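(* Let $k\ge1$. The $\mathfrak S_k$-cycle index of the $\mathfrak S_k$-species $\mathcal{CT}_k^Y$ is characterized by (i.e. satisfies, and is determined by) the recursive functional equations $$Z^{\mathfrak S_k}_{\mathcal{CT}^Y_k}=Z^{\mathfrak S_k}_{Y}\cdot\big(Z^{\mathfrak S_k}_{\mathcal E}\circ Z^{\mathfrak S_k}_{F_k}\big),$$ $$Z^{\mathfrak S_k}_{F_k}(\sigma)=p_1[x]\cdot\prod_{c\in C(\sigma)}Z^{\mathfrak S_k}_{\mathcal{CT}^Y_k}\Big(\prod_{i\in c}\rho_i(\sigma)\Big)\big(p_{|c|}[x],p_{2|c|}[x],\dots;\,p_{|c|}[y],p_{2|c|}[y],\dots\big)\qquad(\sigma\in\mathfrak S_k).$$ Here $\circ$ is plethysm of $\mathfrak S_k$-species, $\mathcal E$ is the $\mathfrak S_k$-species of sets with trivial $\mathfrak S_k$-action, $Y$ is the $\mathfrak S_k$-species of $Y$-labeled singletons with trivial $\mathfrak S_k$-action, $C(\sigma)$ is the set of cycles of $\sigma$ as a permutation of $[k]$ (fixed points included), and the product $\prod_{i\in c}\rho_i(\sigma)$ is taken in order with respect to any choice of linearization of the cyclic order of the elements of $c$.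
   Context: **$k$-coding trees.** A $k$-coding tree is a finite tree with vertices colored black and white, each edge joining a black and a white vertex, in which every black vertex has exactly $k+1$ (white) neighbors and carries a cyclic ordering of them (white vertices may have any number of black neighbors; a single white vertex is allowed). Black vertices are labeled by sort $X$ and white vertices by sort $Y$. $\mathcal{CT}_k^Y$ is the two-sort species of $k$-coding trees rooted at a white vertex. **Actions.** $\mathfrak S_m$ is the symmetric group on $[m]=\{1,\dots,m\}$ and $\mathfrak S_k\subset\mathfrak S_{k+1}$ is the subgroup fixing $k+1$. For $\sigma\in\mathfrak S_{k+1}$, $i\in[k+1]$, let $\rho_i(\sigma)\in\mathfrak S_{k+1}$ be $a\mapsto\sigma(i+a)-\sigma(i)$, with sums and differences reduced modulo $k+1$ to representatives in $\{1,\dots,k+1\}$; $\rho_i(\sigma)$ fixes $k+1$, so lies in $\mathfrak S_k$. In a $\mathcal{CT}^Y_k$-structure, the cyclic order at each black vertex is linearized by putting its parent (the neighbor toward the root) last, in position $k+1$. Thus a $\mathcal{CT}_k^Y$-structure is a root label $y$ together with a set of $F_k$-structures $(x;W_1,\dots,W_k)$, where $F_k=X\cdot\mathcal L_k(\mathcal{CT}_k^Y)$ ($\mathcal L_k$: linear orders on $k$-sets), $x$ is a black label and the $W_i$ are $\mathcal{CT}_k^Y$-structures. Recursively, $\sigma\in\mathfrak S_k$ acts on $F_k$ by $(x;W_1,\dots,W_k)\mapsto(x;W'_1,\dots,W'_k)$ with $W'_{\sigma(i)}=\rho_i(\sigma)\cdot W_i$, and on $\mathcal{CT}_k^Y$ by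 fixing $y$ and acting on each $F_k$-structure attached to it. These actions commute with relabeling. (With this action, $F_k$ is not the composite of $\mathfrak S_k$-species $X\cdot\mathcal L_k(\mathcal{CT}^Y_k)$.) **Ordered product.** If $c=(c_1,c_2,\dots,c_m)$ with $\sigma(c_j)=c_{j+1}$ (indices cyclic), the product is the composition $\rho_{c_m}(\sigma)\circ\cdots\circ\rho_{c_2}(\sigma)\circ\rho_{c_1}(\sigma)$. **$\Gamma$-cycle index.** For a two-sort species $F$ with an action of a group $\Gamma$ commuting with relabelings (a $\Gamma$-species) and $\gamma\in\Gamma$, $$Z^\Gamma_F(\gamma)=\sum_{m,n\ge0}\frac1{m!\,n!}\sum_{\mu\in\mathfrak S_m,\nu\in\mathfrak S_n}\left|\mathrm{Fix}(\gamma\cdot F[\mu,\nu])\right|p_\mu[x]\,p_\nu[y],$$ with $p_\mu[x]=\prod_i p_i[x]^{\mu_i}$, $\mu_i$ the number of $i$-cycles of $\mu$ (similarly for $y$). Products of $\Gamma$-cycle indices are pointwise in $\gamma$. Plethysm: for a one-sort $\Gamma$-species $G$, $(Z_G^\Gamma\circ Z_F^\Gamma)(\gamma)$ is obtained from $Z^\Gamma_G(\gamma)$ by replacing each $p_n$ by $Z_F^\Gamma(\gamma^n)(p_n[x],p_{2n}[x],\dots;p_n[y],p_{2n}[y],\dots)$. The notation $Z(\gamma)(p_m[x],p_{2m}[x],\dots;p_m[y],p_{2m}[y],\dots)$ means substituting $p_{jm}$ for $p_j$ in both sets of variables. *)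

(* Defs.v *)
From HB Require Import structures.
From mathcomp Require Import finmap monalg.
From mathcomp Require Import boolp classical_sets cardinality fsbigop.
From mathcomp Require Import all_boot all_order all_algebra all_fingroup.

Set Implicit Arguments.
Unset Strict Implicit.
Unset Printing Implicit Defensive.
Import GRing.Theory.

(* Formal power series over rat in the variables indexed by I (possibly
   infinitely many). A sum \sum_(_ \in A) over a classical set A is 0 by convention
   if it has infinitely many nonzero terms. This never happens in a product or a
   cycle index, and happens in a substitution only if the latter is not defined. *)
Section Series.
Variable I : choiceType.
Local Notation mon := {cmonom I}.
Local Open Scope ring_scope.

Record series := Series { coef : mon -> rat }.

Lemma seriesP (f g : series) : coef f =1 coef g -> f = g.
Proof. by case: f g => f [g] /= /funext->. Qed.

HB.instance Definition _ := gen_eqMixin series.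
HB.instance Definition _ := gen_choiceMixin series.

Definition szero := Series (fun=> 0).
Definition sone := Series (fun m => (m == mone)%:R).
Definition sopp f := Series (fun m => - coef f m).
Definition sadd f g := Series (fun m => coef f m + coef g m).
Definition smul f g := Series (fun m =>
  (\sum_(p \in [set p : mon * mon | mmul p.1 p.2 = m]%classic)
     coef f p.1 * coef g p.2)%R).

Fact saddA : associative sadd.
Proof. by move=> f g h; apply: seriesP => m /=; rewrite addrA. Qed.
Fact saddC : commutative sadd.
Proof. by move=> f g; apply: seriesP => m /=; rewrite addrC. Qed.
Fact sadd0 : left_id szero sadd.
Proof. by move=> f; apply: seriesP => m /=; rewrite add0r. Qed.
Fact saddN : left_inverse szero sopp sadd.
Proof. by move=> f; apply: seriesP => m /=; rewrite addNr. Qed.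
HB.instance Definition _ := GRing.isZmodule.Build series saddA saddC sadd0 saddN.

Lemma finite_mdiv (m : mon) :
  finite_set [set a : mon | exists b, mmul a b = m]%classic.
Proof.
pose T := {ffun finsupp m -> 'I_(mdeg m).+1}.
pose h (t : T) : mon := \big[mmul/mone]_(i : finsupp m)
  iter (t i) (mmul (ucm (val i))) mone.
apply: (@sub_finite_set _ _ [set h t | t in [set: T]%classic]%classic); last first.
  exact/finite_image/finite_finset.
move=> a [b abm]; have leam i : (a i <= m i)%N by rewrite -abm cmM leq_addr.
have lemd i : (m i <= mdeg m)%N.
  rewrite mdegE; case: (mdomP m i) => // i_m.
  by rewrite (big_fsetD1 i) //= leq_addr.
exists [ffun i : finsupp m => inord (a (val i))] => //.
apply/eqP/cmP => j; rewrite /h.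
have itE n i k : iter n (mmul (ucm i)) mone k = (n * (i == k))%N :> nat.
  by elim: n => [|n IH] /=; rewrite ?cm1 // cmM IH cmU mulSn.
have -> (F : finsupp m -> mon) : (\big[mmul/mone]_i F i) j = (\sum_i F i j)%N.
  by elim/big_rec2: _ => [|i y1 y2 _ <-]; rewrite ?cm1 // cmM.
under eq_bigr => i _ do rewrite itE ffunE inordK ?ltnS ?(leq_trans (leam _)) //.
case: (boolP (j \in finsupp m)) => [jm | jm].
  rewrite (bigD1 [` jm]%fset) //= eqxx muln1 big1 ?addn0 // => i.
  by rewrite -val_eqE /= => /negPf->; rewrite muln0.
rewrite big1 => [|i _].
  by move: (leam j) jm; rewrite -cmE_eq0 => /[swap] /eqP ->; case: (a j).
by case: eqVneq => [e|]; rewrite ?muln0 //; move: jm; rewrite -e (valP i).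
Qed.

Lemma coef_smul f g (D : seq mon) m : uniq D ->
    (forall a b, mmul a b = m -> a \in D /\ b \in D) ->
  coef (smul f g) m =
  \sum_(a <- D) \sum_(b <- D) (coef f a * coef g b) *+ (mmul a b == m).
Proof.
move=> uD hD /=; rewrite (fsbig_fwiden [seq p <- [seq (a, b) | a <- D, b <- D]
                                         | mmul p.1 p.2 == m]).
- rewrite big_filter big_mkcond big_allpairs_dep.
  by do 2!apply: eq_bigr => ? _; rewrite mulrb.
- move=> [a b] /= e; rewrite mem_filter /= e eqxx /=.
  by have [aD bD] := hD _ _ e; apply: allpairs_f.
- by rewrite filter_uniq // allpairs_uniq // => -[a b] [].
- by move=> p [/=]; rewrite mem_filter => /andP[/eqP e _] /(_ e).
Qed.

Lemma ex_mdivs (m : mon) : {D : seq mon | uniq D &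
  forall a b, mmul a b = m -> a \in D /\ b \in D}.
Proof.
exists (fset_set [set a : mon | exists b, mmul a b = m]%classic) => [|a b ab].
  exact: fset_uniq.
have fin := finite_mdiv m; rewrite !in_fset_set //.
by split; apply: mem_set; [exists b | exists a; rewrite mulmC].
Qed.

Lemma mdivs_trans (m : mon) (D : seq mon) :
  (forall a b, mmul a b = m -> a \in D /\ b \in D) ->
  forall p q, mmul p q = m ->
    (forall a b, mmul a b = p -> a \in D /\ b \in D) /\
    (forall a b, mmul a b = q -> a \in D /\ b \in D).
Proof.
move=> hD p q pq; split=> a b e; split.
- by case: (hD a (mmul b q)); rewrite ?mulmA ?e.
- by case: (hD b (mmul a q)); rewrite ?mulmA ?(mulmC b) ?e.
- by case: (hD a (mmul b p)); rewrite ?mulmA ?e // mulmC.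
- by case: (hD b (mmul a p)); rewrite ?mulmA ?(mulmC b) ?e // mulmC.
Qed.

Fact smulC : commutative smul.
Proof.
move=> f g; apply: seriesP => m; have [D uD hD] := ex_mdivs m.
rewrite !(coef_smul _ _ uD hD) exchange_big /=.
by do 2!apply: eq_bigr => ? _; rewrite mulrC mulmC.
Qed.

Fact smulDl : left_distributive smul sadd.
Proof.
move=> f g h; apply: seriesP => m; have [D uD hD] := ex_mdivs m.
rewrite [RHS](_ : _ = coef (smul f h) m + coef (smul g h) m) //.
rewrite !(coef_smul _ _ uD hD) -big_split /=; apply: eq_bigr => a _.
by rewrite -big_split /=; apply: eq_bigr => b _; rewrite mulrDl mulrnDl.
Qed.

Fact smul1 : left_id sone smul.
Proof.
move=> f; apply: seriesP => m; have [D uD hD] := ex_mdivs m.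
have [D1 Dm] := hD mone m (mul1m _).
rewrite (coef_smul _ _ uD hD) (bigD1_seq mone) //= [X in _ + X]big1 => [|a /negPf ne].
  rewrite addr0 (bigD1_seq m) //= big1 => [|b /negPf ne].
    by rewrite eqxx mul1m eqxx mul1r addr0.
  by rewrite mul1m ne.
by rewrite big1 // => b _; rewrite ne mul0r mul0rn.
Qed.

Fact smulA : associative smul.
Proof.
move=> f g h; apply: seriesP => m; have [D uD hD] := ex_mdivs m.
rewrite !(coef_smul _ _ uD hD).
transitivity (\sum_(a <- D) \sum_(b <- D) \sum_(c <- D)
  (coef f a * coef g b * coef h c) *+ (mmul (mmul a b) c == m)).
  apply: eq_bigr => a _; under eq_bigr => q _.
    rewrite (_ : _ *+ _ = \sum_(b <- D) \sum_(c <- D)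
       (coef f a * coef g b * coef h c) *+ ((mmul b c == q) && (mmul a q == m))).
      over.
    case: eqVneq => [e|_]; last first.
      by rewrite big1 // => b _; rewrite big1 // => c _; rewrite andbF.
    rewrite (coef_smul _ _ uD (mdivs_trans hD e).2) mulr1n big_distrr.
    apply: eq_bigr => b _; rewrite big_distrr; apply: eq_bigr => c _.
    by rewrite andbT /= mulrnAr mulrA.
  rewrite exchange_big; apply: eq_bigr => b _.
  rewrite exchange_big; apply: eq_bigr => c _ /=.
  rewrite -mulmA; case: (eqVneq (mmul a (mmul b c)) m) => [e|ne].
    have [_ bcD] := hD _ _ e; rewrite (bigD1_seq (mmul b c)) //= e !eqxx.
    by rewrite big1 ?addr0 // => q /negPf; rewrite eq_sym => ->.
  by rewrite big1 // => q _; case: eqVneq => // <-; rewrite (negPf ne).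
apply/esym; under eq_bigr => p _.
  rewrite (_ : (\sum_(c <- D) _) = \sum_(a <- D) \sum_(b <- D) \sum_(c <- D)
     (coef f a * coef g b * coef h c) *+ ((mmul a b == p) && (mmul p c == m))).
    over.
  under eq_bigr => c _.
    rewrite (_ : _ *+ _ = \sum_(a <- D) \sum_(b <- D)
       (coef f a * coef g b * coef h c) *+ ((mmul a b == p) && (mmul p c == m))).
      over.
    case: (eqVneq (mmul p c) m) => [e|_]; last first.
      by rewrite big1 // => a _; rewrite big1 // => b _; rewrite andbF.
    rewrite (coef_smul _ _ uD (mdivs_trans hD e).1) mulr1n big_distrl.
    apply: eq_bigr => a _; rewrite big_distrl; apply: eq_bigr => b _.
    by rewrite andbT /= mulrnAl.
  by rewrite exchange_big; apply: eq_bigr => a _; rewrite exchange_big.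
rewrite exchange_big; apply: eq_bigr => a _.
rewrite exchange_big; apply: eq_bigr => b _.
rewrite exchange_big; apply: eq_bigr => c _ /=.
case: (eqVneq (mmul (mmul a b) c) m) => [e|ne].
  have [abD _] := hD _ _ e; rewrite (bigD1_seq (mmul a b)) //= e !eqxx.
  by rewrite big1 ?addr0 // => q /negPf; rewrite eq_sym => ->.
by rewrite big1 // => q _; case: eqVneq => // <-; rewrite (negPf ne).
Qed.

Fact sone_neq0 : sone != szero.
Proof.
by apply/eqP => /(congr1 (coef^~ mone)) /= /eqP; rewrite eqxx oner_eq0.
Qed.

HB.instance Definition _ := GRing.Zmodule_isComNzRing.Build series
  smulA smulC smul1 smulDl sone_neq0.

Definition var (i : I) := Series (fun m => (m == ucm i)%:R).

End Series.
Arguments sone {I}.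

(* f with each variable i replaced by g i. *)
Definition subst (I J : choiceType) (f : series I) (g : I -> series J) : series J :=
  Series (fun m => \sum_(d \in [set: {cmonom I}]%classic)
    coef f d * coef (\prod_(i <- finsupp d) g i ^+ d i) m)%R.

(* Conventions on permutations. The position a in [k+1] is the residue of a mod k+1
   in 'I_k.+1, so that position k+1 is ord0 and the elements of [k] are the
   [lift ord0 i] with i : 'I_k. Products in 'S_n are composed from left to right:
   (s * t) i = t (s i). *)
Section Rho.
Variable k : nat.
Local Open Scope group_scope.

Definition emb (s : 'S_k) : 'S_k.+1 := lift_perm ord0 ord0 s.

Lemma emb0 s : emb s ord0 = ord0. Proof. exact: lift_perm_id. Qed.

Lemma emb_lift s i : emb s (lift ord0 i) = lift ord0 (s i).
Proof. exact: lift_perm_lift. Qed.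

Lemma emb1 : emb 1 = 1. Proof. exact: lift_perm1. Qed.

Lemma embM s t : emb (s * t) = emb s * emb t.
Proof. exact/esym/lift_permM. Qed.

Lemma emb_inj : injective emb.
Proof.
move=> s t e; apply/permP => i.
by have := congr1 (fun u : 'S_k.+1 => u (lift ord0 i)) e; rewrite !emb_lift => /lift_inj.
Qed.

Definition rho_ext (i : 'I_k.+1) (s : 'S_k) (a : 'I_k.+1) : 'I_k.+1 :=
  (emb s (i + a)%R - emb s i)%R.

Lemma rho_ext_inj i s : injective (rho_ext i s).
Proof. by move=> a b /addIr /perm_inj /addrI. Qed.

Lemma rho_ext0 i s : rho_ext i s ord0 = ord0.
Proof. by rewrite /rho_ext (addr0 i : (i + ord0)%R = i) subrr. Qed.

Definition rho_fun i s (a : 'I_k) : 'I_k :=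
  odflt a (unlift ord0 (rho_ext i s (lift ord0 a))).

Lemma lift_rho_fun i s a :
  lift ord0 (rho_fun i s a) = rho_ext i s (lift ord0 a).
Proof.
rewrite /rho_fun; case: unliftP => // e; case/eqP: (neq_lift ord0 a).
by apply: (@rho_ext_inj i s); rewrite rho_ext0 e.
Qed.

Lemma rho_fun_inj i s : injective (rho_fun i s).
Proof.
move=> a b /(congr1 (lift ord0)); rewrite !lift_rho_fun.
by move/rho_ext_inj/lift_inj.
Qed.

Definition rho i s : 'S_k := perm (@rho_fun_inj i s).

Lemma emb_rho i s a : emb (rho i s) a = (emb s (i + a) - emb s i)%R.
Proof.
rewrite -/(rho_ext i s a); case: (unliftP ord0 a) => [b|] ->.
  by rewrite emb_lift permE lift_rho_fun.
by rewrite emb0 rho_ext0.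
Qed.

Lemma rho1 i : rho i 1 = 1.
Proof.
apply: emb_inj; apply/permP => a.
by rewrite emb_rho !emb1 !perm1 addrC addKr.
Qed.

Lemma rhoM i s t : rho i (s * t) = rho i s * rho (emb s i) t.
Proof.
apply: emb_inj; apply/permP => a.
rewrite embM permM !emb_rho embM !permM; congr (emb t _ - _)%R.
by rewrite [RHS]addrC subrK.
Qed.

End Rho.

Section Tree.
Variables (T : finType) (e : rel T).

Definition del (v : T) : rel T := [rel x y | [&& e x y, x != v & y != v]].

(* u is the neighbor of v on the way to r. *)
Definition toward (r v u : T) := e v u && connect (del v) u r.

Definition is_tree (D : {set T}) : Prop :=
  {in D &, forall u v, connect e u v} /\
  (forall c : seq T, ucycle e c -> size c <= 2).

Hypothesis eC : symmetric e.
Hypothesis e_irr : irreflexive e.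
Hypothesis acyclic : forall c : seq T, ucycle e c -> size c <= 2.

Lemma delE v x y : del v x y = [&& e x y, x != v & y != v]. Proof. by []. Qed.

Lemma del_sym v : symmetric (del v).
Proof. by move=> x y; rewrite !delE eC; congr andb; exact: andbC. Qed.

Lemma toward_uniq r v u1 u2 : toward r v u1 -> toward r v u2 -> u1 = u2.
Proof.
case/andP=> e1 c1 /andP[e2 c2]; apply/eqP/contraT => ne.
have: connect (del v) u1 u2.
  by apply: connect_trans c1 _; rewrite (sym_connect_sym (@del_sym v)).
case/connectP => p0 pp l0; case/shortenP: pp l0 => p pp up _ lp.
have sub : subrel (del v) e by move=> x y /andP[].
have vNp : v \notin p.
  elim: p u1 pp {e1 c1 ne up lp} => //= y p IH x /andP[/and3P[_ _ yv] /IH vp].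
  by rewrite inE negb_or eq_sym yv.
have v1 : v != u1 by apply: contraTneq e1 => ->; rewrite e_irr.
have : ucycle e (v :: u1 :: p).
  rewrite /ucycle /= rcons_path -lp e1 eC e2 (sub_path sub pp) /= inE negb_or v1.
  by rewrite vNp -[_ && uniq p]/(uniq (u1 :: p)) up.
move/acyclic; case: p {pp up vNp} lp => //= lp.
by case/eqP: ne.
Qed.

Lemma toward_child r v u u' : u != r -> v != r ->
  e v u -> toward r u u' -> u' != v -> toward r v u.
Proof.
move=> ur vr evu /andP[euu' c] u'v; rewrite /toward evu /=.
have /negP nv : ~ connect (del u) v r.
  move=> cv; case/eqP: u'v; apply: (@toward_uniq r u); first by rewrite /toward euu'.
  by rewrite /toward eC evu.
have cc : connect (del v) u' r.
  case/connectP: c => p pp lp; elim: p u' pp lp u'v {euu'} => /= [|y p IH] x.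
    by move=> _ -> _; exact: connect0.
  case/andP=> dxy pp lp xv; have yv : y != v.
    apply: contraNneq nv => <-; apply/connectP; by exists p.
  apply: connect_trans (IH y pp lp yv); apply: connect1.
  by case/and3P: dxy => exy _ _; rewrite delE exy xv yv.
apply: connect_trans cc; apply: connect1; rewrite delE euu' u'v andbT.
by apply: contraTneq evu => ->; rewrite e_irr.
Qed.

Lemma toward_ex r v : connect e v r -> v != r -> exists u, toward r v u.
Proof.
case/connectP => p0 pp l0; case/shortenP: pp l0 => p pp up _ lp vr.
case: p pp up lp => [|u p] /=; first by move=> _ _ e'; rewrite e' eqxx in vr.
case/andP=> evu pp /andP[vN _] lp; exists u; rewrite /toward evu /=.
apply/connectP; exists p => //; elim: p u pp vN {evu lp} => //= y p IH x.
case/andP=> exy pp; rewrite !inE !negb_or => /and3P[vx vy vp].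
by rewrite delE exy ![_ == v]eq_sym vx vy IH // inE negb_or vy.
Qed.

End Tree.

Section Pretree.
Variables (k : nat) (U V : finType).
Local Open Scope group_scope.

(* A white-rooted tree with labels among U (black) and V (white) is given by its
   root t.1 and the set t.2 of the pairs (b, s) where s lists the k+1 neighbors of
   the black vertex b according to its cyclic order; a cyclic order is thus a class
   of listings modulo rotation. Only the labels in [blacks t] and [whites t] are
   used as vertices; a white vertex other than the root has a black neighbor. *)
Definition pretree : finType := (V * {set U * {ffun 'I_k.+1 -> V}})%type.

Implicit Types (t : pretree) (s : {ffun 'I_k.+1 -> V}).

Definition adj t : rel (U + V)%type := fun x y =>
  match x, y with
  | inl b, inr w | inr w, inl b => [exists s, ((b, s) \in t.2) && (w \in codom s)]
  | _, _ => false
  end.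

Definition blacks t : {set U} := [set p.1 | p in t.2].
Definition whites t : {set V} :=
  t.1 |: [set w | [exists b, adj t (inl b) (inr w)]].
Definition vertices t : {set U + V} :=
  [set x | match x with inl b => b \in blacks t | inr w => w \in whites t end].

Definition rotate (i : 'I_k.+1) s : {ffun 'I_k.+1 -> V} := [ffun a => s (a + i)%R].

Definition coding_tree t : Prop :=
  is_tree (adj t) (vertices t) /\
  forall b s, (b, s) \in t.2 ->
    injective s /\ forall s', (b, s') \in t.2 <-> exists i, s' = rotate i s.

(* s lists the neighbors of b linearly with the parent of b in position k+1. *)
Definition lin t (b : U) s : Prop :=
  (b, s) \in t.2 /\ toward (adj t) (inr t.1) (inl b) (inr (s ord0)).

(* [twist t sigma b tau]: when sigma acts on t, the children of the black vertex b
   get permuted by tau. This is sigma itself if b is attached to the root, and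
   rho_i(tau) if b is attached to the i-th child of a black vertex b' at which tau
   acts. *)
Inductive twist t (sigma : 'S_k) : U -> 'S_k -> Prop :=
| twist_root b s :
    lin t b s -> s ord0 = t.1 -> twist t sigma b sigma
| twist_child b s b' s' (i : 'I_k) tau :
    lin t b s -> lin t b' s' -> s ord0 = s' (lift ord0 i) ->
    twist t sigma b' tau -> twist t sigma b (rho (lift ord0 i) tau).

(* The vertex at position a moves to position tau a. *)
Definition permute (tau : 'S_k) s : {ffun 'I_k.+1 -> V} :=
  [ffun a => s ((emb tau)^-1 a)].

Definition tree_act t (sigma : 'S_k) : pretree :=
  (t.1, [set p | `[< exists s tau i,
     [/\ lin t p.1 s, twist t sigma p.1 tau & p.2 = rotate i (permute tau s)] >]]).

Lemma rotate0 s : rotate 0%R s = s.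
Proof. by apply/ffunP => a; rewrite ffunE addr0. Qed.

Lemma rotateD i j s : rotate i (rotate j s) = rotate (i + j)%R s.
Proof. by apply/ffunP => a; rewrite !ffunE addrA. Qed.

Lemma rotate_inj i s : injective s -> injective (rotate i s).
Proof. by move=> si a b; rewrite !ffunE => /si /addIr. Qed.

Lemma permute_inj tau s : injective s -> injective (permute tau s).
Proof. by move=> si a b; rewrite !ffunE => /si /perm_inj. Qed.

Lemma permute0 tau s : permute tau s ord0 = s ord0.
Proof. by rewrite ffunE -{1}(emb0 tau) permK. Qed.

Lemma permuteE tau s i : permute tau s (emb tau i) = s i.
Proof. by rewrite ffunE permK. Qed.

Lemma permute1 s : permute 1 s = s.
Proof. by apply/ffunP => a; rewrite ffunE emb1 invg1 perm1. Qed.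

Lemma permuteM tau tau' s : permute tau' (permute tau s) = permute (tau * tau') s.
Proof. by apply/ffunP => a; rewrite !ffunE embM invMg permM. Qed.

Lemma adjC t : symmetric (adj t).
Proof. by case=> [b|w] [b'|w']. Qed.

Lemma adj_irr t : irreflexive (adj t).
Proof. by case. Qed.

Lemma adjP t b w :
  reflect (exists s i, (b, s) \in t.2 /\ s i = w) (adj t (inl b) (inr w)).
Proof.
apply: (iffP existsP) => [[s /andP[bs /codomP[i ->]]]|[s [i [bs <-]]]].
  by exists s, i.
by exists s; rewrite bs codom_f.
Qed.

Section Valid.
Variable t : pretree.
Hypothesis tv : coding_tree t.

Let acyc : forall c, ucycle (adj t) c -> size c <= 2 := tv.1.2.
Let tw := toward_uniq (@adjC t) (@adj_irr t) acyc.

Lemma lin_uniq b s s' : lin t b s -> lin t b s' -> s = s'.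
Proof.
move=> [bs ts] [bs' ts']; have [e] := tw ts ts'.
have [si /(_ s')[/(_ bs')[i es'] _]] := tv.2 _ _ bs.
move: e; rewrite es' ffunE => /si; rewrite (add0r i : (ord0 + i)%R = i) => <-.
by rewrite (rotate0 s).
Qed.

Lemma lin_nb b s0 w : lin t b s0 -> adj t (inl b) (inr w) -> exists i, s0 i = w.
Proof.
case=> bs0 _ /adjP[s [i [bs <-]]].
have [_ /(_ s)[/(_ bs)[j ->] _]] := tv.2 _ _ bs0.
by exists (i + j)%R; rewrite ffunE.
Qed.

Lemma lin_at b w : toward (adj t) (inr t.1) (inl b) (inr w) ->
  exists2 s, lin t b s & s ord0 = w.
Proof.
move=> tbw; have /andP[/adjP[s [i [bs e]]] _] := tbw.
have e0 : rotate i s ord0 = w by rewrite ffunE (add0r i : (ord0 + i)%R = i).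
exists (rotate i s) => //; split; last by rewrite e0.
by have [_ /(_ (rotate i s)) ->] := tv.2 _ _ bs; exists i.
Qed.

Lemma black_root b s : (b, s) \in t.2 -> connect (adj t) (inl b) (inr t.1).
Proof.
move=> bs; apply: tv.1.1; rewrite inE; last exact: setU11.
by apply/imsetP; exists (b, s).
Qed.

Lemma lin_ex b s : (b, s) \in t.2 -> exists s0, lin t b s0.
Proof.
move=> /black_root cb; have [//|[b'|w] tbw] := toward_ex cb; first by case/andP: tbw.
by have [s0 ls _] := lin_at tbw; exists s0.
Qed.

Lemma toward_root u : ~ toward (adj t) (inr t.1) (inr t.1) u.
Proof.
case/andP=> au /connectP[p]; case: p => [_ e|v p /= /andP[+ pp] e].
  by rewrite e adj_irr in au.
elim: p v u {au} pp e => [|y p IH] v u /= pp e.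
  by rewrite delE -e eqxx !andbF.
by case/andP: pp => yp pp _; apply: IH yp.
Qed.

Lemma lin_child b b' s s' i : lin t b s -> lin t b' s' ->
  s ord0 = s' (lift ord0 i) ->
  toward (adj t) (inr t.1) (inr (s ord0)) (inl b').
Proof.
move=> ls [bs' ts'] e; have [si' _] := tv.2 _ _ bs'.
have ab : adj t (inr (s ord0)) (inl b').
  by rewrite adjC; apply/adjP; exists s', (lift ord0 i).
have ne : s' ord0 != s ord0.
  by rewrite e; apply/negP => /eqP/si'/eqP; rewrite (negPf (neq_lift _ _)).
apply: (toward_child (@adjC t) (@adj_irr t) acyc _ _ ab ts') => //.
apply/eqP => -[er]; have [eq0] : inr (s' ord0) = inr t.1 :> U + V.
  apply: tw ts' _; rewrite /toward connect0 andbT -er.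
  by rewrite adjC.
by rewrite eq0 er eqxx in ne.
Qed.

Lemma twist_uniq sigma b tau tau' :
  twist t sigma b tau -> twist t sigma b tau' -> tau = tau'.
Proof.
move=> h; elim: h tau' => {b tau} [b s ls s0|b s b' s' i tau ls ls' e h IH] tau' h'.
  case: h' ls s0 => // {}b {}s1 b' s' i tau ls1 ls' e _ ls s0.
  have := lin_child ls1 ls' e; rewrite (lin_uniq ls1 ls) s0.
  by move/toward_root.
case: h' ls => [{}b s1 ls1 s0|{}b s1 b1 s1' j tau1 ls1 ls1' e1 h1] ls.
  have := lin_child ls ls' e; rewrite (lin_uniq ls ls1) s0.
  by move/toward_root.
have := lin_child ls1 ls1' e1; rewrite -(lin_uniq ls ls1) => t1.
have [eb] := tw (lin_child ls ls' e) t1.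
rewrite -{}eb in ls1' h1 *; rewrite -(lin_uniq ls' ls1') in e1.
have [si' _] := tv.2 _ _ ls'.1.
have -> : i = j.
  by apply: (@lift_inj _ ord0); apply: si'; rewrite -e -e1 (lin_uniq ls ls1).
by rewrite (IH _ h1).
Qed.

Lemma toward_path (v u : U + V) p : path (adj t) v (u :: p) -> uniq (v :: u :: p) ->
  last u p = inr t.1 -> toward (adj t) (inr t.1) v u.
Proof.
case/andP=> evu pp /andP[vN _] lp; rewrite /toward evu /=.
apply/connectP; exists p => //; elim: p u pp vN {evu lp} => //= y p IH x.
case/andP=> exy pp; rewrite !inE !negb_or => /and3P[vx vy vp].
by rewrite delE exy ![_ == v]eq_sym vx vy IH // inE negb_or vy.
Qed.

Lemma twist_ex sigma b s : (b, s) \in t.2 -> exists tau, twist t sigma b tau.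
Proof.
move/black_root => /connectP[p0 pp l0]; case/shortenP: pp l0 => p pp up _ /esym lp.
have [n] := ubnP (size p); elim: n b p pp up lp => // n IH b p pp up lp.
case: p pp up lp => [//|[b1|w] p] // pp up lp sp.
have tbw := toward_path pp up lp.
have [s1 ls1 e1] := lin_at tbw.
case: p pp up lp sp => [|[b'|w'] p].
- by move=> _ _ /= [ew] _; exists sigma; apply: (twist_root _ ls1); rewrite e1.
- move=> /= /and3P[_ wb' pp] /andP[_ /andP[wN up]] lp sp.
  have [|tau h] := IH b' p pp up lp; first by rewrite -ltnS ltnW.
  case: p pp up lp wN {sp} => [//|[b2|w'] p] // pp up lp wN.
  have [s' ls' e'] := lin_at (toward_path pp up lp).
  have [j ej] := lin_nb ls' wb'.
  case: (unliftP ord0 j) ej => [i|] -> ej; last first.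
    by move: wN; rewrite -ej e' !inE eqxx !orbT.
  by exists (rho (lift ord0 i) tau); apply: (twist_child ls1 ls') => //; rewrite e1.
- by rewrite /= andbF.
Qed.

Variable sigma : 'S_k.
Let t' := tree_act t sigma.

Lemma mem_act b s0 tau s' : lin t b s0 -> twist t sigma b tau ->
  (b, s') \in t'.2 <-> exists i, s' = rotate i (permute tau s0).
Proof.
move=> ls h; rewrite inE; split=> [/asboolP[s [tau1 [i [/= ls1 h1 ->]]]]|[i ->]].
  by exists i; rewrite (lin_uniq ls ls1) (twist_uniq h h1).
by apply/asboolP; exists s0, tau, i.
Qed.

Lemma act_mem b s' : (b, s') \in t'.2 ->
  exists s tau i, [/\ lin t b s, twist t sigma b tau & s' = rotate i (permute tau s)].
Proof. by rewrite inE => /asboolP. Qed.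

Lemma adj_act : adj t' = adj t.
Proof.
have E b w : adj t' (inl b) (inr w) = adj t (inl b) (inr w).
  apply/adjP/idP => [[s' [i [/act_mem[s [tau [j [ls h ->]]]] <-]]]|abw].
    by rewrite !ffunE; apply/adjP; exists s, (perm_inv (emb tau) (i + j)%R); case: ls.
  have /adjP[s [i [bs _]]] := abw; have [s0 ls] := lin_ex bs.
  have [tau h] := twist_ex sigma bs; have [j <-] := lin_nb ls abw.
  exists (permute tau s0), (emb tau j); rewrite permuteE; split=> //.
  by apply/(mem_act _ ls h); exists 0%R; rewrite rotate0.
by apply/funext => -[b|w]; apply/funext => -[b'|w'] //; rewrite ?[adj _ (inr _) _]adjC E.
Qed.

Lemma blacks_act : blacks t' = blacks t.
Proof.
apply/setP => b; apply/imsetP/imsetP => [[[b1 s'] /act_mem + ->] /=|[[b1 s] bs ->] /=].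
  by case=> [s [tau [i [[bs _] _ _]]]]; exists (b1, s).
have [s0 ls] := lin_ex bs; have [tau h] := twist_ex sigma bs.
exists (b1, permute tau s0) => //; apply/(mem_act _ ls h).
by exists 0%R; rewrite rotate0.
Qed.

Lemma whites_act : whites t' = whites t.
Proof. by rewrite /whites adj_act. Qed.

Lemma coding_tree_act : coding_tree t'.
Proof.
split; first by rewrite /vertices blacks_act whites_act adj_act; exact: tv.1.
move=> b s' bs'; have [s [tau [i [ls h ->]]]] := act_mem bs'.
have [si _] := tv.2 _ _ ls.1; split; first exact/rotate_inj/permute_inj.
move=> s1; rewrite (mem_act _ ls h); split=> -[j ->].
  by exists (j - i)%R; rewrite rotateD subrK.
by exists (j + i)%R; rewrite rotateD.
Qed.

Lemma lin_act b s tau : lin t b s -> twist t sigma b tau -> lin t' b (permute tau s).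
Proof.
move=> ls h; split; last by rewrite adj_act permute0; case: ls.
by apply/(mem_act _ ls h); exists 0%R; rewrite rotate0.
Qed.

Lemma twist_act sigma' b tau : twist t sigma b tau ->
  exists2 tau', twist t' sigma' b tau' & twist t (sigma * sigma') b (tau * tau').
Proof.
elim=> {b tau} [b s ls s0|b s b' s' i tau ls ls' e h [tau' h1 h2]].
  exists sigma'; last exact: twist_root ls s0.
  apply: (@twist_root t' _ b (permute sigma s)); last by rewrite permute0.
  exact/lin_act/twist_root/s0.
exists (rho (lift ord0 (tau i)) tau').
  have hb := twist_child ls ls' e h.
  apply: (twist_child (lin_act ls hb) (lin_act ls' h)) => //.
  by rewrite permute0 e -emb_lift permuteE.
by rewrite -emb_lift -rhoM; apply: twist_child ls ls' e h2.
Qed.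

End Valid.

Lemma tree_act1 t : coding_tree t -> tree_act t 1 = t.
Proof.
move=> tv; have tw1 b tau : twist t 1 b tau -> tau = 1.
  by elim=> // {b tau} b s b' s' i tau _ _ _ _ ->; rewrite rho1.
rewrite /tree_act [RHS]surjective_pairing; congr pair; apply/setP => -[b s'].
rewrite inE; apply/asboolP/idP => /= [[s [tau [i [ls /tw1-> ->]]]]|bs'].
  by rewrite permute1; case: (tv.2 _ _ ls.1) => _ ->; exists i.
have [s ls] := lin_ex tv bs'; have [tau h] := twist_ex tv 1 bs'.
have [_ /(_ s')[/(_ bs')[i ->] _]] := tv.2 _ _ ls.1.
by exists s, 1, i; rewrite permute1 -{2}(tw1 _ _ h).
Qed.

Lemma tree_actM t sigma sigma' : coding_tree t ->
  tree_act t (sigma * sigma') = tree_act (tree_act t sigma) sigma'.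
Proof.
move=> tv; have t'v := coding_tree_act tv sigma.
rewrite /tree_act; congr pair; apply/setP => -[b s2]; rewrite !inE.
apply/asboolP/asboolP => /= -[s [tau [i [ls h ->]]]].
  have [tau1 h1] := twist_ex tv sigma ls.1.
  have [tau2 h2 h12] := twist_act tv sigma' h1.
  exists (permute tau1 s), tau2, i; rewrite permuteM (twist_uniq tv h h12).
  by split=> //; apply: lin_act.
have [s1 [tau1 [_ [ls1 h1 _]]]] := act_mem ls.1.
have [tau2 h2 h12] := twist_act tv sigma' h1.
exists s1, (tau1 * tau2), i; split=> //.
rewrite -permuteM (lin_uniq t'v ls (lin_act tv ls1 h1)).
by rewrite (twist_uniq t'v h h2).
Qed.

End Pretree.

Section Relabel.
Variable k : nat.

Definition relabel (U U' V V' : finType) (f : U -> U') (g : V -> V')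
    (t : pretree k U V) : pretree k U' V' :=
  (g t.1, [set (f p.1, [ffun a => g (p.2 a)]) | p : U * {ffun 'I_k.+1 -> V} in t.2]).

Lemma relabel_id (U V : finType) (t : pretree k U V) : relabel id id t = t.
Proof.
rewrite /relabel [RHS]surjective_pairing; congr pair.
rewrite -[RHS]imset_id; apply: eq_imset => -[b s] /=; congr pair.
by apply/ffunP => a; rewrite ffunE.
Qed.

Lemma relabel_comp (U U' U'' V V' V'' : finType) (f : U -> U') (g : V -> V')
    (f' : U' -> U'') (g' : V' -> V'') (t : pretree k U V) :
  relabel (f' \o f) (g' \o g) t = relabel f' g' (relabel f g t).
Proof.
rewrite /relabel /=; congr pair; rewrite -imset_comp; apply: eq_imset => p /=.
by congr pair; apply/ffunP => a; rewrite !ffunE.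
Qed.

Section Bij.
Variables (U U' V V' : finType) (f : U -> U') (g : V -> V').
Hypotheses (bf : bijective f) (bg : bijective g).
Implicit Type t : pretree k U V.

Definition smap (x : U + V) : U' + V' :=
  match x with inl b => inl (f b) | inr w => inr (g w) end.

Lemma smap_inj : injective smap.
Proof.
by case=> [b|w] [b'|w'] //= []; [move/(bij_inj bf)-> | move/(bij_inj bg)->].
Qed.

Lemma mem_relabel t b s : (b, s) \in t.2 -> (f b, [ffun a => g (s a)]) \in (relabel f g t).2.
Proof. by move=> bs; apply/imsetP; exists (b, s). Qed.

Lemma adj_relabel t x y : adj (relabel f g t) (smap x) (smap y) = adj t x y.
Proof.
have E b w : adj (relabel f g t) (inl (f b)) (inr (g w)) = adj t (inl b) (inr w).
  apply/adjP/adjP => -[s [i [bs e]]]; last first.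
    by exists [ffun a => g (s a)], i; rewrite ffunE e mem_relabel.
  case/imsetP: bs e => -[b1 s1] bs [/(bij_inj bf)-> ->].
  by rewrite ffunE => /(bij_inj bg) e; exists s1, i.
case: x y => [b|w] [b'|w'] //; first exact: E.
by rewrite [LHS]adjC [RHS]adjC; exact: E.
Qed.

Lemma connect_smap (e : rel (U + V)) (e' : rel (U' + V')) x y :
  (forall x y, e x y -> e' (smap x) (smap y)) ->
  connect e x y -> connect e' (smap x) (smap y).
Proof.
move=> h /connectP[p pp ->]; apply/connectP; exists (map smap p).
  by rewrite (homo_path h).
by rewrite last_map.
Qed.

Lemma toward_relabel t r v u : toward (adj t) r v u ->
  toward (adj (relabel f g t)) (smap r) (smap v) (smap u).
Proof.
case/andP=> a c; rewrite /toward adj_relabel a /=.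
by apply: connect_smap c => x y; rewrite !delE adj_relabel !(inj_eq smap_inj).
Qed.

Lemma lin_relabel t b s : lin t b s ->
  lin (relabel f g t) (f b) [ffun a => g (s a)].
Proof.
case=> bs ts; split; first exact: mem_relabel.
by rewrite ffunE; apply: (toward_relabel ts).
Qed.

Lemma twist_relabel t sigma b tau : twist t sigma b tau ->
  twist (relabel f g t) sigma (f b) tau.
Proof.
elim=> {b tau} [b s ls s0|b s b' s' i tau ls ls' e _ h].
  by apply: (twist_root _ (lin_relabel ls)); rewrite ffunE s0.
by apply: (twist_child (lin_relabel ls) (lin_relabel ls') _ h); rewrite !ffunE e.
Qed.

Lemma act_relabel_sub t sigma :
  (relabel f g (tree_act t sigma)).2 \subset (tree_act (relabel f g t) sigma).2.
Proof.
apply/subsetP => _ /imsetP[[b s'] /act_mem[s [tau [i [ls h ->]]]] ->] /=.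
rewrite inE; apply/asboolP; exists [ffun a => g (s a)], tau, i; split=> /=.
- exact: lin_relabel.
- exact: twist_relabel.
- by apply/ffunP => a; rewrite !ffunE.
Qed.

Lemma blacks_relabel t : blacks (relabel f g t) = f @: blacks t.
Proof. by rewrite /blacks /relabel -!imset_comp. Qed.

Lemma whites_relabel t : whites (relabel f g t) = g @: whites t.
Proof.
case: (bf) (bg) => f' fK f'K [g' gK g'K].
apply/setP => w; rewrite -{1}[w]g'K -[w in RHS]g'K mem_imset; last exact: can_inj gK.
have E b v := adj_relabel t (inl b) (inr v).
rewrite !inE (can_eq gK); congr orb; apply/existsP/existsP => -[b].
  by rewrite -[b]f'K => ab; exists (f' b); rewrite -E.
by rewrite -E => ab; exists (f b).
Qed.

End Bij.

Section Bij2.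
Variables (U U' V V' : finType) (f : U -> U') (g : V -> V').
Hypotheses (bf : bijective f) (bg : bijective g).
Implicit Type t : pretree k U V.

Lemma relabelK f' g' t : cancel f f' -> cancel g g' ->
  relabel f' g' (relabel f g t) = t.
Proof.
move=> fK gK; rewrite -relabel_comp -[RHS]relabel_id; congr (relabel _ _ t).
  by apply/funext => x /=; rewrite fK.
by apply/funext => x /=; rewrite gK.
Qed.

Lemma act_relabel t sigma :
  tree_act (relabel f g t) sigma = relabel f g (tree_act t sigma).
Proof.
case: (bf) (bg) => f' fK f'K [g' gK g'K].
rewrite [LHS]surjective_pairing [RHS]surjective_pairing; congr pair.
apply/eqP; rewrite eqEsubset act_relabel_sub // andbT.
set t' := relabel f g t.
have -> : tree_act t' sigma = relabel f g (relabel f' g' (tree_act t' sigma)).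
  rewrite -relabel_comp -[LHS]relabel_id; congr (relabel _ _ _).
    by apply/funext => x /=; rewrite f'K.
  by apply/funext => x /=; rewrite g'K.
apply: imsetS.
have bf' : bijective f' by exists f.
have bg' : bijective g' by exists g.
have := act_relabel_sub bf' bg' t' sigma.
by rewrite {2}/t' relabelK.
Qed.

Lemma coding_tree_relabel t : coding_tree t -> coding_tree (relabel f g t).
Proof.
case: (bf) (bg) => f' fK f'K [g' gK g'K] tv.
pose h := smap f g; pose h' := smap f' g'.
have hK : cancel h h' by case=> x /=; rewrite ?fK ?gK.
have h'K : cancel h' h by case=> x /=; rewrite ?f'K ?g'K.
have vE x : (h x \in vertices (relabel f g t)) = (x \in vertices t).
  rewrite !inE; case: x => [b|w] /=; rewrite ?blacks_relabel ?whites_relabel //.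
    by rewrite mem_imset //; apply: can_inj fK.
  by rewrite mem_imset //; apply: can_inj gK.
split; first split.
- move=> x y; rewrite -[x]h'K -[y]h'K !vE => vx vy.
  by apply: connect_smap (tv.1.1 _ _ vx vy) => u v; rewrite adj_relabel.
- move=> c /andP[cc uc]; rewrite -(size_map h'); apply: tv.1.2.
  rewrite /ucycle map_inj_uniq ?uc ?andbT; last exact: can_inj h'K.
  case: c cc {uc} => //= x c; rewrite -map_rcons; apply: homo_path => {x c} x y.
  by rewrite -{1}[x]h'K -{1}[y]h'K adj_relabel.
- move=> _ _ /imsetP[[b s] bs [-> ->]] /=.
  have [si sE] := tv.2 _ _ bs; split.
    by move=> a a'; rewrite !ffunE => /(can_inj gK)/si.
  move=> s'; split=> [/imsetP[[b1 s1] bs1 [/(can_inj fK) eb ->]]|[i ->]].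
    rewrite -eb in bs1; have [i ->] := (sE s1).1 bs1.
    by exists i; apply/ffunP => a; rewrite !ffunE.
  apply/imsetP; exists (b, rotate i s); first by apply/sE; exists i.
  by congr pair; apply/ffunP => a; rewrite !ffunE.
Qed.

End Bij2.
End Relabel.

Section Species.
Variable gT : finGroupType.

(* Species with one (resp. two) sorts of labels, together with an action of gT
   commuting with relabelings. In MathComp an action satisfies
   act z (g * h) = act (act z g) h, which for a group of permutations is an action
   on the left, because of the order of composition. *)
Record species1 := Species1 {
  str1 :> finType -> finType;
  map1 : forall (U U' : finType) (f : U -> U'), bijective f -> str1 U -> str1 U';
  act1 : forall U : finType, {action gT &-> str1 U};
  map1_id : forall (U : finType) (bf : bijective (@id U)) z, map1 bf z = z;
  map1_comp : forall (U U' U'' : finType) (f : U -> U') (f' : U' -> U'')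
      (bf : bijective f) (bf' : bijective f') (bff' : bijective (f' \o f)) z,
    map1 bff' z = map1 bf' (map1 bf z);
  map1_act : forall (U U' : finType) (f : U -> U') (bf : bijective f) z gamma,
    map1 bf (act1 U z gamma) = act1 U' (map1 bf z) gamma
}.

Record species2 := Species2 {
  str2 :> finType -> finType -> finType;
  map2 : forall (U U' V V' : finType) (f : U -> U') (g : V -> V'),
    bijective f -> bijective g -> str2 U V -> str2 U' V';
  act2 : forall U V : finType, {action gT &-> str2 U V};
  map2_id : forall (U V : finType) (bf : bijective (@id U)) (bg : bijective (@id V)) z,
    map2 bf bg z = z;
  map2_comp : forall (U U' U'' V V' V'' : finType)
      (f : U -> U') (f' : U' -> U'') (g : V -> V') (g' : V' -> V'')
      (bf : bijective f) (bf' : bijective f') (bff' : bijective (f' \o f))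
      (bg : bijective g) (bg' : bijective g') (bgg' : bijective (g' \o g)) z,
    map2 bff' bgg' z = map2 bf' bg' (map2 bf bg z);
  map2_act : forall (U U' V V' : finType) (f : U -> U') (g : V -> V')
      (bf : bijective f) (bg : bijective g) z gamma,
    map2 bf bg (act2 U V z gamma) = act2 U' V' (map2 bf bg z) gamma
}.

Lemma perm_bij (T : finType) (s : {perm T}) : bijective s.
Proof. exact: injF_bij perm_inj. Qed.

Definition fix1 (F : species1) (gamma : gT) n (mu : 'S_n) : {set F 'I_n} :=
  [set z | act1 F 'I_n (map1 (perm_bij mu) z) gamma == z].

Definition fix2 (F : species2) (gamma : gT) m n (mu : 'S_m) (nu : 'S_n) :
    {set F 'I_m 'I_n} :=
  [set z | act2 F 'I_m 'I_n (map2 (perm_bij mu) (perm_bij nu) z) gamma == z].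

Local Open Scope ring_scope.

(* The variables are p_n, n >= 1: index i : nat stands for p_(i+1), and inl and inr
   distinguish p_n[x] from p_n[y]. *)
Definition pz (n : nat) : series nat := var n.-1.
Definition px (n : nat) : series (nat + nat)%type := var (inl n.-1).
Definition py (n : nat) : series (nat + nat)%type := var (inr n.-1).

Definition p_perm (I : choiceType) (q : nat -> series I) n (mu : 'S_n) : series I :=
  \prod_(c in porbits mu) q #|c|.

Definition cycle_index1 (F : species1) (gamma : gT) : series nat :=
  Series (fun M => \sum_(n \in [set: nat]%classic) n`!%:R^-1 *
    coef (\sum_(mu : 'S_n) p_perm pz mu *+ #|fix1 F gamma mu|) M).

Definition cycle_index2 (F : species2) (gamma : gT) : series (nat + nat)%type :=
  Series (fun M => \sum_(mn \in [set: nat * nat]%classic) (mn.1`! * mn.2`!)%N%:R^-1 *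
    coef (\sum_(mu : 'S_mn.1) \sum_(nu : 'S_mn.2)
            (p_perm px mu * p_perm py nu) *+ #|fix2 F gamma mu nu|) M).

Definition dilate (m : nat) (f : series (nat + nat)%type) : series (nat + nat)%type :=
  subst f (fun i => match i with
                    | inl j => px (j.+1 * m)%N
                    | inr j => py (j.+1 * m)%N
                    end).

Definition plethysm (G : gT -> series nat) (F : gT -> series (nat + nat)%type)
    (gamma : gT) : series (nat + nat)%type :=
  subst (G gamma) (fun i => dilate i.+1 (F (gamma ^+ i.+1)%g)).

Definition trivial_action (T : Type) : {action gT &-> T} :=
  @TotalAction gT T (fun z _ => z) (fun=> erefl) (fun _ _ _ => erefl).

(* Exactly one structure, the set U itself, on each label set U. *)
Definition set_species : species1 :=
  @Species1 (fun=> unit) (fun _ _ _ _ z => z) (fun=> trivial_action unit)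
    (fun _ _ _ => erefl) (fun _ _ _ _ _ _ _ _ _ => erefl)
    (fun _ _ _ _ _ _ => erefl).

Definition Y_str (U V : finType) : finType :=
  {w : V | (#|U| == 0)%N && (#|V| == 1)%N}.

Lemma Y_map_proof (U U' V V' : finType) (f : U -> U') (g : V -> V') :
  bijective f -> bijective g -> (#|U| == 0)%N && (#|V| == 1)%N ->
  (#|U'| == 0)%N && (#|V'| == 1)%N.
Proof. by move=> /bij_eq_card-> /bij_eq_card->. Qed.

Definition Y_map (U U' V V' : finType) (f : U -> U') (g : V -> V')
    (bf : bijective f) (bg : bijective g) (z : Y_str U V) : Y_str U' V' :=
  exist _ (g (val z)) (Y_map_proof bf bg (valP z)).

Lemma Y_map_id (U V : finType) (bf : bijective (@id U)) (bg : bijective (@id V)) z :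
  Y_map bf bg z = z.
Proof. exact: val_inj. Qed.

Lemma Y_map_comp (U U' U'' V V' V'' : finType)
    (f : U -> U') (f' : U' -> U'') (g : V -> V') (g' : V' -> V'')
    (bf : bijective f) (bf' : bijective f') (bff' : bijective (f' \o f))
    (bg : bijective g) (bg' : bijective g') (bgg' : bijective (g' \o g)) z :
  Y_map bff' bgg' z = Y_map bf' bg' (Y_map bf bg z).
Proof. exact: val_inj. Qed.

Definition Y_species : species2 :=
  @Species2 Y_str Y_map (fun U V => trivial_action (Y_str U V))
    Y_map_id Y_map_comp (fun _ _ _ _ _ _ _ _ _ _ => erefl).

End Species.

Section CodingTrees.
Variable k : nat.
Local Open Scope group_scope.

Definition ctY (U V : finType) (t : pretree k U V) : Prop :=
  [/\ coding_tree t, blacks t = [set: U] & whites t = [set: V]].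

Definition CT_str (U V : finType) : finType := {t : pretree k U V | `[< ctY t >]}.

Lemma CT_map_proof (U U' V V' : finType) (f : U -> U') (g : V -> V') t :
  bijective f -> bijective g -> `[< ctY t >] -> `[< ctY (relabel f g t) >].
Proof.
move=> bf bg /asboolP[tv tb tw]; apply/asboolP; split.
- exact: coding_tree_relabel.
- by rewrite blacks_relabel // tb; apply/setP=> b; case: bf => f' fK f'K;
    rewrite inE -[b]f'K imset_f.
- by rewrite whites_relabel // tw; apply/setP=> b; case: bg => f' fK f'K;
    rewrite inE -[b]f'K imset_f.
Qed.

Definition CT_map (U U' V V' : finType) (f : U -> U') (g : V -> V')
    (bf : bijective f) (bg : bijective g) (z : CT_str U V) : CT_str U' V' :=
  exist _ (relabel f g (val z)) (CT_map_proof bf bg (valP z)).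

Lemma CT_act_proof (U V : finType) (t : pretree k U V) sigma :
  `[< ctY t >] -> `[< ctY (tree_act t sigma) >].
Proof.
move=> /asboolP[tv tb tw]; apply/asboolP.
by split; rewrite ?blacks_act ?whites_act //; apply: coding_tree_act.
Qed.

Definition CT_act (U V : finType) (z : CT_str U V) (sigma : 'S_k) : CT_str U V :=
  exist _ (tree_act (val z) sigma) (CT_act_proof sigma (valP z)).

Lemma CT_act_id (U V : finType) : (@CT_act U V)^~ 1 =1 id.
Proof. by move=> [t tv]; have /asboolP[v _ _] := tv; apply/val_inj/tree_act1. Qed.

Lemma CT_act_morph (U V : finType) (z : CT_str U V) : act_morph (@CT_act U V) z.
Proof. by case: z => t tv s s'; have /asboolP[v _ _] := tv; apply/val_inj/tree_actM. Qed.

Lemma CT_map_id (U V : finType) (bf : bijective (@id U)) (bg : bijective (@id V)) z :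
  CT_map bf bg z = z.
Proof.
exact/val_inj/relabel_id.
Qed.

Lemma CT_map_comp (U U' U'' V V' V'' : finType)
    (f : U -> U') (f' : U' -> U'') (g : V -> V') (g' : V' -> V'')
    (bf : bijective f) (bf' : bijective f') (bff' : bijective (f' \o f))
    (bg : bijective g) (bg' : bijective g') (bgg' : bijective (g' \o g)) z :
  CT_map bff' bgg' z = CT_map bf' bg' (CT_map bf bg z).
Proof.
exact/val_inj/relabel_comp.
Qed.

Lemma CT_map_act (U U' V V' : finType) (f : U -> U') (g : V -> V')
    (bf : bijective f) (bg : bijective g) z sigma :
  CT_map bf bg (CT_act z sigma) = CT_act (CT_map bf bg z) sigma.
Proof.
by apply/val_inj/esym/act_relabel.
Qed.

Definition CT_species : species2 'S_k :=
  @Species2 _ CT_str CT_map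
    (fun U V => TotalAction (@CT_act_id U V) (@CT_act_morph U V))
    CT_map_id CT_map_comp CT_map_act.


(* An F_k-structure is a pair (x, W) where W_1, ..., W_k are trees whose label sets,
   together with {x}, partition the labels. *)
Definition preF (U V : finType) : finType :=
  (U * {ffun 'I_k -> pretree k U V})%type.

Definition F_axiom (U V : finType) (z : preF U V) : Prop :=
  [/\ forall i, coding_tree (z.2 i),
      forall i j, i != j -> [disjoint blacks (z.2 i) & blacks (z.2 j)] /\
                            [disjoint whites (z.2 i) & whites (z.2 j)],
      forall i, z.1 \notin blacks (z.2 i),
      z.1 |: \bigcup_i blacks (z.2 i) = [set: U]
    & \bigcup_i whites (z.2 i) = [set: V]].

Definition F_str (U V : finType) : finType := {z : preF U V | `[< F_axiom z >]}.

Definition F_map_fun (U U' V V' : finType) (f : U -> U') (g : V -> V')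
    (z : preF U V) : preF U' V' :=
  (f z.1, [ffun i => relabel f g (z.2 i)]).

Definition F_act_fun (U V : finType) (z : preF U V) (sigma : 'S_k) : preF U V :=
  (z.1, [ffun j => let i := sigma^-1 j in
                   tree_act (z.2 i) (rho (lift ord0 i) sigma)]).

Lemma F_map_proof (U U' V V' : finType) (f : U -> U') (g : V -> V') z :
  bijective f -> bijective g -> `[< F_axiom z >] -> `[< F_axiom (F_map_fun f g z) >].
Proof.
move=> bf bg /asboolP[zv zd zN zb zw]; apply/asboolP.
have bE i : blacks ((F_map_fun f g z).2 i) = f @: blacks (z.2 i).
  by rewrite ffunE blacks_relabel.
have wE i : whites ((F_map_fun f g z).2 i) = g @: whites (z.2 i).
  by rewrite ffunE whites_relabel.
split.
- by move=> i; rewrite ffunE; apply: coding_tree_relabel.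
- move=> i j ij; rewrite !bE !wE (imset_disjoint (bij_inj bf)).
  by rewrite (imset_disjoint (bij_inj bg)); apply: zd.
- by move=> i; rewrite bE /= mem_imset //; apply: bij_inj.
- rewrite (eq_bigr _ (fun i _ => bE i)) /=.
  rewrite -(big_morph (fun A : {set U} => f @: A) (imsetU f) (imset0 f)) -imset_set1.
  rewrite -imsetU zb; case: bf => f' fK f'K.
  by apply/setP=> b; rewrite inE -[b]f'K imset_f.
- rewrite (eq_bigr _ (fun i _ => wE i)) /=.
  rewrite -(big_morph (fun A : {set V} => g @: A) (imsetU g) (imset0 g)).
  rewrite zw; case: bg => f' fK f'K.
  by apply/setP=> b; rewrite inE -[b]f'K imset_f.
Qed.

Definition F_map (U U' V V' : finType) (f : U -> U') (g : V -> V')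
    (bf : bijective f) (bg : bijective g) (z : F_str U V) : F_str U' V' :=
  exist _ (F_map_fun f g (val z)) (F_map_proof bf bg (valP z)).

Lemma F_act_proof (U V : finType) (z : preF U V) sigma :
  `[< F_axiom z >] -> `[< F_axiom (F_act_fun z sigma) >].
Proof.
move=> /asboolP[zv zd zN zb zw]; apply/asboolP.
have bE i : blacks ((F_act_fun z sigma).2 i) = blacks (z.2 (sigma^-1 i)).
  by rewrite ffunE blacks_act.
have wE i : whites ((F_act_fun z sigma).2 i) = whites (z.2 (sigma^-1 i)).
  by rewrite ffunE whites_act.
split.
- by move=> i; rewrite ffunE; apply: coding_tree_act.
- by move=> i j ij; rewrite !bE !wE; apply: zd; rewrite (inj_eq perm_inj).
- by move=> i; rewrite bE.
- rewrite (eq_bigr _ (fun i _ => bE i)) -zb; congr setU.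
  by rewrite [RHS](reindex_inj (@perm_inj _ (sigma^-1))).
- rewrite (eq_bigr _ (fun i _ => wE i)) -zw.
  by rewrite [RHS](reindex_inj (@perm_inj _ (sigma^-1))).
Qed.

Definition F_act (U V : finType) (z : F_str U V) (sigma : 'S_k) : F_str U V :=
  exist _ (F_act_fun (val z) sigma) (F_act_proof sigma (valP z)).

Lemma F_act_id (U V : finType) : (@F_act U V)^~ 1 =1 id.
Proof.
move=> [[x W] zv]; have /asboolP[Wv _ _ _ _] := zv.
apply/val_inj; congr pair; apply/ffunP => j.
by rewrite ffunE /= invg1 perm1 rho1; apply: tree_act1.
Qed.

Lemma F_act_morph (U V : finType) (z : F_str U V) : act_morph (@F_act U V) z.
Proof.
case: z => [[x W] zv] s s'; have /asboolP[Wv _ _ _ _] := zv.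
apply/val_inj; congr pair; apply/ffunP => j.
by rewrite !ffunE /= invMg permM rhoM emb_lift permKV ffunE; apply: tree_actM.
Qed.

Lemma F_map_id (U V : finType) (bf : bijective (@id U)) (bg : bijective (@id V)) z :
  F_map bf bg z = z.
Proof.
case: z => [[x W] zv]; apply/val_inj; congr pair; apply/ffunP => i.
by rewrite ffunE relabel_id.
Qed.

Lemma F_map_comp (U U' U'' V V' V'' : finType)
    (f : U -> U') (f' : U' -> U'') (g : V -> V') (g' : V' -> V'')
    (bf : bijective f) (bf' : bijective f') (bff' : bijective (f' \o f))
    (bg : bijective g) (bg' : bijective g') (bgg' : bijective (g' \o g)) z :
  F_map bff' bgg' z = F_map bf' bg' (F_map bf bg z).
Proof.
apply/val_inj; congr pair; apply/ffunP => i.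
by rewrite !ffunE relabel_comp.
Qed.

Lemma F_map_act (U U' V V' : finType) (f : U -> U') (g : V -> V')
    (bf : bijective f) (bg : bijective g) z sigma :
  F_map bf bg (F_act z sigma) = F_act (F_map bf bg z) sigma.
Proof.
apply/val_inj; congr pair; apply/ffunP => i.
by rewrite !ffunE /= ffunE act_relabel.
Qed.

Definition F_species : species2 'S_k :=
  @Species2 _ F_str F_map
    (fun U V => TotalAction (@F_act_id U V) (@F_act_morph U V))
    F_map_id F_map_comp F_map_act.


End CodingTrees.

(* The composite rho_(c_m) o ... o rho_(c_1), for c = (c_1, ..., c_m) the cycle of
   sigma through i, written with c_1 = i. *)
Definition ordered_rho (k : nat) (sigma : 'S_k) (i : 'I_k) : 'S_k :=
  (\prod_(j <- traject sigma i #|porbit sigma i|) rho (lift ord0 j) sigma)%g.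

(* Main.v *)
Require Import Defs.
From mathcomp Require Import finmap monalg.
From mathcomp Require Import boolp classical_sets fsbigop.
From mathcomp Require Import all_boot all_order all_algebra all_fingroup.
From mathcomp Require Import ring zify.

Set Implicit Arguments.
Unset Strict Implicit.
Unset Printing Implicit Defensive.
Import GRing.Theory Num.Theory.

(** Up to the factor 1 / (m! n!), a cycle index is a sum over pairs (mu, nu) of
permutations of the labels: the monomial recording their cycle types, times the number
of structures fixed by the group element composed with relabeling along (mu, nu). Here
this number is taken on arbitrary sets A and B of labels that mu and nu preserve, so
that structures can be cut into pieces with smaller supports. Two operations on such
counts are then visible on series. Cutting A and B in two in all possible ways becomes
multiplication [cycle_series_conv]; and choosing a set P whose translates P, mu P, ...,
mu^(l-1) P partition A (likewise for B), then counting on P with mu^l, becomes the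
dilation p_n -> p_(nl) [cycle_series_cyc_count].

Now let tau permute a finite index set, and count the families of structures W_i with
disjoint supports such that relabeling W_i and letting gam_i act on it gives W_(tau i).
On a cycle c of tau, such a family is determined by the structure at one starting
point, which is fixed by mu^|c| and nu^|c| together with the product of the gam_i taken
along c; the other supports are the translates of its support. The series of families is
therefore a product over the cycles of tau of dilated series [cycle_series_tuple_count].
This one statement is used twice.
- With tau = sigma and gam_i = rho_i(sigma) it is the equation for F_k, whose structures
  are a black label with a k-tuple of trees [cycle_series_planted].
- With constant gam_i and tau ranging over all of 'S_n, it counts each stable set of n
  structures n! times: the structures of such a set are permuted, so each of its n!
  enumerations comes with exactly one tau. The sum over 'S_n is therefore n! times the
  contribution of the sets of size n, as in the plethysm with the series of sets
  [cycle_series_sets_plethysm].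

A tree is a root label together with a set of F_k-structures, equivariantly [fix_count_LT];
this gives the equation for the trees. The decomposition is carried out on trees in
which the cyclic order at each black vertex has already been cut open at the parent, so
that subtrees and their grafting have a direct description; coding trees are
equivalent to these, compatibly with relabeling and with the action [untieK, tieK,
untie_relabel, untie_act].

Uniqueness: because of the factor p_1[x], the second equation determines the series of
F_k up to total weight N + 1 from the series of the trees up to weight N, and the first
one then determines the latter up to weight N + 1. *)

Local Open Scope ring_scope.

(** * Monomials of formal power series *)

Lemma fsum_seq (T : choiceType) (r : seq T) (F : T -> rat) : uniq r ->
  (forall x, x \notin r -> F x = 0) ->
  \sum_(x \in [set: T]%classic) F x = \sum_(x <- r) F x.
Proof.
move=> ur F0; rewrite (fsbigE r) //= => [|x _ /F0 //].
by apply: eq_bigl => x; rewrite mem_setT.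
Qed.

Section Monomials.
Variable I : choiceType.
Implicit Types (a b d m : {cmonom I}) (f g : series I).

Lemma scoefD f g m : coef (f + g) m = coef f m + coef g m.
Proof. by []. Qed.

Lemma scoef0 m : coef (0 : series I) m = 0.
Proof. by []. Qed.

Lemma scoef1 m : coef (1 : series I) m = (m == mone)%:R.
Proof. by []. Qed.

Lemma scoef_sum J (r : seq J) (P : pred J) (F : J -> series I) m :
  coef (\sum_(j <- r | P j) F j) m = \sum_(j <- r | P j) coef (F j) m.
Proof. by elim/big_rec2: _ => [|j y f _ <-]; rewrite ?scoef0 ?scoefD. Qed.

Lemma scoefMn f n m : coef (f *+ n) m = coef f m *+ n.
Proof. by elim: n => // n IH; rewrite !mulrSr scoefD IH. Qed.

Lemma scoefM f g (D : seq {cmonom I}) m : uniq D ->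
    (forall a b, mmul a b = m -> a \in D /\ b \in D) ->
  coef (f * g) m =
  \sum_(a <- D) \sum_(b <- D) (coef f a * coef g b) *+ (mmul a b == m).
Proof. exact: coef_smul. Qed.

Definition mono m := Series (fun m' => (m' == m)%:R).

Lemma mono1 : mono mone = 1.
Proof. by []. Qed.

Lemma monoM a b : mono (mmul a b) = mono a * mono b.
Proof.
apply: seriesP => m; have [D uD hD] := ex_mdivs m.
rewrite (scoefM _ _ uD hD) /=.
have [e|ne] := eqVneq m (mmul a b).
  have [aD bD] := hD _ _ (esym e).
  rewrite (bigD1_seq a) //= (bigD1_seq b) //= !eqxx -e eqxx mulr1 mulr1n.
  rewrite !big1 ?addr0 // => [c /negPf nc|c /negPf nc].
    by rewrite big1 // => ? _; rewrite nc mul0r mul0rn.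
  by rewrite nc mulr0 mul0rn.
rewrite big1 // => c _; rewrite big1 // => c' _.
case: eqP => [->|_]; last by rewrite mul0r mul0rn.
case: eqP => [->|_]; last by rewrite mulr0 mul0rn.
by rewrite eq_sym (negPf ne).
Qed.

Lemma mono_prod J (r : seq J) (P : pred J) (F : J -> {cmonom I}) :
  mono (\big[mmul/mone]_(j <- r | P j) F j) = \prod_(j <- r | P j) mono (F j).
Proof. exact: (big_morph mono monoM mono1). Qed.

Definition wdeg (w : I -> nat) m := (\sum_(i <- finsupp m) w i * m i)%N.

Lemma wdegEw w m (S : {fset I}) : (finsupp m `<=` S)%fset ->
  wdeg w m = (\sum_(i <- S) w i * m i)%N.
Proof.
move=> sub; rewrite /wdeg; apply/esym.
rewrite -(big_rmcond_in (fun i => i \in finsupp m)) /=; last first.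
  by move=> i _; rewrite -cmE_eq0 => /eqP ->; rewrite muln0.
rewrite -big_filter; apply: perm_big; apply: uniq_perm; rewrite ?filter_uniq ?fset_uniq //.
by move=> i; rewrite mem_filter andb_idr // => /(fsubsetP sub).
Qed.

Lemma wdegM w a b : wdeg w (mmul a b) = (wdeg w a + wdeg w b)%N.
Proof.
rewrite (@wdegEw w _ (finsupp a `|` finsupp b)%fset); last by rewrite mdomD.
rewrite (@wdegEw w a (finsupp a `|` finsupp b)%fset) ?fsubsetUl //.
rewrite (@wdegEw w b (finsupp a `|` finsupp b)%fset) ?fsubsetUr //.
by rewrite -big_split; apply: eq_bigr => i _; rewrite cmM mulnDr.
Qed.

Lemma wdeg1 w : wdeg w mone = 0%N.
Proof. by rewrite /wdeg mdom1 big_seq_fset0. Qed.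

Lemma wdegU w i : wdeg w (ucm i) = w i.
Proof. by rewrite /wdeg mdomU big_seq_fset1 cmU eqxx muln1. Qed.

Lemma wdeg_prod w J (r : seq J) (P : pred J) (F : J -> {cmonom I}) :
  wdeg w (\big[mmul/mone]_(j <- r | P j) F j) = (\sum_(j <- r | P j) wdeg w (F j))%N.
Proof. exact: (big_morph (wdeg w) (wdegM w) (wdeg1 w)). Qed.

(** The monomial m with the variables replaced by the series g i, so that
[subst f g] is the sum over m of the coefficient of f at m times [mono_eval g m]. *)
Definition mono_eval (J : choiceType) (g : I -> series J) m : series J :=
  \prod_(i <- finsupp m) g i ^+ m i.

Lemma mono_evalEw (J : choiceType) (g : I -> series J) m (S : {fset I}) :
  (finsupp m `<=` S)%fset -> mono_eval g m = \prod_(i <- S) g i ^+ m i.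
Proof.
move=> sub; rewrite /mono_eval; apply/esym.
rewrite -(big_rmcond_in (fun i => i \in finsupp m)) /=; last first.
  by move=> i _; rewrite -cmE_eq0 => /eqP ->; rewrite expr0.
rewrite -big_filter; apply: perm_big; apply: uniq_perm; rewrite ?filter_uniq ?fset_uniq //.
by move=> i; rewrite mem_filter andb_idr // => /(fsubsetP sub).
Qed.

Lemma mono_evalM (J : choiceType) (g : I -> series J) a b :
  mono_eval g (mmul a b) = mono_eval g a * mono_eval g b.
Proof.
rewrite (@mono_evalEw J g _ (finsupp a `|` finsupp b)%fset); last by rewrite mdomD.
rewrite (@mono_evalEw J g a (finsupp a `|` finsupp b)%fset) ?fsubsetUl //.
rewrite (@mono_evalEw J g b (finsupp a `|` finsupp b)%fset) ?fsubsetUr //.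
by rewrite -big_split; apply: eq_bigr => i _; rewrite cmM exprD.
Qed.

Lemma mono_eval1 (J : choiceType) (g : I -> series J) : mono_eval g mone = 1.
Proof. by rewrite /mono_eval mdom1 big_seq_fset0. Qed.

Lemma mono_evalU (J : choiceType) (g : I -> series J) i : mono_eval g (ucm i) = g i.
Proof. by rewrite /mono_eval mdomU big_seq_fset1 cmU eqxx expr1. Qed.

Lemma mono_eval_prod (J : choiceType) (g : I -> series J) T (r : seq T) (P : pred T) F :
  mono_eval g (\big[mmul/mone]_(j <- r | P j) F j) = \prod_(j <- r | P j) mono_eval g (F j).
Proof. exact: (big_morph (mono_eval g) (mono_evalM g) (mono_eval1 g)). Qed.

Lemma cm_prod J (r : seq J) (P : pred J) (F : J -> {cmonom I}) i :
  (\big[mmul/mone]_(j <- r | P j) F j) i = (\sum_(j <- r | P j) F j i)%N.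
Proof.
elim/big_rec2: _ => [|j y1 y2 _ <-]; [exact: cm1 | exact: cmM].
Qed.

Lemma iter_ucm n i j :
  (iter n (mmul (ucm i)) mone : {cmonom I}) j = (n * (i == j))%N.
Proof. by elim: n => [|n IH] /=; rewrite ?cm1 // cmM IH cmU mulSn. Qed.

End Monomials.

(** * Substituting variables for variables *)

Section Rename.
Variables (I J : choiceType) (h : I -> J).
Hypothesis h_inj : injective h.

Definition ren (m : {cmonom I}) : {cmonom J} :=
  \big[mmul/mone]_(i <- finsupp m) iter (m i) (mmul (ucm (h i))) mone.

Lemma mono_eval_var m : mono_eval (fun i => var (h i)) m = mono (ren m).
Proof.
rewrite mono_prod /mono_eval; apply: eq_bigr => i _.
elim: (m i) => [|n IH]; first by rewrite expr0.
by rewrite exprS IH /= monoM.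
Qed.

Lemma renE m i : ren m (h i) = m i.
Proof.
rewrite cm_prod; under eq_bigr do rewrite iter_ucm (inj_eq h_inj).
case: (boolP (i \in finsupp m)) => [im|im].
  rewrite (big_fsetD1 i) //= eqxx muln1 big1_fset ?addn0 // => i'.
  by rewrite in_fsetD1 => /andP[/negPf -> _]; rewrite muln0.
rewrite big1_fset => [|i' im' _]; first by apply/esym/eqP; rewrite cmE_eq0.
by case: eqP => [e|]; rewrite ?muln0 //; rewrite -e im' in im.
Qed.

Lemma ren0 m j : (forall i, h i <> j) -> ren m j = 0%N.
Proof.
move=> nj; rewrite cm_prod big1_fset // => i _ _.
by rewrite iter_ucm; case: eqP => [/nj//|]; rewrite muln0.
Qed.

Lemma ren_inj : injective ren.
Proof. by move=> a b e; apply/eqP/cmP => i; rewrite -!renE e. Qed.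

Lemma ren1 : ren mone = mone.
Proof. by rewrite /ren mdom1 big_seq_fset0. Qed.

Lemma renM a b : ren (mmul a b) = mmul (ren a) (ren b).
Proof.
apply/eqP/cmP => j; have [[i <-]|nj] := pselect (exists i, h i = j).
  by rewrite cmM !renE cmM.
have nj' i : h i <> j by move=> e; apply: nj; exists i.
by rewrite cmM !ren0.
Qed.

Lemma renU i : ren (ucm i) = ucm (h i).
Proof. by rewrite /ren mdomU big_seq_fset1 cmUU /= mulm1. Qed.

Lemma wdeg_ren w m : wdeg w (ren m) = wdeg (w \o h) m.
Proof.
rewrite wdeg_prod [RHS]/wdeg; apply: eq_bigr => i _.
elim: (m i) => [|n IH] /=; first by rewrite wdeg1 muln0.
by rewrite wdegM wdegU IH mulnS.
Qed.

(** The monomials dividing a renamed monomial are themselves renamed, so that a product of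
renamed series involves no others; multiplicativity of the renaming of series rests on
this. *)
Lemma ren_div a b m : mmul a b = ren m ->
  exists2 p, a = ren p.1 & b = ren p.2 /\ mmul p.1 p.2 = m.
Proof.
have H (a' b' : {cmonom J}) : mmul a' b' = ren m -> exists a0, a' = ren a0.
  move=> e.
  exists (\big[mmul/mone]_(i <- finsupp m) iter (a' (h i)) (mmul (ucm i)) mone).
  apply/eqP/cmP => j; have [[i <-]|nj] := pselect (exists i, h i = j); last first.
    have nj' i : h i <> j by move=> e'; apply: nj; exists i.
    have : mmul a' b' j = 0%N by rewrite e ren0.
    by rewrite ren0 // cmM => /eqP; rewrite addn_eq0 => /andP[/eqP].
  rewrite renE cm_prod.
  under eq_bigr do rewrite iter_ucm.
  case: (boolP (i \in finsupp m)) => [im|im].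
    rewrite (big_fsetD1 i) //= eqxx muln1 big1_fset ?addn0 // => i'.
    by rewrite in_fsetD1 => /andP[/negPf -> _]; rewrite muln0.
  rewrite big1_fset => [|i' im' _]; last first.
    by case: eqP => [e'|]; rewrite ?muln0 //; rewrite -e' im' in im.
  have : mmul a' b' (h i) = 0%N by rewrite e renE; apply/eqP; rewrite cmE_eq0.
  by rewrite cmM => /eqP; rewrite addn_eq0 => /andP[/eqP].
move=> e; have [a0 ea] := H _ _ e; have [b0 eb] := H b a (etrans (mulmC b a) e).
exists (a0, b0) => //; split=> //=; apply: ren_inj.
by rewrite renM -ea -eb.
Qed.

Definition rename (f : series I) : series J := subst f (fun i => var (h i)).

Lemma coef_renameE f M : coef (rename f) M =
  \sum_(d \in [set: {cmonom I}]%classic) coef f d * (M == ren d)%:R.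
Proof.
by apply: eq_fsbigr => d _; rewrite -[X in coef X M]/(mono_eval _ d) mono_eval_var.
Qed.

Lemma coef_rename f m : coef (rename f) (ren m) = coef f m.
Proof.
rewrite coef_renameE (@fsum_seq _ [:: m]) //; first by rewrite big_seq1 eqxx mulr1.
move=> d; rewrite mem_seq1 => ne.
by case: eqP => [/ren_inj e|_]; rewrite ?mulr0 //; move: ne; rewrite e eqxx.
Qed.

Lemma coef_rename0 f M : (forall m, M <> ren m) -> coef (rename f) M = 0.
Proof.
by move=> nM; rewrite coef_renameE fsbig1 // => d _; case: eqP => [/nM|]; rewrite ?mulr0.
Qed.

(** Injectivity of h makes renaming a bijection onto the monomials in its image, hence a
renamed series is known from its coefficients there. The ring laws below are all
checked in this way. *)
Lemma renameP (f : series I) (g : series J) :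
  (forall m, coef g (ren m) = coef f m) ->
  (forall M, (forall m, M <> ren m) -> coef g M = 0) -> rename f = g.
Proof.
move=> h1 h0; apply: seriesP => M.
have [[m ->]|nM] := pselect (exists m, M = ren m); first by rewrite coef_rename h1.
have nM' m : M <> ren m by move=> e; apply: nM; exists m.
by rewrite coef_rename0 // h0.
Qed.

Lemma renameD f g : rename (f + g) = rename f + rename g.
Proof.
apply: renameP => [m|M nM]; first by rewrite !scoefD !coef_rename.
by rewrite scoefD !coef_rename0 ?addr0.
Qed.

Lemma rename0 : rename 0 = 0.
Proof. by apply: renameP. Qed.

Lemma renameMn f n : rename (f *+ n) = rename f *+ n.
Proof.
apply: renameP => [m|M nM]; first by rewrite !scoefMn coef_rename.
by rewrite scoefMn coef_rename0 ?mul0rn.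
Qed.

Lemma rename_mono m : rename (mono m) = mono (ren m).
Proof.
apply: renameP => [m'|M nM] /=; first by rewrite (inj_eq ren_inj).
by case: eqP => // /nM.
Qed.

Lemma rename_var i : rename (var i) = var (h i).
Proof. by rewrite -[var i]/(mono (ucm i)) rename_mono renU. Qed.

Lemma rename1 : rename 1 = 1.
Proof. by rewrite -mono1 rename_mono ren1. Qed.

Lemma renameM f g : rename (f * g) = rename f * rename g.
Proof.
apply: renameP => [m|M nM].
  have [D uD hD] := ex_mdivs m.
  have uD' : uniq (map ren D) by rewrite map_inj_uniq //; exact: ren_inj.
  rewrite (scoefM _ _ uD' (m := ren m)); last first.
    move=> a b /ren_div[[a0 b0] /= -> [-> /hD[aD bD]]].
    by rewrite !map_f.
  rewrite (scoefM _ _ uD hD) big_map; apply: eq_bigr => a _.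
  rewrite big_map; apply: eq_bigr => b _.
  by rewrite !coef_rename -renM (inj_eq ren_inj).
have [D uD hD] := ex_mdivs M.
rewrite (scoefM _ _ uD hD) big1 // => a _; rewrite big1 // => b _.
case: eqP => // e; rewrite mulr1n.
have [[a0 ea]|na] := pselect (exists m, a = ren m); last first.
  by rewrite coef_rename0 ?mul0r // => m e'; apply: na; exists m.
rewrite [coef _ b]coef_rename0 ?mulr0 // => b0 eb.
by apply: (nM (mmul a0 b0)); rewrite renM -ea -eb e.
Qed.

End Rename.

(** * Bigraded exponential generating series and their dilations *)

Local Notation xyseries := (series (nat + nat)%type).
Local Notation xymon := {cmonom (nat + nat)%type}.

(** The variable p_n has weight n: it stands for a cycle of length n, and the monomial of a
pair of permutations of m and n points has weights (m, n). *)
Definition wx : xymon -> nat := wdeg (fun i => if i is inl j then j.+1 else 0%N).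
Definition wy : xymon -> nat := wdeg (fun i => if i is inr j then j.+1 else 0%N).

Definition homog (h : nat -> nat -> xyseries) :=
  forall m n M, coef (h m n) M != 0 -> wx M = m /\ wy M = n.

Definition egf (h : nat -> nat -> xyseries) : xyseries :=
  Series (fun M => ((wx M)`! * (wy M)`!)%N%:R^-1 * coef (h (wx M) (wy M)) M).

Lemma facs_neq0 m n : ((m`! * n`!)%N%:R : rat) != 0.
Proof. by rewrite pnatr_eq0 muln_eq0 negb_or -!lt0n !fact_gt0. Qed.

Lemma homogE h m n M : homog h ->
  coef (h m n) M = coef (h (wx M) (wy M)) M *+ ((wx M == m) && (wy M == n)).
Proof.
move=> hh; case: (eqVneq (coef (h m n) M) 0) => [e|/hh[<- <-]]; last first.
  by rewrite !eqxx.
by rewrite e; case: andP => [[/eqP em /eqP en]|//]; rewrite em en e.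
Qed.

(** A monomial splitting as p * q in the product has weights that add up, and
(a + b)! / (a! b!) turns the two normalizations into binomial coefficients. *)
Lemma egfM h h' : homog h -> homog h' ->
  egf h * egf h' = egf (fun m n => \sum_(a < m.+1) \sum_(b < n.+1)
     (h a b * h' (m - a)%N (n - b)%N) *+ ('C(m, a) * 'C(n, b))).
Proof.
move=> hh hh'; apply: seriesP => M; have [D uD hD] := ex_mdivs M.
rewrite (scoefM _ _ uD hD) /=; set m := wx M; set n := wy M.
rewrite scoef_sum mulr_sumr.
under [RHS]eq_bigr => a _.
  rewrite scoef_sum mulr_sumr.
  under eq_bigr => b _.
    rewrite scoefMn (scoefM _ _ uD hD) -[_ *+ ('C(_, _) * _)]mulr_natr mulr_suml mulr_sumr.
    under eq_bigr do rewrite mulr_suml mulr_sumr.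
    over.
  rewrite exchange_big; under eq_bigr do rewrite exchange_big.
  over.
rewrite [RHS]exchange_big; apply: eq_bigr => p _.
rewrite [RHS]exchange_big; apply: eq_bigr => q _ /=.
case: (eqVneq (mmul p q) M) => [e|_]; last first.
  rewrite mulr0n big1 // => a _; rewrite big1 // => b _.
  by rewrite mulr0n mul0r mulr0.
have em : m = (wx p + wx q)%N by rewrite /m -e /wx wdegM.
have en : n = (wy p + wy q)%N by rewrite /n -e /wy wdegM.
have lb : (wy p < n.+1)%N by rewrite ltnS en leq_addr.
have la : (wx p < m.+1)%N by rewrite ltnS em leq_addr.
rewrite (bigD1 (Ordinal la)) //= [X in _ + X]big1 ?addr0 => [|a na]; last first.
  rewrite big1 // => b _; rewrite (homogE a b p hh).
  have /negPf-> : wx p != a by apply: contraNneq na => ea; apply/eqP/val_inj.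
  by rewrite mulr0n mul0r mul0rn mul0r mulr0.
rewrite (bigD1 (Ordinal lb)) //= [X in _ + X]big1 ?addr0 => [|b nb]; last first.
  rewrite (homogE _ b p hh).
  have /negPf-> : wy p != b by apply: contraNneq nb => eb; apply/eqP/val_inj.
  by rewrite andbF mulr0n mul0r mul0rn mul0r mulr0.
have -> : (m - wx p)%N = wx q by rewrite em addKn.
have -> : (n - wy p)%N = wy q by rewrite en addKn.
have H a b : ('C(a + b, a) * (a`! * b`!) = (a + b)`!)%N.
  by rewrite -(bin_fact (leq_addr b a)) addKn.
rewrite mulrACA -invfM -natrM !mulr1n [RHS]mulrC -[RHS]mulrA [LHS]mulrC.
congr (_ * _); apply: (mulIf (facs_neq0 m n)).
rewrite -mulrA mulVf ?facs_neq0 // mulr1.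
have nz : (((wx p)`! * (wy p)`!) * ((wx q)`! * (wy q)`!))%N%:R != 0 :> rat.
  by rewrite natrM mulf_neq0 ?facs_neq0.
apply: (mulfI nz); rewrite mulVKf // -natrM; congr _%:R.
by rewrite em en -!H; ring.
Qed.

Lemma egf_coef h M : homog h ->
  coef (egf h) M = \sum_(mn \in [set: nat * nat]%classic)
     (mn.1`! * mn.2`!)%N%:R^-1 * coef (h mn.1 mn.2) M.
Proof.
move=> hh; rewrite (@fsum_seq _ [:: (wx M, wy M)]) ?big_seq1 // => -[m n].
rewrite mem_seq1 /= => ne; rewrite (homogE m n M hh).
have -> : (wx M == m) && (wy M == n) = false.
  by apply: contraNF ne => /andP[/eqP -> /eqP ->].
by rewrite mulr0n mulr0.
Qed.

Lemma egfMn h c : egf h *+ c = egf (fun m n => h m n *+ c).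
Proof. by apply: seriesP => M; rewrite scoefMn /= scoefMn mulrnAr. Qed.

Lemma eq_egf h h' : (forall m n, h m n = h' m n) -> egf h = egf h'.
Proof. by move=> e; apply: seriesP => M /=; rewrite e. Qed.

Section Dilate.
Variable l : nat.
Hypothesis l_gt0 : (0 < l)%N.

Definition dilx (i : nat + nat) : nat + nat :=
  match i with inl j => inl (j.+1 * l).-1 | inr j => inr (j.+1 * l).-1 end.

Let dil_nat j j' : (j.+1 * l).-1 = (j'.+1 * l).-1 -> j = j'.
Proof.
move=> e; apply/succn_inj/eqP; rewrite -(eqn_pmul2r l_gt0).
by rewrite -(prednK (_ : 0 < j.+1 * l)%N) ?muln_gt0 // e prednK // muln_gt0.
Qed.

Lemma dilx_inj : injective dilx.
Proof. by case=> j [] j' //= [/dil_nat ->]. Qed.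

Lemma dilateE f : dilate l f = rename dilx f.
Proof.
by rewrite /dilate /rename; congr subst; apply/funext => -[].
Qed.

Lemma wx_dil d : wx (ren dilx d) = (wx d * l)%N.
Proof.
rewrite /wx wdeg_ren /wdeg big_distrl; apply: eq_bigr => -[j|j] _ //=.
by rewrite prednK ?muln_gt0 // mulnAC.
Qed.

Lemma wy_dil d : wy (ren dilx d) = (wy d * l)%N.
Proof.
rewrite /wy wdeg_ren /wdeg big_distrl; apply: eq_bigr => -[j|j] _ //=.
by rewrite prednK ?muln_gt0 // mulnAC.
Qed.

(** Dilation multiplies weights by l, so the normalization at (m, n) has to be traded for
the one at (m l, n l). *)
Lemma egf_dilate h h' :
  (forall m n, h' (m * l)%N (n * l)%N *+ (m`! * n`!) =
               dilate l (h m n) *+ ((m * l)`! * (n * l)`!)) ->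
  (forall m n, ~~ ((l %| m) && (l %| n))%N -> h' m n = 0) ->
  dilate l (egf h) = egf h'.
Proof.
move=> hE h0; rewrite dilateE; apply: (renameP dilx_inj) => [m|M nM] /=.
- have := congr1 (fun f => coef f (ren dilx m)) (hE (wx m) (wy m)).
  rewrite /= !scoefMn dilateE (coef_rename dilx_inj).
  rewrite !wx_dil !wy_dil => /(congr1 (fun x => x / ((wx m)`! * (wy m)`!)%N%:R)).
  rewrite /= -[X in X / _ = _]mulr_natr mulfK ?facs_neq0 // => ->.
  by rewrite -[coef _ _ *+ _]mulr_natr mulrAC mulrC mulfK ?facs_neq0 // mulrC.
- case: (boolP ((l %| wx M) && (l %| wy M))%N) => [|/h0->]; last first.
    by rewrite scoef0 mulr0.
  case/andP => /dvdnP[m em] /dvdnP[n en].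
  have := congr1 (fun f => coef f M) (hE m n).
  rewrite /= !scoefMn dilateE coef_rename0 // -em -en mul0rn.
  move/eqP; rewrite -[coef _ _ *+ _]mulr_natr mulf_eq0 (negPf (facs_neq0 _ _)) orbF => /eqP ->.
  by rewrite mulr0.
Qed.

Lemma dilateM f g : dilate l (f * g) = dilate l f * dilate l g.
Proof. by rewrite !dilateE (renameM dilx_inj). Qed.
Lemma dilateD f g : dilate l (f + g) = dilate l f + dilate l g.
Proof. by rewrite !dilateE (renameD dilx_inj). Qed.
Lemma dilate0 : dilate l 0 = 0.
Proof. by rewrite !dilateE (rename0 dilx_inj). Qed.
Lemma dilate1 : dilate l 1 = 1.
Proof. by rewrite !dilateE (rename1 dilx_inj). Qed.
Lemma dilateMn f n : dilate l (f *+ n) = dilate l f *+ n.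
Proof. by rewrite !dilateE (renameMn dilx_inj). Qed.

Lemma dilate_px j : (0 < j)%N -> dilate l (px j) = px (j * l).
Proof.
move=> j0; rewrite dilateE [LHS](rename_var dilx_inj).
by rewrite /= prednK.
Qed.
Lemma dilate_py j : (0 < j)%N -> dilate l (py j) = py (j * l).
Proof.
move=> j0; rewrite dilateE [LHS](rename_var dilx_inj).
by rewrite /= prednK.
Qed.
Lemma dilate_prod T (r : seq T) (P : pred T) F :
  dilate l (\prod_(j <- r | P j) F j) = \prod_(j <- r | P j) dilate l (F j).
Proof. exact: (big_morph (dilate l) dilateM dilate1). Qed.
Lemma dilate_sum T (r : seq T) (P : pred T) F :
  dilate l (\sum_(j <- r | P j) F j) = \sum_(j <- r | P j) dilate l (F j).
Proof. exact: (big_morph (dilate l) dilateD dilate0). Qed.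

End Dilate.

Local Close Scope ring_scope.

(** * Weights of permutations by cycle type *)

Section OrbitProducts.
Variable R : comNzRingType.

(** Comparison of products over the cycles of two permutations: f induces a bijection from
the cycles of mu0 to those cycles of mu that satisfy D. *)
Lemma big_porbits (T T0 : finType) (mu : {perm T}) (mu0 : {perm T0}) (f : T0 -> T)
    (D : pred {set T}) (Q : {set T} -> R) (Q0 : {set T0} -> R) :
  (forall a a', (porbit mu (f a) == porbit mu (f a')) = (porbit mu0 a == porbit mu0 a')) ->
  (forall u, D (porbit mu u) -> exists a, porbit mu u = porbit mu (f a)) ->
  (forall a, D (porbit mu (f a))) ->
  (forall a, Q (porbit mu (f a)) = Q0 (porbit mu0 a)) ->
  (\prod_(c in porbits mu | D c) Q c = \prod_(c in porbits mu0) Q0 c)%R.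
Proof.
move=> hf hD Df hQ.
(* a cycle of mu0 is sent to the cycle of mu through the image of any of its points;
   [set0] is only reached from the empty set, which is not a cycle *)
pose psi (c0 : {set T0}) := if [pick a in c0] is Some a then porbit mu (f a) else set0.
have psiE a : psi (porbit mu0 a) = porbit mu (f a).
  rewrite /psi; case: pickP => [a'|/(_ a)]; last by rewrite porbit_id.
  by rewrite -eq_porbit_mem => e; apply/eqP; rewrite hf.
transitivity (\prod_(c in psi @: porbits mu0) Q c)%R.
  apply: eq_bigl => c; apply/andP/imsetP => [[/imsetP[u _ ->] /hD[a ->]]|[c0]].
    by exists (porbit mu0 a); rewrite ?psiE //; apply: imset_f.
  by case/imsetP => a _ -> ->; rewrite psiE; split=> //; apply: imset_f.
rewrite big_imset => [|c c' /imsetP[a _ ->] /imsetP[a' _ ->]] /=.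
  by apply: eq_bigr => c /imsetP[a _ ->]; rewrite psiE hQ.
by rewrite !psiE => /eqP; rewrite hf => /eqP.
Qed.

Definition cycle_weight (q : nat -> R) (T : finType) (mu : {perm T}) : R :=
  (\prod_(c in porbits mu) q #|c|)%R.

Lemma porbit_inj (T T0 : finType) (mu : {perm T}) (mu0 : {perm T0}) (f : T0 -> T) a :
  (forall x, mu (f x) = f (mu0 x)) -> porbit mu (f a) = f @: porbit mu0 a.
Proof.
move=> mf; have mfX i x : (mu ^+ i)%g (f x) = f ((mu0 ^+ i)%g x).
  by rewrite !permX; elim: i => //= i ->.
apply/setP => y; apply/porbitP/imsetP => [[i ->]|[_ /porbitP[i ->] ->]].
  by exists ((mu0 ^+ i)%g a); rewrite ?mem_porbit ?mfX.
by exists i; rewrite mfX.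
Qed.

Lemma wt_union (q : nat -> R) (T T1 T2 : finType) (mu : {perm T}) (a : {perm T1})
    (b : {perm T2}) (f : T1 -> T) (g : T2 -> T) (A : {set T}) :
  injective f -> injective g -> f @: [set: T1] = A -> g @: [set: T2] = ~: A ->
  (forall x, mu (f x) = f (a x)) -> (forall x, mu (g x) = g (b x)) ->
  cycle_weight q mu = (cycle_weight q a * cycle_weight q b)%R.
Proof.
move=> fi gi fA gA mf mg; rewrite /cycle_weight (bigID (fun c : {set T} => c \subset A)) /=.
have fsub x : porbit mu (f x) \subset A.
  by rewrite (porbit_inj _ mf) -fA imsetS ?subsetT.
have gsub x : ~~ (porbit mu (g x) \subset A).
  apply/negP => /subsetP/(_ (g x) (porbit_id _ _)).
  have : g x \in ~: A by rewrite -gA imset_f.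
  by rewrite inE => /negP.
congr (_ * _)%R; [apply: (big_porbits (f := f)) | apply: (big_porbits (f := g))].
- by move=> x y; rewrite !(porbit_inj _ mf) (inj_eq (imset_inj fi)).
- move=> u /subsetP/(_ u (porbit_id _ _)); rewrite -fA => /imsetP[x _ ->].
  by exists x.
- exact: fsub.
- by move=> x; rewrite (porbit_inj _ mf) card_imset.
- by move=> x y; rewrite !(porbit_inj _ mg) (inj_eq (imset_inj gi)).
- move=> u uA; have : u \in ~: A.
    rewrite inE; apply: contra uA; rewrite -fA => /imsetP[x _ ->].
    by rewrite fA.
  by rewrite -gA => /imsetP[x _ ->]; exists x.
- exact: gsub.
- by move=> x; rewrite (porbit_inj _ mg) card_imset.
Qed.

Lemma wt_card0 (q : nat -> R) (T : finType) (mu : {perm T}) : #|T| = 0 -> cycle_weight q mu = 1%R.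
Proof.
by move=> cT; rewrite /cycle_weight big1 // => c /imsetP[x _ _]; have := card0_eq cT x; rewrite inE.
Qed.

Lemma wt_conj (q : nat -> R) (T T1 : finType) (mu : {perm T}) (a : {perm T1})
    (f : T1 -> T) : bijective f -> (forall x, mu (f x) = f (a x)) ->
  cycle_weight q mu = cycle_weight q a.
Proof.
case=> g fK gK mf; have fi := can_inj fK.
rewrite /cycle_weight (_ : (\prod_(c in porbits mu) q #|c| = \prod_(c in porbits mu | true) q #|c|)%R);
  last by apply: eq_bigl => c; rewrite andbT.
apply: (big_porbits (f := f)) => // [x y|u _|x].
- by rewrite !(porbit_inj _ mf) (inj_eq (imset_inj fi)).
- by exists (g u); rewrite gK.
- by rewrite (porbit_inj _ mf) card_imset.
Qed.

End OrbitProducts.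

Lemma card_porbits_sum (T : finType) (mu : {perm T}) :
  (\sum_(c in porbits mu) #|c| = #|T|)%N.
Proof.
have -> : porbits mu = equivalence_partition (fun x y => porbit mu x == porbit mu y) setT.
  apply/setP => c; apply/imsetP/imsetP => -[x xT ->]; exists x => //; apply/setP => y;
  by rewrite !inE /= eq_sym eq_porbit_mem.
rewrite -(card_partition (D := setT)) ?cardsT //; apply/equivalence_partitionP.
by move=> x y z _ _ _; split=> // /eqP ->.
Qed.

Lemma perm_restr (T U : finType) (f : T -> U) (h : U -> U) : injective f -> injective h ->
  (forall x, exists y, h (f x) = f y) -> exists a : {perm T}, forall x, h (f x) = f (a x).
Proof.
move=> fi hi hf; have [k hk] := choice hf.
have ki : injective k by move=> x y e; apply/fi/hi; rewrite !hk e.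
by exists (perm ki) => x; rewrite permE.
Qed.

Lemma sum_perm_conj (R : nmodType) (T T' : finType) (f : T -> T')
    (G : {perm T'} -> R) (F : {perm T} -> R) : bijective f ->
  (forall (mu : {perm T'}) (a : {perm T}),
     (forall x, mu (f x) = f (a x)) -> G mu = F a) ->
  (\sum_(mu : {perm T'}) G mu = \sum_(a : {perm T}) F a)%R.
Proof.
case=> g fK gK GF; have [fi gi] := (can_inj fK, can_inj gK).
have ci (a : {perm T}) : injective (fun x => f (a (g x))).
  by move=> x y /fi/perm_inj/gi.
have di (a : {perm T'}) : injective (fun x => g (a (f x))).
  by move=> x y /gi/perm_inj/fi.
rewrite (reindex (fun a => perm (ci a))) /=.
  by apply: eq_bigr => a _; apply: GF => x; rewrite permE fK.
apply: onW_bij; exists (fun a => perm (di a)) => a.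
  by apply/permP => x; rewrite !permE !fK.
by apply/permP => x; rewrite !permE !gK.
Qed.

(** The permutations of U that preserve A are exactly the pairs of a permutation of A and
a permutation of its complement. *)
Lemma sum_perm_stab (R : nmodType) (U T1 T2 : finType) (f : T1 -> U) (g : T2 -> U)
    (A : {set U}) (G : {perm U} -> R) (F : {perm T1} -> {perm T2} -> R) :
  injective f -> injective g -> f @: [set: T1] = A -> g @: [set: T2] = ~: A ->
  (forall mu : {perm U}, mu @: A != A -> G mu = 0%R) ->
  (forall (mu : {perm U}) (a : {perm T1}) (b : {perm T2}),
     (forall x, mu (f x) = f (a x)) -> (forall x, mu (g x) = g (b x)) ->
     G mu = F a b) ->
  (\sum_(mu : {perm U}) G mu = \sum_a \sum_b F a b)%R.
Proof.
move=> fi gi fA gA G0 GF.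
have fin x : f x \in A by rewrite -fA imset_f.
have gin x : g x \notin A by rewrite -in_setC -gA imset_f.
pose k (x : T1 + T2) := match x with inl x => f x | inr x => g x end.
have ki : injective k.
  move=> [x|x] [y|y] /= e; [by rewrite (fi _ _ e) | | | by rewrite (gi _ _ e)].
    by move: (gin y); rewrite -e fin.
  by move: (gin x); rewrite e fin.
have ks u : exists x, k x = u.
  case: (boolP (u \in A)) => uA.
    by move: uA; rewrite -fA => /imsetP[x _ ->]; exists (inl x).
  by move: uA; rewrite -in_setC -gA => /imsetP[x _ ->]; exists (inr x).
have [k' k'K] := choice ks.
have kK x : k' (k x) = x by apply: ki; rewrite k'K.
(* glue the permutations of the two parts *)
pose sf (p : {perm T1} * {perm T2}) u :=
  k (match k' u with inl x => inl (p.1 x) | inr x => inr (p.2 x) end).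
have sfi p : injective (sf p).
  move=> u v /ki e; rewrite -[u]k'K -[v]k'K; congr k; move: e.
  by case: (k' u) (k' v) => [x|x] [y|y] //= [/perm_inj ->].
pose h p := perm (sfi p).
have hf p x : h p (f x) = f (p.1 x) by rewrite permE /sf -[f x]/(k (inl x)) kK.
have hg p x : h p (g x) = g (p.2 x) by rewrite permE /sf -[g x]/(k (inr x)) kK.
rewrite (bigID (mem (h @: [set: {perm T1} * {perm T2}]))) /= [X in (_ + X)%R]big1 => [|mu].
  rewrite addr0 big_imset => [|p q _ _ e] /=; last first.
    rewrite [p]surjective_pairing [q]surjective_pairing; congr pair; apply/permP => x.
      by apply: fi; rewrite -!hf e.
    by apply: gi; rewrite -!hg e.
  rewrite pair_bigA big_mkcond /=; apply: eq_bigr => -[a b] _; rewrite inE.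
  by apply: GF => x; rewrite ?hf ?hg.
move=> muN; apply: G0; apply: contra muN => /eqP muA.
have muin u : (mu u \in A) = (u \in A) by rewrite -{1}muA (mem_imset _ _ (@perm_inj _ mu)).
have [a ha] : exists a : {perm T1}, forall x, mu (f x) = f (a x).
  apply: perm_restr => // [|x]; first exact: perm_inj.
  have : mu (f x) \in A by rewrite muin.
  by rewrite -fA => /imsetP[y _ ->]; exists y.
have [b hb] : exists b : {perm T2}, forall x, mu (g x) = g (b x).
  apply: perm_restr => // [|x]; first exact: perm_inj.
  have : mu (g x) \in ~: A by rewrite inE muin.
  by rewrite -gA => /imsetP[y _ ->]; exists y.
apply/imsetP; exists (a, b); first by rewrite inE.
apply/permP => u.
by have [[x|x] <-] := ks u; rewrite /= ?ha ?hb ?hf ?hg.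
Qed.

(** * Sets whose translates under a permutation form a partition *)

(** Each u must belong to exactly one of the l translates if it is in A and to none
otherwise; counting memberships states disjointness and covering at once. *)
Definition cycpart (U : finType) l (mu : {perm U}) (P A : {set U}) :=
  [forall u, (\sum_(j < l) (u \in [set (mu ^+ j)%g x | x in P]) == (u \in A))%N].

Section CycPart.
Variables (U : finType) (l : nat) (mu : {perm U}) (P A : {set U}).
Hypothesis cp : cycpart l mu P A.

Lemma cycpart_uniq (i j : 'I_l) x y : x \in P -> y \in P ->
  (mu ^+ i)%g x = (mu ^+ j)%g y -> i = j /\ x = y.
Proof.
move=> xP yP e; have ij : i = j.
  apply/eqP; apply: contraT => ne; have /forallP/(_ ((mu ^+ i)%g x)) := cp.
  have hi : (mu ^+ i)%g x \in [set (mu ^+ i)%g x | x in P] by apply: imset_f.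
  have hj : (mu ^+ i)%g x \in [set (mu ^+ j)%g x | x in P] by rewrite e imset_f.
  rewrite (bigD1 i) // (bigD1 j) 1?eq_sym //= hi hj.
  by case: (_ \in A); lia.
by split=> //; move: e; rewrite ij => /perm_inj.
Qed.

Lemma cycpartP u : reflect (exists (i : 'I_l) x, x \in P /\ u = (mu ^+ i)%g x) (u \in A).
Proof.
have /forallP/(_ u)/eqP e := cp.
apply: (iffP idP) => [uA|[i [x [xP ue]]]].
  rewrite uA in e; case: (pickP (fun j : 'I_l => u \in [set (mu ^+ j)%g x | x in P])).
    by move=> j /imsetP[x xP ->]; exists j, x.
  by move=> n; move: e; rewrite big1 // => j _; rewrite n.
have hi : u \in [set (mu ^+ i)%g x | x in P] by rewrite ue imset_f.
move: e; rewrite (bigD1 i) //= hi.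
by case: (u \in A) => //; lia.
Qed.

Hypothesis l_gt0 : (0 < l)%N.

(** As mu preserves A, the point mu^l x lies in some translate mu^j P with j < l. If j > 0
then mu^(l-1) x would lie both in the translate of index l-1 and in that of index j-1,
which is impossible. *)
Lemma cycpart_stab_sub x : x \in P -> (mu @: A = A) -> (mu ^+ l)%g x \in P.
Proof.
move=> xP muA; have xA : x \in A.
  by apply/cycpartP; exists (Ordinal l_gt0), x; rewrite perm1.
have XA n : (mu ^+ n)%g x \in A.
  elim: n => [|n IH]; first by rewrite perm1.
  by rewrite expgSr permM -muA imset_f.
have /cycpartP[j [y [yP e]]] := XA l.
case: j e => [[|j] jl] /= e; first by rewrite e expg0 perm1.
have l1 : (l.-1 < l)%N by rewrite prednK.
have e' : (mu ^+ (Ordinal l1))%g x = (mu ^+ (Ordinal (ltnW jl)))%g y.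
  by apply: (@perm_inj _ mu); rewrite -!permM -!expgSr /= prednK.
have [[ej] _] := cycpart_uniq xP yP e'.
by have := jl; rewrite -ej prednK // ltnn.
Qed.

Lemma cycpart_card : #|A| = (#|P| * l)%N.
Proof.
have -> : A = [set (mu ^+ (p : U * 'I_l).2)%g p.1 | p in setX P [set: 'I_l]].
  apply/setP => u; apply/cycpartP/imsetP => [[i [x [xP ->]]]|[[x i]]].
    by exists (x, i); rewrite // !inE xP.
  by rewrite !inE andbT /= => xP ->; exists i, x.
rewrite card_in_imset ?cardsX ?cardsT ?card_ord // => -[x i] [y j].
rewrite !inE !andbT /= => xP yP e.
by have [-> ->] := cycpart_uniq xP yP e.
Qed.

Lemma cycpart_stab : mu @: A = A -> [set (mu ^+ l)%g x | x in P] = P.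
Proof.
move=> muA; apply/eqP; rewrite eqEcard card_imset ?leqnn ?andbT; last exact: perm_inj.
by apply/subsetP => _ /imsetP[x xP ->]; apply: cycpart_stab_sub.
Qed.

End CycPart.

Section CycSums.
Variables (U T : finType) (l : nat) (mu : {perm U}) (a : {perm T}) (e : T -> U).
Hypotheses (l_gt0 : (0 < l)%N) (ei : injective e).
Hypothesis cp : cycpart l mu (e @: [set: T]) setT.
Hypothesis ea : forall x, (mu ^+ l)%g (e x) = e (a x).

Lemma cyc_divn i x :
  (mu ^+ i)%g (e x) = (mu ^+ (i %% l))%g (e ((a ^+ (i %/ l))%g x)).
Proof.
rewrite {1}(divn_eq i l) expgD permM mulnC expgM; congr ((mu ^+ _)%g _).
elim: (i %/ l) => [|q IH]; first by rewrite !expg0 !perm1.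
by rewrite !expgSr !permM IH ea.
Qed.

Lemma cyc_uniq i j x y : (i < l)%N -> (j < l)%N ->
  (mu ^+ i)%g (e x) = (mu ^+ j)%g (e y) -> i = j /\ x = y.
Proof.
move=> il jl h; have inE x' : e x' \in e @: [set: T] by rewrite imset_f.
by have [[ij] /ei xy] := @cycpart_uniq _ _ _ _ _ cp (Ordinal il) (Ordinal jl) _ _ (inE x) (inE y) h.
Qed.

Lemma cyc_ex u : exists i x, (i < l)%N /\ u = (mu ^+ i)%g (e x).
Proof.
have /(cycpartP cp)[i [_ [/imsetP[x _ ->] ->]]] : u \in [set: U] by rewrite inE.
by exists i, x.
Qed.

Lemma porbit_cyc x y : (e x \in porbit mu (e y)) = (x \in porbit a y).
Proof.
apply/porbitP/porbitP => -[i].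
  rewrite cyc_divn -[e x](perm1) -(expg0 mu) => h.
  exists (i %/ l); have [_ ->//] := cyc_uniq l_gt0 (ltn_pmod i l_gt0) h.
move=> ->; exists (i * l)%N.
by rewrite cyc_divn modnMl mulnK // expg0 perm1.
Qed.

(** A cycle of length n of the map that mu^l induces on P comes from a cycle of length n l
of mu. *)
Lemma wt_cyc (R : comNzRingType) (q : nat -> R) :
  cycle_weight q mu = cycle_weight (fun n => q (n * l)%N) a.
Proof.
rewrite /cycle_weight (_ : (\prod_(c in porbits mu) q #|c| = \prod_(c in porbits mu | true) q #|c|)%R);
  last by apply: eq_bigl => c; rewrite andbT.
apply: (big_porbits (f := e)) => // [x y|u _|x].
- by rewrite !eq_porbit_mem porbit_cyc.
- by have [i [x [_ ->]]] := cyc_ex u; exists x; apply: porbit_perm.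
congr q; have -> : porbit mu (e x) =
    [set (mu ^+ (p : T * 'I_l).2)%g (e p.1) | p in setX (porbit a x) [set: 'I_l]].
  apply/setP => u; apply/idP/imsetP => [/porbitP[i ->]|[[y i]]].
    exists ((a ^+ (i %/ l))%g x, Ordinal (ltn_pmod i l_gt0)); last exact: cyc_divn.
    by rewrite !inE mem_porbit.
  rewrite !inE andbT /= => yx ->.
  by rewrite -eq_porbit_mem porbit_perm eq_porbit_mem porbit_cyc.
rewrite card_in_imset ?cardsX ?cardsT ?card_ord // => -[y i] [z j] _ _ /=.
by move/(cyc_uniq (ltn_ord i) (ltn_ord j)) => [/val_inj -> ->].
Qed.

End CycSums.

Lemma card_inj_onto (T U : finType) (P : {set U}) : #|P| = #|T| ->
  #|[set e : {ffun T -> U} | injectiveb e & e @: [set: T] == P]| = (#|T|)`!.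
Proof.
move=> PT; rewrite -ffactnn -{1}PT -card_inj_ffuns_on; apply: eq_card => e.
rewrite !inE andbC; apply: andb_id2r => /injectiveP ei.
apply/eqP/ffun_onP => [<- x|eP]; first by rewrite imset_f.
apply/eqP; rewrite eqEcard card_imset // cardsT PT leqnn andbT.
by apply/subsetP => _ /imsetP[x _ ->]; apply: eP.
Qed.

(** A bijection behind the dilation of cycle indices. Give P an enumeration e by T: then
mu and e amount to the permutation a that mu^l induces on T, together with the
bijection (j, x) |-> mu^j (e x) from 'I_l * T to U, and both can be prescribed freely.
There are #|T|! enumerations of each P and #|U|! such bijections. *)
Lemma sum_perm_cyc (R : nmodType) (U T : finType) l
    (G : {perm U} -> {set U} -> R) (F : {perm T} -> R) :
  (0 < l)%N -> #|U| = (#|T| * l)%N ->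
  (forall (mu : {perm U}) (a : {perm T}) (e : T -> U), injective e ->
     cycpart l mu (e @: [set: T]) setT ->
     (forall x, (mu ^+ l)%g (e x) = e (a x)) -> G mu (e @: [set: T]) = F a) ->
  ((\sum_mu \sum_(P | cycpart l mu P setT) G mu P) *+ (#|T|)`! = (\sum_a F a) *+ (#|U|)`!)%R.
Proof.
move=> l_gt0 cU GF.
pose Y (p : {perm U} * {ffun T -> U}) :=
  injectiveb p.2 && cycpart l p.1 (p.2 @: [set: T]) setT.
transitivity (\sum_(p | Y p) G p.1 (p.2 @: [set: T]))%R.
  rewrite -(pair_big_dep xpredT (fun mu e => Y (mu, e))
     (fun mu (e : {ffun T -> U}) => G mu (e @: [set: T]))) /=.
  rewrite -sumrMnl; apply: eq_bigr => mu _; rewrite -sumrMnl.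
  rewrite [RHS](partition_big (fun e : {ffun T -> U} => e @: [set: T])
     (fun P => cycpart l mu P setT)) => [|e /andP[]] //=.
  apply: eq_bigr => P cp; have cP : #|P| = #|T|.
    have := cycpart_card cp; rewrite cardsT cU => /eqP.
    by rewrite eqn_pmul2r // => /eqP.
  rewrite -(card_inj_onto cP) -sumr_const; apply: eq_big => [e|e].
    rewrite !inE /Y /=; case: (injectiveb _) => //=; rewrite andb_idl //.
    by move=> /eqP ->.
  by rewrite inE => /andP[_ /eqP ->].
pose X := [set b : {ffun 'I_l * T -> U} | injectiveb b].
have cX : #|X| = (#|U|)`!.
  by rewrite card_inj_ffuns card_prod card_ord cU mulnC ffactnn.
(* both sides are now sums over pairs, matched by h *)
rewrite -cX -sumr_const [RHS]exchange_big pair_big_dep /= => {cX}.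
pose h (p : {perm U} * {ffun T -> U}) : {perm T} * {ffun 'I_l * T -> U} :=
  (odflt 1%g [pick a : {perm T} | [forall x, (p.1 ^+ l)%g (p.2 x) == p.2 (a x)]],
   [ffun q => (p.1 ^+ (q : 'I_l * T).1)%g (p.2 q.2)]).
have hP p : Y p -> forall x, (p.1 ^+ l)%g (p.2 x) = p.2 ((h p).1 x).
  case: p => mu e /andP[/injectiveP /= ei cp] x; case: pickP => [a /forallP/(_ x)/eqP//|].
  have muT : mu @: [set: U] = [set: U].
    by apply/eqP; rewrite eqEcard subsetT card_imset ?leqnn //; exact: perm_inj.
  have [y|a ha] := @perm_restr _ _ e (mu ^+ l)%g ei (@perm_inj _ _).
    have : (mu ^+ l)%g (e y) \in e @: [set: T].
      by apply: (cycpart_stab_sub cp l_gt0 _ muT); apply: imset_f; rewrite inE.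
    by case/imsetP => z _ ->; exists z.
  by move/(_ a)/negbT/negP; case; apply/forallP => z; rewrite ha.
pose i0 := Ordinal l_gt0.
have h0 p x : (h p).2 (i0, x) = p.2 x by rewrite ffunE expg0 perm1.
transitivity (\sum_(p in h @: [set p | Y p]) F p.1)%R.
  rewrite big_imset => [|p p'] /=.
    apply: eq_big => [p|p Yp]; first by rewrite inE.
    have /andP[/injectiveP ei cp] := Yp.
    exact: (GF _ _ _ ei cp (hP _ Yp)).
  rewrite !inE => Yp Yp' e.
  have e2 : p.2 = p'.2 by apply/ffunP => x; rewrite -!h0 e.
  have /andP[_ cp] := Yp.
  rewrite [p]surjective_pairing [p']surjective_pairing e2; congr pair.
  apply/permP => u; have [i [x [il ->]]] := cyc_ex cp u.
  have eq j y (jl : (j < l)%N) : (p.1 ^+ j)%g (p.2 y) = (p'.1 ^+ j)%g (p.2 y).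
    have := congr1 (fun f : {perm T} * {ffun 'I_l * T -> U} => f.2 (Ordinal jl, y)) e.
    by rewrite !ffunE /= e2.
  rewrite -(permM (p.1 ^+ i)%g p.1) -expgSr (eq i) // -(permM (p'.1 ^+ i)%g p'.1) -expgSr.
  have [il'|] := ltnP i.+1 l; first by rewrite eq.
  rewrite leq_eqVlt ltnS leqNgt il orbF => /eqP <-.
  by rewrite hP // {2}e2 hP // e e2.
apply: eq_bigl => -[a b]; rewrite inE /=; apply/imsetP/injectiveP => [[p]|bi].
  rewrite inE => Yp e; have /andP[/injectiveP ei cp] := Yp.
  move=> [i x] [j y] /=; rewrite -[b]/(a, b).2 e !ffunE /=.
  by move/(cyc_uniq ei cp (ltn_ord i) (ltn_ord j)) => [/val_inj -> ->].
have cb : #|{: 'I_l * T}| = #|U| by rewrite card_prod card_ord cU mulnC.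
have [b' bK b'K] := inj_card_bij bi (eq_leq (esym cb)).
(* the inverse of h: mu is the shift of the first component, transported by b, where
   wrapping around from the last translate to the first one applies a *)
pose st (q : 'I_l * T) : 'I_l * T :=
  if insub q.1.+1 is Some i then (i, q.2) else (i0, a q.2).
have sti : injective st.
  move=> [i x] [j y]; rewrite /st /=.
  case: insubP => [i' _ ei|iN]; case: insubP => [j' _ ej|jN] //.
  - by case=> e ->; move: ei; rewrite e ej => -[/val_inj ->].
  - by case=> e; move: ei; rewrite e.
  - by case=> e; move: ej; rewrite -e.
  case=> /perm_inj ->; congr pair; apply: val_inj.
  have := ltn_ord i; have := ltn_ord j; rewrite /=; lia.
have mi : injective (fun u => b (st (b' u))).
  by move=> u v /bi/sti/(can_inj b'K).
pose mu := perm mi; pose e : {ffun T -> U} := [ffun x => b (i0, x)].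
have muX i x : (i < l)%N -> forall (il : (i < l)%N), (mu ^+ i)%g (e x) = b (Ordinal il, x).
  elim: i => [|i IH] _ il.
    by rewrite expg0 perm1 ffunE; congr (b (_, _)); apply: val_inj.
  rewrite expgSr permM (IH _ (ltnW il)) ?(ltnW il) // permE bK /st /= insubT /=.
  by congr (b (_, _)); apply: val_inj.
have ei : injective e by move=> x y; rewrite !ffunE => /bi[].
have mul x : (mu ^+ l)%g (e x) = e (a x).
  have l1 : (l.-1 < l)%N by rewrite prednK.
  rewrite -(prednK l_gt0) expgSr permM (muX _ _ l1 l1) permE bK /st /= insubF ?ffunE //.
  by rewrite prednK // ltnn.
have cp : cycpart l mu (e @: [set: T]) setT.
  apply/forallP => u; rewrite inE; have [q bq] : exists q, b q = u by exists (b' u).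
  case: q bq => i x <-.
  have E (j : 'I_l) : (b (i, x) \in [set (mu ^+ j)%g x | x in e @: [set: T]]) = (j == i).
    apply/imsetP/eqP => [[_ /imsetP[y _ ->]]|->].
      by rewrite (muX _ _ (ltn_ord j) (ltn_ord j)) => /bi[-> _]; apply: val_inj.
    exists (e x); first by rewrite imset_f.
    by rewrite (muX _ _ (ltn_ord i) (ltn_ord i)); congr (b (_, _)); apply: val_inj.
  under eq_bigr do rewrite E.
  by rewrite (bigD1 i) //= eqxx big1 // => j /negPf ->.
have Yme : Y (mu, e) by apply/andP; split => //=; apply/injectiveP.
exists (mu, e); first by rewrite inE.
rewrite [RHS]surjective_pairing; congr pair.
  by apply/permP => x; apply: ei; rewrite -(hP (mu, e)) // mul.
apply/ffunP => -[i x]; rewrite ffunE /= (muX _ _ (ltn_ord i) (ltn_ord i)).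
by congr (b (_, _)); apply: val_inj.
Qed.

Local Open Scope ring_scope.

(** * Counts of fixed structures on stable sets of labels *)

(** A count is evaluated on subsets A and B of the labels, not on label types of their own:
supports of parts of a structure are then just subsets, and no relabeling to smaller
types is needed when a structure is cut. *)
Definition fix_count : Type :=
  forall U V : finType, {set U} -> {set V} -> {perm U} -> {perm V} -> nat.

(** The maps f and g have to intertwine the permutations on A and B only, so the value
depends on nothing but the restrictions of mu and nu to these sets. *)
Definition natural (Phi : fix_count) : Prop :=
  forall (U U' V V' : finType) (f : U -> U') (g : V -> V') (A : {set U}) (B : {set V})
    (mu : {perm U}) (mu' : {perm U'}) (nu : {perm V}) (nu' : {perm V'}),
  injective f -> injective g -> mu @: A = A -> nu @: B = B ->
  {in A, forall x, mu' (f x) = f (mu x)} -> {in B, forall y, nu' (g y) = g (nu y)} ->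
  Phi U' V' (f @: A) (g @: B) mu' nu' = Phi U V A B mu nu.

Definition stable (Phi : fix_count) : Prop :=
  forall (U V : finType) (A : {set U}) (B : {set V}) (mu : {perm U}) (nu : {perm V}),
  Phi U V A B mu nu != 0%N -> mu @: A = A /\ nu @: B = B.

Definition conv (Phi Psi : fix_count) : fix_count := fun U V A B mu nu =>
  (\sum_(A1 : {set U} | A1 \subset A) \sum_(B1 : {set V} | B1 \subset B)
    Phi U V A1 B1 mu nu * Psi U V (A :\: A1) (B :\: B1) mu nu)%N.

(** Counts l structures permuted cyclically: the one supported by P and Q determines the
others, and has to be fixed by the l-th powers. *)
Definition cyc_count (l : nat) (Phi : fix_count) : fix_count := fun U V A B mu nu =>
  (\sum_(P | cycpart l mu P A) \sum_(Q | cycpart l nu Q B)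
     Phi U V P Q (mu ^+ l)%g (nu ^+ l)%g)%N.

Definition unit_count : fix_count := fun U V A B mu nu => (A == set0) && (B == set0).

Lemma imset_eqI (T T' : finType) (f : T -> T') (A : {set T}) (mu : {perm T})
    (mu' : {perm T'}) : injective f -> {in A, forall x, mu' (f x) = f (mu x)} ->
  (mu' @: (f @: A) == f @: A) = (mu @: A == A).
Proof.
move=> fi h; have -> : mu' @: (f @: A) = f @: (mu @: A).
  by rewrite -!imset_comp; apply: eq_in_imset => x xA /=; rewrite h.
by rewrite (inj_eq (imset_inj fi)).
Qed.

(** Subsets of an image under an injection are images of subsets; this is how naturality
is passed to sums over supports. *)
Lemma sum_subset_imset (R : nmodType) (T T' : finType) (f : T -> T') (A : {set T})
    (C : pred {set T}) (C' : pred {set T'}) (G : {set T} -> R) (G' : {set T'} -> R) :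
  injective f ->
  (forall P : {set T}, P \subset A -> C' (f @: P) = C P) ->
  (forall P : {set T}, P \subset A -> C P -> G' (f @: P) = G P) ->
  \sum_(P : {set T'} | (P \subset f @: A) && C' P) G' P =
  \sum_(P : {set T} | (P \subset A) && C P) G P.
Proof.
move=> fi hC hG.
transitivity (\sum_(P in (fun P : {set T} => f @: P) @: [set P : {set T} | (P \subset A) && C P]) G' P).
  apply: eq_bigl => P; apply/andP/imsetP => [[/subsetP PA CP]|[Q]]; last first.
    rewrite inE => /andP[QA CQ] ->; split; first exact: imsetS.
    by rewrite hC.
  have eP : P = f @: (f @^-1: P).
    apply/setP => u; apply/idP/imsetP => [uP|[x]]; last by rewrite inE => h ->.
    have /imsetP[x xA eu] := PA _ uP; exists x => //; by rewrite inE -eu.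
  have sub : f @^-1: P \subset A.
    apply/subsetP => x; rewrite inE => /PA /imsetP[y yA /fi ->//].
  by exists (f @^-1: P) => //; rewrite inE sub -hC // -eP.
rewrite big_imset => [|P Q _ _ /(imset_inj fi) //] /=.
by apply: eq_big => [P|P]; rewrite inE // => /andP[PA CP]; rewrite hG.
Qed.

Lemma imsetD_inj (T T' : finType) (f : T -> T') (A B : {set T}) : injective f ->
  f @: (A :\: B) = f @: A :\: f @: B.
Proof.
move=> fi; apply/setP => u; rewrite inE; apply/imsetP/andP => [[x]|[uB /imsetP[x xA eu]]].
  by rewrite inE => /andP[xB xA] ->; rewrite !(mem_imset _ _ fi).
exists x => //; rewrite inE xA andbT; apply: contra uB => xB.
by rewrite eu imset_f.
Qed.

Lemma stab_setD (T : finType) (mu : {perm T}) (A B : {set T}) :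
  mu @: A = A -> mu @: B = B -> mu @: (A :\: B) = A :\: B.
Proof. by move=> eA eB; rewrite (imsetD_inj _ _ (@perm_inj _ mu)) eA eB. Qed.

Lemma natural_conv Phi Psi : natural Phi -> natural Psi -> stable Phi -> stable Psi ->
  natural (conv Phi Psi).
Proof.
move=> nP nQ sP sQ U U' V V' f g A B mu mu' nu nu' fi gi muA nuB hf hg.
rewrite /conv; under eq_bigl do rewrite -[_ \subset _]andbT.
under [RHS]eq_bigl do rewrite -[_ \subset _]andbT.
apply: sum_subset_imset => // A1 A1A _.
under eq_bigl do rewrite -[_ \subset _]andbT.
under [RHS]eq_bigl do rewrite -[_ \subset _]andbT.
apply: sum_subset_imset => // B1 B1B _.
have hf1 : {in A1, forall x, mu' (f x) = f (mu x)} by move=> x /(subsetP A1A)/hf.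
have hg1 : {in B1, forall x, nu' (g x) = g (nu x)} by move=> x /(subsetP B1B)/hg.
have hf2 : {in A :\: A1, forall x, mu' (f x) = f (mu x)} by move=> x /setDP[/hf].
have hg2 : {in B :\: B1, forall x, nu' (g x) = g (nu x)} by move=> x /setDP[/hg].
case: (eqVneq (mu @: A1) A1) => [e1|ne]; last first.
  case: (eqVneq (Phi U V A1 B1 mu nu) 0%N) => [->|/sP[e _]]; last by rewrite e eqxx in ne.
  case: (eqVneq (Phi U' V' (f @: A1) (g @: B1) mu' nu') 0%N) => [->//|/sP[/eqP e _]].
  by rewrite (imset_eqI fi hf1) (negPf ne) in e.
case: (eqVneq (nu @: B1) B1) => [e2|ne]; last first.
  case: (eqVneq (Phi U V A1 B1 mu nu) 0%N) => [->|/sP[_ e]]; last by rewrite e eqxx in ne.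
  case: (eqVneq (Phi U' V' (f @: A1) (g @: B1) mu' nu') 0%N) => [->//|/sP[_ /eqP e]].
  by rewrite (imset_eqI gi hg1) (negPf ne) in e.
rewrite -!imsetD_inj //; congr (_ * _)%N; first exact: nP.
by apply: nQ => //; apply: stab_setD.
Qed.

Lemma sum_neq0 (I : finType) (P : pred I) (F : I -> nat) :
  (\sum_(i | P i) F i != 0)%N -> exists2 i, P i & F i != 0%N.
Proof.
move=> h; have : [exists i, P i && (F i != 0%N)].
  apply: contraNT h; rewrite negb_exists => /forallP h.
  rewrite big1 // => i Pi; have := h i; rewrite Pi /= negbK => /eqP //.
by case/existsP => i /andP[Pi Fi]; exists i.
Qed.

Lemma stable_conv Phi Psi : stable Phi -> stable Psi -> stable (conv Phi Psi).
Proof.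
move=> sP sQ U V A B mu nu /sum_neq0[A1 A1A /sum_neq0[B1 B1B]].
rewrite muln_eq0 negb_or => /andP[/sP[eA eB] /sQ[eA' eB']].
rewrite -(setID A A1) (setIidPr A1A) imsetU eA eA'.
by rewrite -(setID B B1) (setIidPr B1B) imsetU eB eB'.
Qed.

Lemma natural_unit : natural unit_count.
Proof.
move=> U U' V V' f g A B mu mu' nu nu' fi gi _ _ _ _.
by rewrite /unit_count !imset_eq0.
Qed.

Lemma stable_unit : stable unit_count.
Proof.
move=> U V A B mu nu; rewrite /unit_count eqb0 negbK => /andP[/eqP -> /eqP ->].
by rewrite !imset0.
Qed.

Section CycCount.
Variable l : nat.
Hypothesis l_gt0 : (0 < l)%N.

Lemma cycpart_sub (T : finType) (mu : {perm T}) (P A : {set T}) : cycpart l mu P A -> P \subset A.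
Proof.
move=> cp; apply/subsetP => x xP; apply/(cycpartP cp); exists (Ordinal l_gt0), x.
by rewrite perm1.
Qed.

Lemma cycpart_imset (T T' : finType) (f : T -> T') (mu : {perm T}) (mu' : {perm T'})
    (A P : {set T}) :
  injective f -> mu @: A = A -> {in A, forall x, mu' (f x) = f (mu x)} -> P \subset A ->
  cycpart l mu' (f @: P) (f @: A) = cycpart l mu P A.
Proof.
move=> fi muA hf PA.
have XA j x : x \in A -> (mu ^+ j)%g x \in A.
  move=> xA; elim: j => [|j IH]; first by rewrite perm1.
  by rewrite expgSr permM -muA imset_f.
have hX j x : x \in A -> (mu' ^+ j)%g (f x) = f ((mu ^+ j)%g x).
  move=> xA; elim: j => [|j IH]; first by rewrite !perm1.
  by rewrite !expgSr !permM IH hf // XA.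
have E j : [set (mu' ^+ j)%g x | x in f @: P] = f @: [set (mu ^+ j)%g x | x in P].
  rewrite -!imset_comp; apply: eq_in_imset => x /(subsetP PA) xA /=.
  exact: hX.
apply/forallP/forallP => [h x|h u].
  have := h (f x); rewrite (mem_imset _ _ fi).
  by under eq_bigr do rewrite E (mem_imset _ _ fi).
under eq_bigr do rewrite E.
case: (boolP [exists x, u == f x]) => [/existsP[x /eqP ->]|nx].
  rewrite (mem_imset _ _ fi); under eq_bigr do rewrite (mem_imset _ _ fi).
  exact: h.
have n (D : {set T}) : (u \in f @: D) = false.
  by apply: contraNF nx => /imsetP[x _ ->]; apply/existsP; exists x.
by rewrite n big1 // => j _; rewrite n.
Qed.

Lemma natural_cyc_count Phi : natural Phi -> natural (cyc_count l Phi).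
Proof.
move=> nP U U' V V' f g A B mu mu' nu nu' fi gi muA nuB hf hg.
have sub (T : finType) (s : {perm T}) (D : {set T}) (F : {set T} -> nat) :
    (\sum_(P : {set T} | cycpart l s P D) F P = \sum_(P : {set T} | (P \subset D) && cycpart l s P D) F P)%N.
  by apply: eq_bigl => P; case: (boolP (cycpart _ _ _ _)) => [/cycpart_sub->|]; rewrite ?andbF.
rewrite /cyc_count !sub; apply: sum_subset_imset => // [P PA|P PA cp]; first exact: cycpart_imset.
rewrite !sub; apply: sum_subset_imset => // [Q QB|Q QB cq]; first exact: cycpart_imset.
have XA (T T' : finType) (h : T -> T') (s : {perm T}) (s' : {perm T'}) (D : {set T}) :
    s @: D = D -> {in D, forall x, s' (h x) = h (s x)} ->
    {in D, forall x, (s' ^+ l)%g (h x) = h ((s ^+ l)%g x)}.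
  move=> sD hD x xD; suff [] : (s' ^+ l)%g (h x) = h ((s ^+ l)%g x) /\ (s ^+ l)%g x \in D by [].
  elim: l => [|j [IH IH']]; first by rewrite !perm1.
  by rewrite !expgSr !permM IH hD //; split=> //; rewrite -sD imset_f.
apply: nP => //; first exact: cycpart_stab cp l_gt0 muA.
- exact: cycpart_stab cq l_gt0 nuB.
- by move=> x /(subsetP PA); apply: XA.
by move=> x /(subsetP QB); apply: XA.
Qed.

Lemma cycpart_stab_conv (T : finType) (mu : {perm T}) (P A : {set T}) : cycpart l mu P A ->
  [set (mu ^+ l)%g x | x in P] = P -> mu @: A = A.
Proof.
move=> cp st; apply/eqP; rewrite eqEcard card_imset ?leqnn ?andbT; last exact: perm_inj.
apply/subsetP => _ /imsetP[u /(cycpartP cp)[i [x [xP ->]]] ->].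
rewrite -(permM (mu ^+ i)%g mu) -expgSr; apply/(cycpartP cp).
have [il|] := ltnP i.+1 l; first by exists (Ordinal il), x.
rewrite leq_eqVlt ltnS leqNgt ltn_ord orbF => /eqP <-.
exists (Ordinal l_gt0), ((mu ^+ l)%g x); rewrite expg0 perm1; split=> //.
by rewrite -st imset_f.
Qed.

Lemma stable_cyc_count Phi : stable Phi -> stable (cyc_count l Phi).
Proof.
move=> sP U V A B mu nu /sum_neq0[P cp /sum_neq0[Q cq /sP[eP eQ]]].
by split; [apply: cycpart_stab_conv cp eP | apply: cycpart_stab_conv cq eQ].
Qed.

End CycCount.

(** * The generating series of a count *)

(** Names for the two weights, so that rewriting does not have to recover the ring of
series from its carrier. *)
Definition wtx (T : finType) (mu : {perm T}) : series (nat + nat)%type := cycle_weight px mu.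
Definition wty (T : finType) (mu : {perm T}) : series (nat + nat)%type := cycle_weight py mu.

Lemma wtx_conj (T T1 : finType) (mu : {perm T}) (a : {perm T1}) (f : T1 -> T) :
  bijective f -> (forall x, mu (f x) = f (a x)) -> wtx mu = wtx a.
Proof. exact: wt_conj. Qed.

Lemma wty_conj (T T1 : finType) (mu : {perm T}) (a : {perm T1}) (f : T1 -> T) :
  bijective f -> (forall x, mu (f x) = f (a x)) -> wty mu = wty a.
Proof. exact: wt_conj. Qed.

Lemma wtx_card0 (T : finType) (mu : {perm T}) : #|T| = 0%N -> wtx mu = 1.
Proof. exact: wt_card0. Qed.

Lemma wty_card0 (T : finType) (mu : {perm T}) : #|T| = 0%N -> wty mu = 1.
Proof. exact: wt_card0. Qed.

Lemma wtx_union (T T1 T2 : finType) (mu : {perm T}) (a : {perm T1})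
    (b : {perm T2}) (f : T1 -> T) (g : T2 -> T) (A : {set T}) :
  injective f -> injective g -> f @: [set: T1] = A -> g @: [set: T2] = ~: A ->
  (forall x, mu (f x) = f (a x)) -> (forall x, mu (g x) = g (b x)) ->
  wtx mu = wtx a * wtx b.
Proof. exact: wt_union. Qed.

Lemma wty_union (T T1 T2 : finType) (mu : {perm T}) (a : {perm T1})
    (b : {perm T2}) (f : T1 -> T) (g : T2 -> T) (A : {set T}) :
  injective f -> injective g -> f @: [set: T1] = A -> g @: [set: T2] = ~: A ->
  (forall x, mu (f x) = f (a x)) -> (forall x, mu (g x) = g (b x)) ->
  wty mu = wty a * wty b.
Proof. exact: wt_union. Qed.

Lemma porbits_gt0 (T : finType) (mu : {perm T}) c : c \in porbits mu -> (0 < #|c|)%N.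
Proof. by case/imsetP => x _ ->; rewrite lt0n card_porbit_neq0. Qed.

Lemma wtx_cyc (U T : finType) l (mu : {perm U}) (a : {perm T}) (e : T -> U) :
  (0 < l)%N -> injective e -> cycpart l mu (e @: [set: T]) setT ->
  (forall x, (mu ^+ l)%g (e x) = e (a x)) -> wtx mu = dilate l (wtx a).
Proof.
move=> l0 ei cp ea; rewrite /wtx (wt_cyc l0 ei cp ea) [RHS](dilate_prod l0).
by apply: eq_bigr => c /porbits_gt0 c0; rewrite (dilate_px l0).
Qed.

Lemma wty_cyc (U T : finType) l (mu : {perm U}) (a : {perm T}) (e : T -> U) :
  (0 < l)%N -> injective e -> cycpart l mu (e @: [set: T]) setT ->
  (forall x, (mu ^+ l)%g (e x) = e (a x)) -> wty mu = dilate l (wty a).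
Proof.
move=> l0 ei cp ea; rewrite /wty (wt_cyc l0 ei cp ea) [RHS](dilate_prod l0).
by apply: eq_bigr => c /porbits_gt0 c0; rewrite (dilate_py l0).
Qed.

Definition fix_sum (Phi : fix_count) (U V : finType) : series (nat + nat)%type :=
  \sum_(mu : {perm U}) \sum_(nu : {perm V})
    (wtx mu * wty nu) *+ Phi U V setT setT mu nu.

Definition cycle_series (Phi : fix_count) := egf (fun m n => fix_sum Phi 'I_m 'I_n).

Definition wtmon (U V : finType) (mu : {perm U}) (nu : {perm V}) : {cmonom (nat + nat)%type} :=
  mmul (\big[mmul/mone]_(c in porbits mu) ucm (inl #|c|.-1))
       (\big[mmul/mone]_(c in porbits nu) ucm (inr #|c|.-1)).

Lemma wt_mono (U V : finType) (mu : {perm U}) (nu : {perm V}) :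
  wtx mu * wty nu = mono (wtmon mu nu).
Proof. by rewrite monoM !mono_prod. Qed.

Lemma wx_wtmon (U V : finType) (mu : {perm U}) (nu : {perm V}) :
  wx (wtmon mu nu) = #|U| /\ wy (wtmon mu nu) = #|V|.
Proof.
rewrite /wx /wy !wdegM !wdeg_prod; split.
  rewrite [X in (_ + X)%N]big1 => [|c _]; last by rewrite wdegU.
  rewrite addn0 -(card_porbits_sum mu); apply: eq_bigr => c /porbits_gt0 c0.
  by rewrite wdegU prednK.
rewrite [X in (X + _)%N]big1 => [|c _]; last by rewrite wdegU.
rewrite add0n -(card_porbits_sum nu); apply: eq_bigr => c /porbits_gt0 c0.
by rewrite wdegU prednK.
Qed.

Lemma homog_fix_sum Phi : homog (fun m n => fix_sum Phi 'I_m 'I_n).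
Proof.
move=> m n M; apply: contraNP => hM; rewrite /fix_sum scoef_sum big1 // => mu _.
rewrite scoef_sum big1 // => nu _; rewrite scoefMn wt_mono /=.
case: eqP => [eM|]; last by rewrite mul0rn.
by case: hM; have [] := wx_wtmon mu nu; rewrite eM !card_ord.
Qed.

Lemma cycle_series_ext Phi Psi : (forall U V (mu : {perm U}) (nu : {perm V}),
   Phi U V setT setT mu nu = Psi U V setT setT mu nu) -> cycle_series Phi = cycle_series Psi.
Proof.
by move=> e; apply: eq_egf => m n; do 2!apply: eq_bigr => ? _; rewrite e.
Qed.

Lemma bij_of_card (T T' : finType) : #|T| = #|T'| -> exists f : T -> T', bijective f.
Proof.
move=> e; exists (fun x => enum_val (cast_ord e (enum_rank x))).
exists (fun x => enum_val (cast_ord (esym e) (enum_rank x))) => x.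
  by rewrite enum_valK cast_ordK enum_rankK.
by rewrite enum_valK cast_ordKV enum_rankK.
Qed.

Lemma imsetT_bij (T T' : finType) (f : T -> T') : bijective f -> f @: [set: T] = [set: T'].
Proof.
move=> bf; apply/eqP; rewrite eqEcard subsetT card_imset; last exact: bij_inj.
by rewrite !cardsT (bij_eq_card bf) leqnn.
Qed.

Lemma stabT (T : finType) (mu : {perm T}) : mu @: [set: T] = [set: T].
Proof. exact: imsetT_bij (perm_bij mu). Qed.

Lemma fix_sum_card Phi (U U' V V' : finType) : natural Phi -> #|U| = #|U'| -> #|V| = #|V'| ->
  fix_sum Phi U V = fix_sum Phi U' V'.
Proof.
move=> nP /bij_of_card [f bf] /bij_of_card [g bg]; apply/esym.
apply: (sum_perm_conj bf) => mu a ha; apply: (sum_perm_conj bg) => nu b hb.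
rewrite (wtx_conj bf ha) (wty_conj bg hb); congr (_ *+ _).
rewrite -(imsetT_bij bf) -(imsetT_bij bg); apply: nP; rewrite ?stabT //; exact: bij_inj.
Qed.

Lemma enum_val_imset (T : finType) (A : {set T}) : (@enum_val _ (mem A)) @: [set: 'I_#|A|] = A.
Proof.
apply/setP => x; apply/imsetP/idP => [[i _ ->]|xA]; first exact: enum_valP.
by exists (enum_rank_in xA x); rewrite ?enum_rankK_in.
Qed.

(** Only splittings of the labels that are preserved by both permutations contribute; these
permutations are then pairs of permutations of the parts, and the weight is
multiplicative. *)
Lemma fix_sum_conv Phi Psi (U V : finType) : natural Phi -> natural Psi ->
  stable Phi -> stable Psi ->
  fix_sum (conv Phi Psi) U V = \sum_(A : {set U}) \sum_(B : {set V})
    fix_sum Phi 'I_#|A| 'I_#|B| * fix_sum Psi 'I_#|~: A| 'I_#|~: B|.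
Proof.
move=> nP nQ sP sQ; rewrite /fix_sum.
transitivity (\sum_(A : {set U}) \sum_(B : {set V}) \sum_(mu : {perm U})
  \sum_(nu : {perm V}) (wtx mu * wty nu) *+
      (Phi U V A B mu nu * Psi U V (~: A) (~: B) mu nu)).
  under [RHS]eq_bigr => A _ do rewrite exchange_big /=.
  rewrite [RHS]exchange_big /=; apply: eq_bigr => mu _.
  under [RHS]eq_bigr => A _ do rewrite exchange_big /=.
  rewrite [RHS]exchange_big /=; apply: eq_bigr => nu _.
  rewrite /conv -sumrMnr; apply: eq_big => [A|A _]; first by rewrite subsetT.
  rewrite -sumrMnr; apply: eq_big => [B|B _]; first by rewrite subsetT.
  by rewrite !setTD.
apply: eq_bigr => A _; apply: eq_bigr => B _.
have eA := enum_val_imset A; have eA' := enum_val_imset (~: A).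
have eB := enum_val_imset B; have eB' := enum_val_imset (~: B).
have vi := @enum_val_inj.
rewrite (@sum_perm_stab _ _ _ _ _ _ A _ (fun a a' => \sum_b \sum_b'
   (wtx a * wty b) *+ Phi 'I_#|A| 'I_#|B| setT setT a b *
   ((wtx a' * wty b') *+ Psi 'I_#|~: A| 'I_#|~: B| setT setT a' b')) (vi _ _) (vi _ _) eA eA').
- rewrite big_distrl /=; apply: eq_bigr => a _; rewrite big_distrr /=; apply: eq_bigr => a' _.
  rewrite big_distrl /=; apply: eq_bigr => b _; rewrite big_distrr /=; apply: eq_bigr => b' _.
  by [].
- move=> mu ne; rewrite big1 // => nu _.
  case: (eqVneq (Phi U V A B mu nu) 0%N) => [->|/sP[e _]]; first by rewrite mul0n mulr0n.
  by rewrite e eqxx in ne.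
move=> mu a a' ha ha'.
apply: (@sum_perm_stab _ _ _ _ _ _ B _ _ (vi _ _) (vi _ _) eB eB').
- move=> nu ne; case: (eqVneq (Phi U V A B mu nu) 0%N) => [->|/sP[_ e]].
    by rewrite mul0n mulr0n.
  by rewrite e eqxx in ne.
move=> nu b b' hb hb'.
rewrite (wtx_union (vi _ _) (vi _ _) eA eA' ha ha').
rewrite (wty_union (vi _ _) (vi _ _) eB eB' hb hb').
rewrite [RHS]mulrnAl mulrnAr -mulrnA mulrACA [in RHS]mulnC; congr (_ *+ (_ * _)).
  rewrite -{1}eA -{1}eB; apply: nP; rewrite ?stabT //; exact: vi.
rewrite -{1}eA' -{1}eB'; apply: nQ; rewrite ?stabT //; exact: vi.
Qed.

Lemma sum_sets_card (R : nmodType) (T : finType) (G : nat -> R) :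
  \sum_(A : {set T}) G #|A| = \sum_(a < #|T|.+1) G a *+ 'C(#|T|, a).
Proof.
rewrite (partition_big (fun A : {set T} => inord #|A| : 'I_#|T|.+1) xpredT) //=.
apply: eq_bigr => a _; rewrite -card_draws -sumr_const.
have E (A : {set T}) : (inord #|A| == a :> 'I_#|T|.+1) = (#|A| == a).
  by rewrite -val_eqE /= inordK // ltnS max_card.
apply: eq_big => [A|A]; rewrite E ?inE //.
by move=> /eqP ->.
Qed.

(** By naturality the contribution of a splitting depends only on the sizes of its parts;
the number of splittings of given sizes is the binomial coefficient in the product of
exponential series. *)
Lemma cycle_series_conv Phi Psi : natural Phi -> natural Psi -> stable Phi -> stable Psi ->
  cycle_series (conv Phi Psi) = cycle_series Phi * cycle_series Psi.
Proof.
move=> nP nQ sP sQ; rewrite egfM; try exact: homog_fix_sum.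
apply: eq_egf => m n; rewrite fix_sum_conv //.
have C (a b : nat) (A : {set 'I_a}) : #|~: A| = (a - #|A|)%N by rewrite cardsCs setCK card_ord.
under eq_bigr => A _.
  under eq_bigr => B _.
    rewrite (@fix_sum_card Psi _ 'I_(m - #|A|) _ 'I_(n - #|B|)) ?card_ord ?C //.
    over.
  rewrite (sum_sets_card 'I_n
     (fun b => fix_sum Phi 'I_#|A| 'I_b * fix_sum Psi 'I_(m - #|A|) 'I_(n - b))).
  over.
rewrite (sum_sets_card 'I_m (fun a => \sum_(b < #|'I_n|.+1)
   fix_sum Phi 'I_a 'I_b * fix_sum Psi 'I_(m - a) 'I_(n - b) *+ 'C(#|'I_n|, b))) /=.
rewrite !card_ord; apply: eq_bigr => a _; rewrite -sumrMnl; apply: eq_bigr => b _.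
by rewrite -mulrnA mulnC.
Qed.

Lemma fix_sum_unit (U V : finType) :
  fix_sum unit_count U V = ((#|U| == 0) && (#|V| == 0))%N%:R.
Proof.
have E (T : finType) : ([set: T] == set0) = (#|T| == 0)%N by rewrite -cards_eq0 cardsT.
rewrite /fix_sum /unit_count !E; case: (boolP (_ && _)) => [|_]; last first.
  by rewrite big1 // => mu _; rewrite big1 // => nu _; rewrite mulr0n.
case/andP => /eqP cU /eqP cV.
have P1 (T : finType) (mu : {perm T}) : #|T| = 0%N -> mu = 1%g.
  by move=> cT; apply/permP => x; have := card0_eq cT x; rewrite inE.
rewrite (bigD1 1%g) //= [X in _ + X]big1 => [|mu]; last by rewrite (P1 _ mu cU) eqxx.
rewrite (bigD1 1%g) //= [X in _ + X + _]big1 => [|nu]; last by rewrite (P1 _ nu cV) eqxx.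
by rewrite wtx_card0 // wty_card0 // mul1r !addr0.
Qed.

Lemma cycle_series_unit : cycle_series unit_count = 1.
Proof.
apply: seriesP => M; rewrite scoef1 [LHS]/= fix_sum_unit !card_ord.
case: (eqVneq M mone) => [->|ne].
  by rewrite /wx /wy !wdeg1 /= eqxx invr1 mulr1.
have [|] := boolP (_ && _); last by rewrite scoef0 mulr0.
by rewrite scoef1 (negPf ne) mulr0.
Qed.

Lemma fix_sum_cyc_count l Phi (U V T S : finType) : (0 < l)%N -> natural Phi ->
  #|U| = (#|T| * l)%N -> #|V| = (#|S| * l)%N ->
  fix_sum (cyc_count l Phi) U V *+ ((#|T|)`! * (#|S|)`!) =
  dilate l (fix_sum Phi T S) *+ ((#|U|)`! * (#|V|)`!).
Proof.
move=> l0 nP cU cV; rewrite /fix_sum.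
rewrite (dilate_sum l0).
under [in RHS]eq_bigr do rewrite (dilate_sum l0).
transitivity ((\sum_(mu : {perm U}) \sum_(P | cycpart l mu P setT)
  ((\sum_(nu : {perm V}) \sum_(Q | cycpart l nu Q setT)
   (wtx mu * wty nu) *+ Phi U V P Q (mu ^+ l)%g (nu ^+ l)%g) *+ (#|S|)`!)) *+ (#|T|)`!).
  rewrite mulnC mulrnA; congr (_ *+ _); rewrite -sumrMnl; apply: eq_bigr => mu _.
  rewrite sumrMnl; congr (_ *+ _); rewrite [RHS]exchange_big /=; apply: eq_bigr => nu _.
  rewrite /cyc_count -sumrMnr; apply: eq_bigr => P _.
  by rewrite -sumrMnr.
rewrite (sum_perm_cyc (F := fun a => (\sum_b dilate l ((wtx a * wty b)
     *+ Phi T S setT setT a b)) *+ (#|V|)`!) l0 cU) => [|mu a e ei cp ea].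
  by rewrite sumrMnl -mulrnA mulnC.
rewrite (sum_perm_cyc (F := fun b => dilate l ((wtx a * wty b)
     *+ Phi T S setT setT a b)) l0 cV) => [//|nu b d di cq db].
rewrite (dilateMn l0) (dilateM l0) (wtx_cyc l0 ei cp ea) (wty_cyc l0 di cq db).
congr (_ * _ *+ _).
by apply: nP; rewrite ?stabT.
Qed.

(** The sums over the two sorts of labels are treated one after the other with
[sum_perm_cyc]. *)
Lemma cycle_series_cyc_count l Phi : (0 < l)%N -> natural Phi ->
  cycle_series (cyc_count l Phi) = dilate l (cycle_series Phi).
Proof.
move=> l0 nP; apply/esym; apply: egf_dilate => // [m n|m n nd].
  by have := @fix_sum_cyc_count l Phi 'I_(m * l) 'I_(n * l) 'I_m 'I_n l0 nP; rewrite !card_ord; apply.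
rewrite /fix_sum big1 // => mu _; rewrite big1 // => nu _.
case: (eqVneq (cyc_count l Phi setT setT mu nu) 0%N) => [->|/sum_neq0[P cp /sum_neq0[Q cq _]]].
  by rewrite mulr0n.
have := cycpart_card cp; have := cycpart_card cq; rewrite !cardsT !card_ord => en em.
by case/negP: nd; rewrite en em !dvdn_mull.
Qed.

Lemma cycle_series_muln Phi c :
  cycle_series (fun U V A B mu nu => (Phi U V A B mu nu * c)%N) = cycle_series Phi *+ c.
Proof.
rewrite egfMn; apply: eq_egf => m n; rewrite /fix_sum -sumrMnl; apply: eq_bigr => mu _.
by rewrite -sumrMnl; apply: eq_bigr => nu _; rewrite mulrnA.
Qed.

Local Close Scope ring_scope.

(** * Species whose structures have supports *)

Section Families.
Variable gT : finGroupType.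

(** A species in which a structure z over (U, V) only uses part of the labels, its support
(bl z, wh z). The predicate ok singles out the genuine structures, rl relabels along
any maps and ac is the group action. Relabeling only depends on the values on the
support [rl_congr], and a structure supported by the image of an injection comes from
the source [rl_surj]. *)
Record sspecies := SSpecies {
  fam :> finType -> finType -> finType;
  ok : forall U V, pred (fam U V);
  bl : forall U V, fam U V -> {set U};
  wh : forall U V, fam U V -> {set V};
  rl : forall (U U' V V' : finType) (f : U -> U') (g : V -> V'), fam U V -> fam U' V';
  ac : forall U V, fam U V -> gT -> fam U V;
  ok_rl : forall (U U' V V' : finType) (f : U -> U') (g : V -> V') z,
    injective f -> injective g -> ok z -> ok (rl f g z);
  bl_rl : forall (U U' V V' : finType) (f : U -> U') (g : V -> V') z,
    bl (rl f g z) = f @: bl z;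
  wh_rl : forall (U U' V V' : finType) (f : U -> U') (g : V -> V') z,
    wh (rl f g z) = g @: wh z;
  rl_id : forall (U V : finType) (z : fam U V), rl id id z = z;
  rl_comp : forall (U U' U'' V V' V'' : finType) (f : U -> U') (g : V -> V')
      (f' : U' -> U'') (g' : V' -> V'') z,
    rl f' g' (rl f g z) = rl (f' \o f) (g' \o g) z;
  rl_congr : forall (U U' V V' : finType) (f f' : U -> U') (g g' : V -> V') z,
    ok z -> {in bl z, f =1 f'} -> {in wh z, g =1 g'} -> rl f g z = rl f' g' z;
  rl_inj : forall (U U' V V' : finType) (f : U -> U') (g : V -> V'),
    injective f -> injective g -> injective (@rl U U' V V' f g);
  rl_surj : forall (U U' V V' : finType) (f : U -> U') (g : V -> V') z,
    injective f -> injective g -> ok z -> bl z \subset f @: setT -> wh z \subset g @: setT ->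
    exists2 z0, ok z0 & rl f g z0 = z;
  ok_ac : forall U V (z : fam U V) c, ok z -> ok (ac z c);
  bl_ac : forall U V (z : fam U V) c, ok z -> bl (ac z c) = bl z;
  wh_ac : forall U V (z : fam U V) c, ok z -> wh (ac z c) = wh z;
  ac1 : forall U V (z : fam U V), ok z -> ac z 1%g = z;
  acM : forall U V (z : fam U V) c d, ok z -> ac z (c * d)%g = ac (ac z c) d;
  rl_ac : forall (U U' V V' : finType) (f : U -> U') (g : V -> V') z c,
    injective f -> injective g -> ok z -> rl f g (ac z c) = ac (rl f g z) c
}.

Variable K : sspecies.

Definition fixc (c : gT) : fix_count := fun U V A B mu nu =>
  (\sum_(z : K U V) [&& ok z, bl z == A, wh z == B & ac (rl mu nu z) c == z])%N.

Lemma rl_perm (U U' V V' : finType) (f : U -> U') (g : V -> V')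
    (A : {set U}) (B : {set V})
    (mu : {perm U}) (mu' : {perm U'}) (nu : {perm V}) (nu' : {perm V'}) (z : K U V) :
  ok z -> bl z \subset A -> wh z \subset B ->
  {in A, forall x, mu' (f x) = f (mu x)} -> {in B, forall y, nu' (g y) = g (nu y)} ->
  rl mu' nu' (rl f g z) = rl f g (rl mu nu z).
Proof.
move=> okz /subsetP bA /subsetP wB hf hg; rewrite !rl_comp.
by apply: rl_congr => // [x /bA/hf|y /wB/hg].
Qed.

Lemma natural_fixc c : natural (fixc c).
Proof.
move=> U U' V V' f g A B mu mu' nu nu' fi gi muA nuB hf hg.
rewrite /fixc -!big_mkcond /= !sum1dep_card.
rewrite -(card_imset _ (@rl_inj K U U' V V' f g fi gi)); apply: eq_card => z'.
rewrite !inE; apply/and4P/imsetP => [[okz /eqP bz /eqP wz /eqP ez]|[z]].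
  have [z okz0 e] : exists2 z0, ok z0 & rl f g z0 = z'.
    by apply: rl_surj; rewrite ?bz ?wz ?imsetS ?subsetT.
  move: bz wz ez; rewrite -{}e bl_rl wh_rl => /(imset_inj fi) bz /(imset_inj gi) wz ez.
  exists z => //; rewrite inE okz0 bz wz !eqxx /=; apply/eqP.
  apply: (rl_inj fi gi); rewrite rl_ac //; last by apply: ok_rl => //; apply: perm_inj.
  by rewrite -[RHS]ez (@rl_perm _ _ _ _ f g A B mu mu' nu nu') // ?bz ?wz.
rewrite inE => /and4P[okz /eqP bz /eqP wz /eqP ez] ->.
rewrite bl_rl wh_rl bz wz !eqxx; split=> //; first exact: ok_rl.
rewrite (@rl_perm _ _ _ _ f g A B mu mu' nu nu') ?bz ?wz // -rl_ac //; first by rewrite ez.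
by apply: ok_rl => //; apply: perm_inj.
Qed.

Lemma stable_fixc c : stable (fixc c).
Proof.
move=> U V A B mu nu /sum_neq0[z _]; rewrite eqb0 negbK => /and4P[okz /eqP bz /eqP wz /eqP ez].
have ok' : ok (rl mu nu z) by apply: ok_rl => //; apply: perm_inj.
split; first by rewrite -bz -{2}ez bl_ac // bl_rl.
by rewrite -wz -{2}ez wh_ac // wh_rl.
Qed.

End Families.

(** * Families of structures permuted by a permutation of the indices *)

Section ConvList.
Variables (C K U V : finType) (Q : C -> pred K).
Variables (M : C -> K -> U -> nat) (M' : C -> K -> V -> nat).

Definition indicates (T : finType) (a : T -> nat) (A : {set T}) := [forall u, a u == (u \in A)].

(** If a takes the values 0 and 1 only, it is the indicator of just one set A1; so the left
side has at most one nonzero term. *)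
Lemma sum_indicates (T : finType) (a b : T -> nat) (A : {set T}) :
  (\sum_(A1 : {set T} | A1 \subset A) indicates a A1 * indicates b (A :\: A1) =
   indicates (fun u => a u + b u) A)%N.
Proof.
(* the only candidate for A1 *)
pose A0 := [set u | a u != 0%N].
have H (A1 : {set T}) : indicates a A1 -> A1 = A0.
  move=> /forallP h; apply/setP => u; rewrite inE; have /eqP -> := h u.
  by case: (u \in A1).
rewrite big_mkcond (bigD1 A0) //= big1 ?addn0 => [|A1 ne]; last first.
  case: ifP => // _; case: (boolP (indicates a A1)) => [/H e|]; last by rewrite mul0n.
  by rewrite e eqxx in ne.
case: (boolP (indicates (fun u => _) A)) => [/forallP h|/negP n].
  have e u : a u = (u \in A0) /\ b u = (u \in A :\: A0) /\ (u \in A0 -> u \in A).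
    have /eqP := h u; rewrite !inE; case: (a u) => [|[|n]]; case: (b u) => [|[|m]];
    by case: (u \in A).
  have sub : A0 \subset A by apply/subsetP => u; case: (e u) => _ [].
  rewrite sub; have -> : indicates a A0 by apply/forallP => u; case: (e u) => ->.
  by have -> : indicates b (A :\: A0) by apply/forallP => u; case: (e u) => _ [->].
case: ifP => // sub; case: (boolP (indicates a A0)) => //= /forallP ha.
case: (boolP (indicates b _)) => //= /forallP hb; case: n; apply/forallP => u.
rewrite (eqP (ha u)) (eqP (hb u)) in_setD.
by have /implyP := subsetP sub u; case: (u \in A0) => //= ->.
Qed.

Definition sel (l : seq C) (z : {ffun C -> option K}) :=
  [forall c, if z c is Some w then (c \in l) && Q c w else c \notin l].

Definition mult (T : finType) (N : C -> K -> T -> nat) (z : {ffun C -> option K}) u :=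
  (\sum_c if z c is Some w then N c w u else 0)%N.

Variables (mu : {perm U}) (nu : {perm V}) (Phi : C -> fix_count).
Hypothesis PhiE : forall c A B,
  Phi c A B mu nu = (\sum_(w : K) (Q c w * indicates (M c w) A * indicates (M' c w) B))%N.

Lemma eq_indicates (T : finType) (a b : T -> nat) (A : {set T}) :
  a =1 b -> indicates a A = indicates b A.
Proof. by move=> e; apply: eq_forallb => u; rewrite e. Qed.

(** An iterated convolution, over a list of parts, of counts of structures with given
supports counts the ways to choose one structure for each part with disjoint supports
of union (A, B). *)
Lemma conv_list (l : seq C) (A : {set U}) (B : {set V}) : uniq l ->
  foldr (fun c => conv (Phi c)) unit_count l U V A B mu nu =
  (\sum_(z : {ffun C -> option K})
      sel l z * indicates (mult M z) A * indicates (mult M' z) B)%N.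
Proof.
elim: l A B => [|c l IH] A B /=.
  move=> _; rewrite (bigD1 [ffun => None]) //= [X in (_ + X)%N]big1 ?addn0 => [|z nz].
    have -> : sel [::] [ffun => None] by apply/forallP => c; rewrite ffunE.
    have E (T : finType) (N : C -> K -> T -> nat) (D : {set T}) :
        indicates (mult N [ffun=> None]) D = (D == set0).
      have m0 u : mult N [ffun=> None] u = 0%N by rewrite /mult big1 // => i _; rewrite ffunE.
      apply/forallP/eqP => [h|-> u]; last by rewrite m0 inE.
      by apply/setP => u; rewrite inE; have := h u; rewrite m0; case: (u \in D).
    by rewrite !E mul1n mulnb.
  case: (boolP (sel _ _)) => [/forallP h|]; last by rewrite !mul0n.
  by case/eqP: nz; apply/ffunP => d; rewrite ffunE; have := h d; case: (z d).
case/andP => cl ul.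
rewrite [LHS](_ : _ = \sum_(A1 : {set U} | A1 \subset A) \sum_(B1 : {set V} | B1 \subset B)
  (Phi c A1 B1 mu nu * foldr (fun c => conv (Phi c)) unit_count l U V
     (A :\: A1) (B :\: B1) mu nu))%N //.
transitivity (\sum_w \sum_z' (Q c w * sel l z') *
   indicates (fun u => M c w u + mult M z' u) A * indicates (fun v => M' c w v + mult M' z' v) B)%N.
  under [LHS]eq_bigr => A1 _.
    under eq_bigr => B1 _.
      rewrite PhiE IH // big_distrl /=.
      under eq_bigr do rewrite big_distrr /=.
      over.
    rewrite exchange_big /=; under eq_bigr do rewrite exchange_big /=.
    over.
  rewrite [LHS]exchange_big /=; apply: eq_bigr => w _.
  rewrite [LHS]exchange_big /=; apply: eq_bigr => z' _.
  rewrite -!sum_indicates -mulnA big_distrlr big_distrr /=; apply: eq_bigr => A1 _.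
  rewrite big_distrr /=; apply: eq_bigr => B1 _; lia.
(* split the selection on c :: l into its value at c and its restriction to l *)
pose h (p : option K * {ffun C -> option K}) : {ffun C -> option K} :=
  [ffun d => if d == c then p.1 else p.2 d].
pose h' (z : {ffun C -> option K}) : option K * {ffun C -> option K} :=
  (z c, [ffun d => if d == c then None else z d]).
rewrite [RHS](reindex_onto h h') /= => [|z _]; last first.
  by apply/ffunP => d; rewrite !ffunE; case: eqP => // ->.
rewrite -(pair_big_dep xpredT (fun o z' => h' (h (o, z')) == (o, z'))
  (fun o z' => sel (c :: l) (h (o, z')) * indicates (mult M (h (o, z'))) A *
     indicates (mult M' (h (o, z'))) B))%N /=.
have N z' : sel (c :: l) (h (None, z')) = false.
  by apply/negP => /forallP/(_ c); rewrite ffunE eqxx inE eqxx.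
have selN z' : sel l z' -> z' c = None.
  by move=> /forallP/(_ c); case: (z' c) => // w; rewrite (negPf cl).
have hK o z' : (h' (h (o, z')) == (o, z')) = (z' c == None).
  rewrite /h' /h /= ffunE eqxx xpair_eqE eqxx /=; apply/eqP/eqP => [<-|e].
    by rewrite ffunE eqxx.
  by apply/ffunP => d; rewrite !ffunE; case: eqP => // ->.
have SOM (F : option K -> nat) : (\sum_o F o = F None + \sum_w F (Some w))%N.
  rewrite (bigD1 None) //=; congr addn.
  rewrite (reindex_omap Some id) /=; last by case.
  by apply: eq_bigl => w; rewrite eqxx.
rewrite SOM [X in (X + _)%N]big1 => [|z' _]; last by rewrite N !mul0n.
rewrite add0n.
apply: eq_bigr => w _; rewrite [RHS]big_mkcond /=; apply: eq_bigr => z' _; rewrite hK.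
case: eqP => [e|ne]; last first.
  by case: (boolP (sel l z')) => [/selN //|_]; rewrite muln0 !mul0n.
have -> : sel (c :: l) (h (Some w, z')) = Q c w && sel l z'.
  apply/forallP/andP => [H|[Qw /forallP H] d].
    split; first by have := H c; rewrite ffunE eqxx inE eqxx.
    apply/forallP => d; have := H d; rewrite ffunE inE; case: eqP => [-> _|//].
    by rewrite e.
  rewrite ffunE inE; have := H d; case: eqP => [->|] //=; by rewrite Qw.
rewrite -!mulnb mulnb; congr (_ * _ * _)%N.
  congr nat_of_bool; apply: eq_indicates => u; rewrite /mult [RHS](bigD1 c) //= ffunE eqxx.
  congr addn; rewrite (bigD1 c) //= e add0n; apply: eq_bigr => d /negPf nd.
  by rewrite ffunE nd.
congr nat_of_bool; apply: eq_indicates => u; rewrite /mult [RHS](bigD1 c) //= ffunE eqxx.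
congr addn; rewrite (bigD1 c) //= e add0n; apply: eq_bigr => d /negPf nd.
by rewrite ffunE nd.
Qed.

End ConvList.

Section OrbitSums.
Variables (I : finType) (tau : {perm I}) (st : {set I} -> I).
Hypothesis stP : forall c, c \in porbits tau -> st c \in c.

Lemma porbit_st c : c \in porbits tau -> porbit tau (st c) = c.
Proof.
move=> cp; have := stP cp; case/imsetP: cp => x _ ->.
by rewrite -eq_porbit_mem => /eqP.
Qed.

Lemma mem_traject_st c i : c \in porbits tau -> (i \in c) = (i \in traject tau (st c) #|c|).
Proof. by move=> cp; rewrite -[in LHS](porbit_st cp) porbit_traject porbit_st. Qed.

Lemma sum_porbits (F : I -> nat) :
  (\sum_i F i = \sum_(c in porbits tau) \sum_(j < #|c|) F (iter j tau (st c)))%N.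
Proof.
rewrite (partition_big (porbit tau) (mem (porbits tau))) /= => [|i _]; last exact: imset_f.
apply: eq_bigr => c cp.
transitivity (\sum_(i <- traject tau (st c) #|c|) F i)%N; last first.
  rewrite (big_nth (st c)) size_traject big_mkord; apply: eq_bigr => j _.
  by rewrite nth_traject.
rewrite -big_filter; apply: perm_big; apply: uniq_perm.
- by rewrite filter_uniq ?index_enum_uniq.
- by have := uniq_traject_porbit tau (st c); rewrite porbit_st.
move=> i; rewrite mem_filter mem_index_enum andbT -mem_traject_st //.
by rewrite -{1}(porbit_st cp) eq_porbit_mem porbit_st.
Qed.

End OrbitSums.

Section Tuples.
Variables (gT : finGroupType) (K : sspecies gT) (I : finType) (tau : {perm I}).
Variables (gam : I -> gT) (st : {set I} -> I).
Hypothesis stP : forall c, c \in porbits tau -> st c \in c.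

(** The supports of the W i have to be disjoint with union (A, B): each label of A or B is
used exactly once. *)
Definition tuple_count : fix_count := fun U V A B mu nu =>
  (\sum_(W : {ffun I -> K U V})
    [&& [forall i, ok (W i)], indicates (fun u => \sum_i (u \in bl (W i))) A,
        indicates (fun v => \sum_i (v \in wh (W i))) B
      & [forall i, W (tau i) == ac (rl mu nu (W i)) (gam i)]])%N.

Definition gprod (c : {set I}) : gT := (\prod_(j <- traject tau (st c) #|c|) gam j)%g.

Section Fixed.
Variables (U V : finType) (mu : {perm U}) (nu : {perm V}).

Definition cyc_ok (c : {set I}) (w : K U V) : bool :=
  ok w && (ac (rl (mu ^+ #|c|)%g (nu ^+ #|c|)%g w) (gprod c) == w).

Definition cyc_bl (c : {set I}) (w : K U V) (u : U) : nat :=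
  (\sum_(j < #|c|) (u \in [set (mu ^+ j)%g x | x in bl w]))%N.

Definition cyc_wh (c : {set I}) (w : K U V) (v : V) : nat :=
  (\sum_(j < #|c|) (v \in [set (nu ^+ j)%g x | x in wh w]))%N.

Lemma cyc_fixcE (c : {set I}) (A : {set U}) (B : {set V}) :
  cyc_count #|c| (fixc K (gprod c)) A B mu nu =
  (\sum_(w : K U V) (cyc_ok c w * indicates (cyc_bl c w) A * indicates (cyc_wh c w) B))%N.
Proof.
rewrite /cyc_count /fixc; under eq_bigr do rewrite exchange_big.
rewrite exchange_big; apply: eq_bigr => w _ /=.
rewrite big_mkcond (bigD1 (bl w)) //= [X in (_ + X)%N]big1 ?addn0 => [|P /negPf nP]; last first.
  case: ifP => // _; rewrite big1 // => Q _; rewrite [bl w == P]eq_sym nP.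
  by rewrite andbF.
case: (boolP (cycpart _ _ _ _)) => [|/negPf] cp.
  rewrite big_mkcond (bigD1 (wh w)) //= [X in (_ + X)%N]big1 ?addn0 => [|P /negPf nP]; last first.
    by case: ifP => // _; rewrite [wh w == P]eq_sym nP /= !andbF.
  rewrite !eqxx /= -[indicates (cyc_bl c w) A]/(cycpart #|c| mu (bl w) A) cp muln1.
  rewrite -[indicates (cyc_wh c w) B]/(cycpart #|c| nu (wh w) B) /cyc_ok.
  by case: (cycpart _ _ _ _); rewrite ?muln1 ?muln0.
by rewrite -[indicates (cyc_bl c w) A]/(cycpart #|c| mu (bl w) A) cp muln0.
Qed.

(** The value forced at the n-th iterate of tau on s by the value w at s. *)
Fixpoint actn (s : I) n (w : K U V) : K U V :=
  if n is n'.+1 then ac (rl mu nu (actn s n' w)) (gam (iter n' tau s)) else w.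

Lemma okn s n w : ok w -> ok (actn s n w).
Proof.
by move=> okw; elim: n => //= n IH; apply/ok_ac/ok_rl => //; apply: perm_inj.
Qed.

(** The action commutes with relabeling, so the twists met along the way can be collected
into one product, in the order of the traversal. *)
Lemma actnE s n w : ok w ->
  actn s n w = ac (rl (mu ^+ n)%g (nu ^+ n)%g w) (\prod_(j <- traject tau s n) gam j)%g.
Proof.
move=> okw; have okX m : ok (rl (mu ^+ m)%g (nu ^+ m)%g w).
  by apply: ok_rl => //; apply: perm_inj.
elim: n => [|n IH].
  rewrite big_nil ac1; last exact: okX.
  rewrite -[LHS]rl_id; apply: rl_congr => // x _; by rewrite expg0 perm1.
rewrite trajectSr -cats1 big_cat big_seq1 [LHS]/= IH rl_ac //; try exact: perm_inj.
rewrite -acM; last by apply: ok_rl => //; exact: perm_inj.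
congr (ac _ _).
by rewrite rl_comp; apply: rl_congr => // x _; rewrite /= expgSr permM.
Qed.

Lemma bl_actn s n w : ok w -> bl (actn s n w) = [set (mu ^+ n)%g x | x in bl w].
Proof.
move=> okw; rewrite actnE // bl_ac ?bl_rl //.
by apply: ok_rl => //; apply: perm_inj.
Qed.

Lemma wh_actn s n w : ok w -> wh (actn s n w) = [set (nu ^+ n)%g x | x in wh w].
Proof.
move=> okw; rewrite actnE // wh_ac ?wh_rl //.
by apply: ok_rl => //; apply: perm_inj.
Qed.

(** A family is determined by its values at the chosen starting points of the cycles of
tau, by propagation along each cycle; a value w at the starting point of c is
admissible exactly when going once around c brings it back to w. The supports along c
are then the translates of that of w. *)
Lemma tuple_countE (A : {set U}) (B : {set V}) : tuple_count A B mu nu =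
  foldr (fun c : {set I} => conv (cyc_count #|c| (fixc K (gprod c)))) unit_count
    (enum (porbits tau)) U V A B mu nu.
Proof.
rewrite (conv_list (Phi := fun c : {set I} => cyc_count #|c| (fixc K (gprod c)))
   (Q := cyc_ok) (M := cyc_bl) (M' := cyc_wh)); last exact: enum_uniq.
  2: by move=> c A' B'; rewrite cyc_fixcE.
pose SW := [set W : {ffun I -> K U V} |
   [&& [forall i, ok (W i)], indicates (fun u => \sum_i (u \in bl (W i)))%N A,
        indicates (fun v => \sum_i (v \in wh (W i)))%N B
      & [forall i, W (tau i) == ac (rl mu nu (W i)) (gam i)]]].
pose SZ := [set z : {ffun {set I} -> option (K U V)} |
   [&& sel cyc_ok (enum (porbits tau)) z, indicates (mult cyc_bl z) A & indicates (mult cyc_wh z) B]].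
transitivity #|SW|; first by rewrite /SW -sum1dep_card [RHS]big_mkcond.
transitivity #|SZ|; last first.
  rewrite /SZ -sum1dep_card [LHS]big_mkcond; apply: eq_bigr => z _ /=.
  by case: (sel _ _ _); case: (indicates _ _); case: (indicates _ _).
(* restriction to the starting points *)
pose h (W : {ffun I -> K U V}) : {ffun {set I} -> option (K U V)} :=
  [ffun c => if c \in porbits tau then Some (W (st c)) else None].
have iterW (W : {ffun I -> K U V}) : [forall i, W (tau i) == ac (rl mu nu (W i)) (gam i)] ->
    forall s n, W (iter n tau s) = actn s n (W s).
  by move=> /forallP hW s; elim=> //= n IH; rewrite (eqP (hW _)) IH.
have idx i : exists2 j, (j < #|porbit tau i|)%N & i = iter j tau (st (porbit tau i)).
  have cp : porbit tau i \in porbits tau by apply: imset_f.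
  have := porbit_id tau i; rewrite {1}(mem_traject_st stP i cp).
  by case/trajectP => j jl e; exists j.
have mE (T : finType) (W : {ffun I -> K U V}) (F : K U V -> {set T}) (N : {set I} -> K U V -> T -> nat) u :
    (forall c, c \in porbits tau -> \sum_(j < #|c|) (u \in F (W (iter j tau (st c)))) = N c (W (st c)) u)%N ->
    (mult N (h W) u = \sum_i (u \in F (W i)))%N.
  move=> hN; rewrite (sum_porbits stP) /mult [RHS]big_mkcond /=; apply: eq_bigr => c _.
  by rewrite ffunE; case: ifP => // cp; rewrite hN.
have mb (W : {ffun I -> K U V}) : [forall i, ok (W i)] ->
    [forall i, W (tau i) == ac (rl mu nu (W i)) (gam i)] ->
    (forall u, mult cyc_bl (h W) u = \sum_i (u \in bl (W i)))%N /\
    (forall u, mult cyc_wh (h W) u = \sum_i (u \in wh (W i)))%N.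
  move=> /forallP okW eW; split=> u.
    apply: (mE U W (@bl gT K U V)) => c cp; apply: eq_bigr => j _.
    by rewrite iterW // bl_actn.
  apply: (mE V W (@wh gT K U V)) => c cp; apply: eq_bigr => j _.
  by rewrite iterW // wh_actn.
have hinj : {in SW &, injective h}.
  move=> W W'; rewrite !inE => /and4P[_ _ _ eW] /and4P[_ _ _ eW'] e.
  apply/ffunP => i; have [j _ ->] := idx i; rewrite !iterW //.
  have := congr1 (fun f : {ffun {set I} -> option (K U V)} => f (porbit tau i)) e.
  by rewrite !ffunE imset_f // => -[->].
rewrite -(card_in_imset hinj); apply: eq_card => z; apply/imsetP/idP => [[W]|].
  rewrite !inE => /and4P[okW bW wW eW] ->; have [eb ew] := mb W okW eW.
  rewrite (eq_indicates _ eb) (eq_indicates _ ew) bW wW !andbT.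
  apply/forallP => c; rewrite ffunE mem_enum; case: ifP => // cp /=.
  rewrite /cyc_ok (forallP okW) /= -actnE ?(forallP okW) // -iterW //.
  by rewrite -{1}(porbit_st stP cp) iter_porbit.
rewrite inE => /and3P[/forallP sz bz wz].
have /choice[w wP] : forall i, exists w, z (porbit tau i) = Some w.
  move=> i; have := sz (porbit tau i); rewrite mem_enum imset_f //.
  by case: (z _) => // w _; exists w.
have wok i : cyc_ok (porbit tau i) (w i).
  by have := sz (porbit tau i); rewrite wP mem_enum => /andP[].
have /choice[jx jxP] : forall i, exists j, (j < #|porbit tau i|)%N /\
     i = iter j tau (st (porbit tau i)).
  by move=> i; have [j h1 h2] := idx i; exists j.
(* i is reached from the starting point of its cycle in jx i steps *)
pose W : {ffun I -> K U V} := [ffun i => actn (st (porbit tau i)) (jx i) (w i)].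
have por i : porbit tau (tau i) = porbit tau i.
  by have := porbit_perm tau 1 i; rewrite expg1.
have wE i j : porbit tau i = porbit tau j -> w i = w j.
  by move=> e; have := wP i; rewrite e wP => -[].
have okW : [forall i, ok (W i)].
  by apply/forallP => i; rewrite ffunE; apply: okn; have /andP[] := wok i.
have jxS i n : (n < #|porbit tau i|)%N -> i = iter n tau (st (porbit tau i)) -> jx i = n.
  move=> ln e; have [lj ej] := jxP i; have cp : porbit tau i \in porbits tau by apply: imset_f.
  have := uniq_traject_porbit tau (st (porbit tau i)); rewrite (porbit_st stP cp) => un.
  apply/eqP; rewrite -(nth_uniq (st (porbit tau i)) _ _ un) ?size_traject //.
  by rewrite !nth_traject // -ej -e.
have eW : [forall i, W (tau i) == ac (rl mu nu (W i)) (gam i)].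
  apply/forallP => i; apply/eqP; rewrite !ffunE por (wE _ _ (por i)).
  have [lj ej] := jxP i.
  have -> : ac (rl mu nu (actn (st (porbit tau i)) (jx i) (w i))) (gam i) =
            actn (st (porbit tau i)) (jx i).+1 (w i) by rewrite /= -ej.
  have [ltj|] := ltnP (jx i).+1 #|porbit tau i|.
    by rewrite (jxS (tau i) (jx i).+1) ?por // iterS -ej.
  rewrite leq_eqVlt ltnS leqNgt lj orbF => /eqP ec.
  have cp : porbit tau i \in porbits tau by apply: imset_f.
  have es : tau i = st (porbit tau i).
    have := iter_porbit tau (st (porbit tau i)); rewrite (porbit_st stP cp) ec iterS -ej.
    by [].
  rewrite (jxS (tau i) 0%N) ?por //; last by rewrite lt0n card_porbit_neq0.
  have /andP[okw /eqP ew] := wok i.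
  by rewrite [RHS]actnE // -ec; apply: esym.
have Wst c : c \in porbits tau -> z c = Some (W (st c)).
  move=> cp; rewrite -{1}(porbit_st stP cp) wP; congr Some; rewrite ffunE.
  have -> // : jx (st c) = 0%N.
  by apply: jxS; rewrite /= ?(porbit_st stP cp) // (porbits_gt0 cp).
have hW : z = h W.
  apply/ffunP => c; rewrite ffunE; case: ifP => [/Wst //|nc].
  by have := sz c; case: (z c) => // w'; rewrite mem_enum nc.
exists W => //; rewrite inE okW eW andbT /=; have [eb ew] := mb W okW eW.
by rewrite -(eq_indicates _ eb) -(eq_indicates _ ew) -hW bz wz.
Qed.

End Fixed.

Lemma foldr_conv (l : seq {set I}) : {subset l <= porbits tau} ->
  let F := foldr (fun c : {set I} => conv (cyc_count #|c| (fixc K (gprod c)))) unit_count l in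
  [/\ natural F, stable F &
      cycle_series F = (\prod_(c <- l) dilate #|c| (cycle_series (fixc K (gprod c))))%R].
Proof.
elim: l => [|c l IH] lp /=.
  by split; [exact: natural_unit | exact: stable_unit | rewrite big_nil cycle_series_unit].
have c0 : (0 < #|c|)%N by apply: (@porbits_gt0 _ tau); apply: lp; rewrite inE eqxx.
have [|nF sF zF] := IH; first by move=> d dl; apply: lp; rewrite inE dl orbT.
have n1 := natural_cyc_count c0 (@natural_fixc gT K (gprod c)).
have s1 := stable_cyc_count c0 (@stable_fixc gT K (gprod c)).
split; [exact: natural_conv | exact: stable_conv|].
by rewrite cycle_series_conv // zF big_cons cycle_series_cyc_count //; apply: natural_fixc.
Qed.

Lemma natural_tuple_count : natural tuple_count.
Proof.
have [|nF _ _] := @foldr_conv (enum (porbits tau)); first by move=> c; rewrite mem_enum.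
by move=> U U' V V' f g A B mu mu' nu nu' *; rewrite !tuple_countE; apply: nF.
Qed.

Lemma stable_tuple_count : stable tuple_count.
Proof.
have [|_ sF _] := @foldr_conv (enum (porbits tau)); first by move=> c; rewrite mem_enum.
by move=> U V A B mu nu; rewrite tuple_countE; apply: sF.
Qed.

Lemma cycle_series_tuple_count : cycle_series tuple_count =
  (\prod_(c in porbits tau) dilate #|c| (cycle_series (fixc K (gprod c))))%R.
Proof.
have [|_ _ zF] := @foldr_conv (enum (porbits tau)); first by move=> c; rewrite mem_enum.
rewrite -big_enum -zF; apply: cycle_series_ext => U V mu nu; exact: tuple_countE.
Qed.

End Tuples.

(** * Trees with linearly ordered children at each black vertex *)

Section LinearTrees.
Variable k : nat.

(** A node (b, (p, c)) is a black vertex b with its parent p and the sequence c of its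
children. *)
Definition lnode (U V : finType) : finType := (U * (V * {ffun 'I_k -> V}))%type.
Definition ltree (U V : finType) : finType := (V * {set lnode U V})%type.

Section Fixed.
Variables U V : finType.
Implicit Types (t : ltree U V) (L : {set lnode U V}).

(** The black vertex b is a descendant of the white vertex w. *)
Inductive under L (w : V) : U -> Prop :=
| under0 b c : (b, (w, c)) \in L -> under L w b
| underS b (c : {ffun 'I_k -> V}) b' p' (c' : {ffun 'I_k -> V}) i :
    (b, (c' i, c)) \in L -> (b', (p', c')) \in L ->
    under L w b' -> under L w b.

(** A tree is given by its nodes: a black vertex has one node, a white vertex is a child at
one place only and the root at none, and every black vertex is a descendant of the
root. The last condition rules out components consisting of a cycle. *)
Definition lvalid t : Prop :=
  [/\ forall b q q', (b, q) \in t.2 -> (b, q') \in t.2 -> q = q',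
      forall b p (c : {ffun 'I_k -> V}) i b' p' (c' : {ffun 'I_k -> V}) j,
        (b, (p, c)) \in t.2 -> (b', (p', c')) \in t.2 ->
        c i = c' j -> b = b' /\ i = j,
      forall b p (c : {ffun 'I_k -> V}) i, (b, (p, c)) \in t.2 -> c i <> t.1
    & forall b q, (b, q) \in t.2 -> under t.2 t.1 b].

Definition lblacks t : {set U} := [set n.1 | n : lnode U V in t.2].
Definition lwhites t : {set V} :=
  [set v | (v == t.1) || [exists n, (n \in t.2) && (v \in codom n.2.2)]].

Lemma lblacksP t b : reflect (exists q, (b, q) \in t.2) (b \in lblacks t).
Proof.
apply: (iffP imsetP) => [[[b' q] h ->]|[q h]]; first by exists q.
by exists (b, q).
Qed.

Lemma lwhitesP t v :
  reflect (v = t.1 \/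
           exists b p (c : {ffun 'I_k -> V}) i, (b, (p, c)) \in t.2 /\ v = c i) (v \in lwhites t).
Proof.
rewrite inE; apply: (iffP orP) => [[/eqP ->|/existsP[[b [p c]] /andP[h /codomP[i ->]]]]|].
- by left.
- by right; exists b, p, c, i.
case=> [->|[b [p [c [i [h ->]]]]]]; first by left.
by right; apply/existsP; exists (b, (p, c)); rewrite h codom_f.
Qed.

Definition permc (tau : 'S_k) (c : {ffun 'I_k -> V}) : {ffun 'I_k -> V} :=
  [ffun j => c ((tau^-1)%g j)].

Lemma permcE tau c i : permc tau c (tau i) = c i.
Proof. by rewrite ffunE permK. Qed.

(** Going down from the root, sigma is replaced by its image under rho_i whenever one
passes to the i-th child of a black vertex: tau is the permutation that reorders the
children of b when sigma acts on t. This unfolds the recursive description of the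
action. *)
Inductive ltwist t (sigma : 'S_k) : U -> 'S_k -> Prop :=
| ltwist0 b c : (b, (t.1, c)) \in t.2 -> ltwist t sigma b sigma
| ltwistS b (c : {ffun 'I_k -> V}) b' p' (c' : {ffun 'I_k -> V}) i tau :
    (b, (c' i, c)) \in t.2 -> (b', (p', c')) \in t.2 ->
    ltwist t sigma b' tau -> ltwist t sigma b (rho (lift ord0 i) tau).

Definition lact t (sigma : 'S_k) : ltree U V :=
  (t.1, [set n | `[< exists c tau, [/\ (n.1, (n.2.1, c)) \in t.2,
                   ltwist t sigma n.1 tau & n.2.2 = permc tau c] >]]).

Lemma lactP t sigma b p c' : (b, (p, c')) \in (lact t sigma).2 <->
  exists c tau, [/\ (b, (p, c)) \in t.2, ltwist t sigma b tau & c' = permc tau c].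
Proof. by rewrite inE; split=> [/asboolP//|h]; apply/asboolP. Qed.

Section Valid.
Variable t : ltree U V.
Hypothesis tv : lvalid t.

Lemma lfun b q q' : (b, q) \in t.2 -> (b, q') \in t.2 -> q = q'.
Proof. by case: tv => h _ _ _; apply: h. Qed.

Lemma lchild b p (c : {ffun 'I_k -> V}) i b' p' (c' : {ffun 'I_k -> V}) j :
  (b, (p, c)) \in t.2 -> (b', (p', c')) \in t.2 ->
  c i = c' j -> b = b' /\ i = j.
Proof. by case: tv => _ h _ _; apply: h. Qed.

Lemma lroot b p (c : {ffun 'I_k -> V}) i : (b, (p, c)) \in t.2 -> c i <> t.1.
Proof. by case: tv => _ _ h _; apply: h. Qed.

Lemma lunder b q : (b, q) \in t.2 -> under t.2 t.1 b.
Proof. by case: tv => _ _ _; apply. Qed.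

Lemma lparent b p c : (b, (p, c)) \in t.2 -> p \in lwhites t.
Proof.
move=> h; apply/lwhitesP; have hu := lunder h; case: hu h => [{}b c0 h0|{}b c0 b' p' c' i h0 h' _] h.
  by left; case: (lfun h h0).
by right; exists b', p', c', i; case: (lfun h h0).
Qed.

Lemma ltwist_uniq sigma b tau tau' :
  ltwist t sigma b tau -> ltwist t sigma b tau' -> tau = tau'.
Proof.
move=> h; elim: h tau' => {b tau} [b c h|b c b' p' c' i tau h h' hb IH] tau' h2.
  case: h2 h => // {}b c1 b' p' c' i tau h1 h' _ h.
  by case: (lfun h1 h) => e _; case: (lroot h' e).
case: h2 h => [{}b c1 h1|{}b c1 b1 p1 c1' j tau1 h1 h1' hb1] h.
  by case: (lfun h h1) => e _; case: (lroot h' e).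
case: (lfun h h1) => e _; have [eb ->] := lchild h' h1' e.
by rewrite (IH tau1) // eb.
Qed.

Lemma ltwist_ex sigma b q : (b, q) \in t.2 -> exists tau, ltwist t sigma b tau.
Proof.
move/lunder; elim=> {b q} [b c h|b c b' p' c' i h h' _ [tau IH]].
  by exists sigma; apply: ltwist0 h.
by exists (rho (lift ord0 i) tau); apply: ltwistS h h' IH.
Qed.

Variable sigma : 'S_k.
Let t' := lact t sigma.

Lemma lact_mem b p c tau : (b, (p, c)) \in t.2 -> ltwist t sigma b tau ->
  (b, (p, permc tau c)) \in t'.2.
Proof. by move=> h ht; apply/lactP; exists c, tau. Qed.

Lemma under_lact w b : under t.2 w b -> under t'.2 w b.
Proof.
elim=> {b} [b c h|b c b' p' c' i h h' _ IH].
  by have [tau ht] := ltwist_ex sigma h; apply: under0 (lact_mem h ht).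
have [tau ht] := ltwist_ex sigma h; have [tau' ht'] := ltwist_ex sigma h'.
apply: (@underS _ _ _ (permc tau c) _ p' (permc tau' c') (tau' i)) IH.
  by rewrite permcE; apply: lact_mem.
exact: lact_mem.
Qed.

Lemma lblacks_act : lblacks t' = lblacks t.
Proof.
apply/setP => b; apply/lblacksP/lblacksP => [[[p c']] /lactP[c [tau [h _ _]]]|[[p c] h]].
  by exists (p, c).
by have [tau ht] := ltwist_ex sigma h; exists (p, permc tau c); apply: lact_mem.
Qed.

Lemma lwhites_act : lwhites t' = lwhites t.
Proof.
apply/setP => v; apply/lwhitesP/lwhitesP => -[->|[b [p [c [i [h ->]]]]]]; try by left.
  by case/lactP: h => c0 [tau [h _ ->]]; right; exists b, p, c0, ((tau^-1)%g i); rewrite ffunE.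
have [tau ht] := ltwist_ex sigma h; right; exists b, p, (permc tau c), (tau i).
by rewrite permcE; split=> //; apply: lact_mem.
Qed.

Lemma lvalid_act : lvalid t'.
Proof.
split.
- move=> b [p c] [p' c'] /lactP[c1 [tau [h ht ->]]] /lactP[c1' [tau' [h' ht' ->]]].
  by case: (lfun h h') => -> ->; rewrite (ltwist_uniq ht ht').
- move=> b p c i b' p' c' j /lactP[c1 [tau [h ht ->]]] /lactP[c1' [tau' [h' ht' ->]]].
  rewrite !ffunE => /(lchild h h')[eb eij]; split=> //.
  by move: ht'; rewrite -eb => /(ltwist_uniq ht) e; move: eij; rewrite -e => /perm_inj.
- move=> b p c i /lactP[c1 [tau [h ht ->]]]; rewrite ffunE; exact: (lroot h).
move=> b [p c] /lactP[c1 [tau [h _ _]]]; apply: under_lact; exact: (lunder h).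
Qed.

(** This is where rho_i(sigma sigma') = rho_i(sigma) rho_(sigma(i))(sigma') enters: sigma
has moved the i-th child to position sigma(i) before sigma' acts. *)
Lemma ltwist_act sigma' b tau : ltwist t sigma b tau ->
  exists2 tau', ltwist t' sigma' b tau' & ltwist t (sigma * sigma')%g b (tau * tau')%g.
Proof.
elim=> {b tau} [b c h|b c b' p' c' i tau h h' hb [tau' h1 h2]].
  exists sigma'; last exact: ltwist0 h.
  by apply: (@ltwist0 _ _ _ (permc sigma c)); apply: lact_mem => //; apply: ltwist0 h.
exists (rho (lift ord0 (tau i)) tau').
  have ht := ltwistS h h' hb.
  apply: (@ltwistS _ _ _ (permc (rho (lift ord0 i) tau) c) b' p' (permc tau c')) h1.
    by rewrite permcE; apply: lact_mem.
  exact: lact_mem.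
by rewrite -emb_lift -rhoM; apply: ltwistS h h' h2.
Qed.

End Valid.

Lemma permc1 c : permc 1%g c = c.
Proof. by apply/ffunP => i; rewrite ffunE invg1 perm1. Qed.

Lemma permcM tau tau' c : permc tau' (permc tau c) = permc (tau * tau')%g c.
Proof. by apply/ffunP => i; rewrite !ffunE invMg permM. Qed.

Lemma lact1 t : lvalid t -> lact t 1%g = t.
Proof.
move=> tv; have tw1 b tau : ltwist t 1%g b tau -> tau = 1%g.
  by elim=> // {b tau} b c b' p' c' i tau _ _ _ ->; rewrite rho1.
rewrite /lact [RHS]surjective_pairing; congr pair; apply/setP => -[b [p c]].
apply/idP/idP => [/lactP[c1 [tau [h /tw1 -> ->]]]|h]; first by rewrite permc1.
apply/lactP; have [tau ht] := ltwist_ex tv 1%g h.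
by exists c, 1%g; rewrite permc1 -{2}(tw1 _ _ ht).
Qed.

Lemma lactM t sigma sigma' : lvalid t ->
  lact t (sigma * sigma')%g = lact (lact t sigma) sigma'.
Proof.
move=> tv; have t'v := lvalid_act tv sigma.
rewrite [LHS]surjective_pairing [RHS]surjective_pairing; congr pair.
apply/setP => -[b [p c]]; apply/idP/idP => /lactP[c1 [tau [h ht ->]]].
  have [tau1 h1] := ltwist_ex tv sigma h.
  have [tau2 h2 h12] := ltwist_act sigma' h1.
  apply/lactP; exists (permc tau1 c1), tau2; rewrite permcM (ltwist_uniq tv ht h12).
  by split=> //; apply: lact_mem.
case/lactP: h => c0 [tau1 [h h1 ->]].
have [tau2 h2 h12] := ltwist_act sigma' h1.
by apply/lactP; exists c0, (tau1 * tau2)%g; rewrite permcM (ltwist_uniq t'v ht h2).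
Qed.

End Fixed.

Definition lrel (U U' V V' : finType) (f : U -> U') (g : V -> V') (t : ltree U V) :
    ltree U' V' :=
  (g t.1, [set (f n.1, (g n.2.1, [ffun i => g (n.2.2 i)])) | n : lnode U V in t.2]).

Lemma lrelP (U U' V V' : finType) (f : U -> U') (g : V -> V') (t : ltree U V) b p c :
  (b, (p, c)) \in (lrel f g t).2 <->
  exists b0 p0 (c0 : {ffun 'I_k -> V}),
    [/\ (b0, (p0, c0)) \in t.2, b = f b0, p = g p0 & c = [ffun i => g (c0 i)]].
Proof.
split=> [/imsetP[[b0 [p0 c0]] h [-> -> ->]]|[b0 [p0 [c0 [h -> -> ->]]]]].
  by exists b0, p0, c0.
by apply/imsetP; exists (b0, (p0, c0)).
Qed.

Lemma lrel_mem (U U' V V' : finType) (f : U -> U') (g : V -> V') (t : ltree U V)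
    b p (c : {ffun 'I_k -> V}) :
  (b, (p, c)) \in t.2 -> (f b, (g p, [ffun i => g (c i)])) \in (lrel f g t).2.
Proof. by move=> h; apply/lrelP; exists b, p, c. Qed.

Lemma lblacks_rel (U U' V V' : finType) (f : U -> U') (g : V -> V') (t : ltree U V) :
  lblacks (lrel f g t) = f @: lblacks t.
Proof. by rewrite /lblacks -!imset_comp. Qed.

Lemma lwhites_rel (U U' V V' : finType) (f : U -> U') (g : V -> V') (t : ltree U V) :
  lwhites (lrel f g t) = g @: lwhites t.
Proof.
apply/setP => v; apply/lwhitesP/imsetP.
  case=> [->|[b [p [c [i [/lrelP[b0 [p0 [c0 [h _ _ ->]]]] ->]]]]]].
    by exists t.1 => //; apply/lwhitesP; left.
  by exists (c0 i); rewrite ?ffunE //; apply/lwhitesP; right; exists b0, p0, c0, i.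
case=> w /lwhitesP[-> ->|[b [p [c [i [h ->]]]]] ->]; first by left.
by right; exists (f b), (g p), [ffun i => g (c i)], i; rewrite ffunE; split=> //; apply: lrel_mem.
Qed.

Lemma lrel_id (U V : finType) (t : ltree U V) : lrel id id t = t.
Proof.
rewrite /lrel [RHS]surjective_pairing; congr pair; rewrite -[RHS]imset_id.
apply: eq_imset => -[b [p c]] /=; congr (_, (_, _)); by apply/ffunP => i; rewrite ffunE.
Qed.

Lemma lrel_comp (U U' U'' V V' V'' : finType) (f : U -> U') (g : V -> V')
    (f' : U' -> U'') (g' : V' -> V'') (t : ltree U V) :
  lrel f' g' (lrel f g t) = lrel (f' \o f) (g' \o g) t.
Proof.
rewrite /lrel /=; congr pair; rewrite -imset_comp; apply: eq_imset => n /=.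
by congr (_, (_, _)); apply/ffunP => i; rewrite !ffunE.
Qed.

Lemma lrel_congr (U U' V V' : finType) (f f' : U -> U') (g g' : V -> V') (t : ltree U V) :
  lvalid t -> {in lblacks t, f =1 f'} -> {in lwhites t, g =1 g'} ->
  lrel f g t = lrel f' g' t.
Proof.
move=> tv hf hg; rewrite /lrel; congr pair; first by apply: hg; apply/lwhitesP; left.
apply: eq_in_imset => -[b [p c]] h /=; congr (_, (_, _)).
- by apply: hf; apply/lblacksP; exists (p, c).
- exact/hg/(lparent tv h).
by apply/ffunP => i; rewrite !ffunE; apply: hg; apply/lwhitesP; right; exists b, p, c, i.
Qed.

Section Injective.
Variables (U U' V V' : finType) (f : U -> U') (g : V -> V').
Hypotheses (fi : injective f) (gi : injective g).
Implicit Types t : ltree U V.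

Lemma ffun_g_inj (c c' : {ffun 'I_k -> V}) :
  [ffun i => g (c i)] = [ffun i => g (c' i)] -> c = c'.
Proof.
by move=> e; apply/ffunP => i; apply: gi; have /ffunP/(_ i) := e; rewrite !ffunE.
Qed.

Lemma lrel_memE t b p (c : {ffun 'I_k -> V}) :
  ((f b, (g p, [ffun i => g (c i)])) \in (lrel f g t).2) = ((b, (p, c)) \in t.2).
Proof.
apply/idP/idP => [/lrelP[b0 [p0 [c0 [h /fi -> /gi -> /ffun_g_inj ->]]]] //|].
exact: lrel_mem.
Qed.

Lemma lrel_inj : injective (@lrel U U' V V' f g).
Proof.
move=> t t' e; rewrite [t]surjective_pairing [t']surjective_pairing; congr pair.
  by apply: gi; rewrite -[LHS]/(lrel f g t).1 e.
by apply/setP => -[b [p c]]; rewrite -!lrel_memE e.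
Qed.

Lemma under_rel t w b : under t.2 w b -> under (lrel f g t).2 (g w) (f b).
Proof.
elim=> {b} [b c h|b c b' p' c' i h h' _ IH]; first exact: under0 (lrel_mem f g h).
apply: (@underS _ _ _ _ _ [ffun i => g (c i)] (f b') (g p') [ffun i => g (c' i)] i) IH.
  by rewrite ffunE; apply: lrel_mem h.
exact: lrel_mem h'.
Qed.

Lemma under_relV t w u : under (lrel f g t).2 (g w) u -> exists2 b, u = f b & under t.2 w b.
Proof.
elim=> {u} [b c /lrelP[b0 [p0 [c0 [h -> /gi -> _]]]]|b c b' p' c' i h1 h2 _ [b1 eb IH]].
  by exists b0 => //; apply: under0 h.
case/lrelP: h1 => b0 [p0 [c0 [h -> ep _]]]; exists b0 => //.
case/lrelP: h2 => b0' [p0' [c0' [h' + _ ec]]]; rewrite eb => /fi e.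
move: ep; rewrite ec ffunE => /gi ep.
by apply: (@underS _ _ _ _ _ c0 b0' p0' c0' i) => //; rewrite -?e // ep.
Qed.

Lemma lvalid_rel t : lvalid (lrel f g t) <-> lvalid t.
Proof.
split=> tv; split.
- move=> b [p c] [p' c'] h h'.
  by case: (lfun tv (lrel_mem f g h) (lrel_mem f g h')) => /gi -> /ffun_g_inj ->.
- move=> b p c i b' p' c' j h h' e.
  have [|/fi] := lchild tv (lrel_mem f g h) (lrel_mem f g h') (i := i) (j := j) _; last by [].
  by rewrite !ffunE e.
- move=> b p c i h e; apply: (lroot tv (lrel_mem f g h) (i := i)).
  by rewrite ffunE e.
- move=> b [p c] h; have := lunder tv (lrel_mem f g h).
  by case/under_relV => b' /fi ->.
- move=> b [p c] [p' c'] /lrelP[b0 [p0 [c0 [h -> -> ->]]]].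
  by case/lrelP => b1 [p1 [c1 [h' /fi e -> ->]]]; move: h'; rewrite -e => /(lfun tv h)[-> ->].
- move=> b p c i b' p' c' j /lrelP[b0 [p0 [c0 [h -> _ ->]]]].
  case/lrelP => b1 [p1 [c1 [h' -> _ ->]]]; rewrite !ffunE => /gi e.
  by have [-> ->] := lchild tv h h' e.
- move=> b p c i /lrelP[b0 [p0 [c0 [h _ _ ->]]]]; rewrite ffunE => /gi.
  exact: (lroot tv h).
by move=> b [p c] /lrelP[b0 [p0 [c0 [h -> _ _]]]]; apply: under_rel; apply: (lunder tv h).
Qed.

Lemma ltwist_rel t sigma b tau : ltwist t sigma b tau -> ltwist (lrel f g t) sigma (f b) tau.
Proof.
elim=> {b tau} [b c h|b c b' p' c' i tau h h' _ IH]; first exact: ltwist0 (lrel_mem f g h).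
apply: (@ltwistS _ _ _ _ _ [ffun i => g (c i)] (f b') (g p') [ffun i => g (c' i)] i) IH.
  by rewrite ffunE; apply: lrel_mem h.
exact: lrel_mem h'.
Qed.

Lemma lrel_act t sigma : lvalid t -> lrel f g (lact t sigma) = lact (lrel f g t) sigma.
Proof.
move=> tv; have tv' : lvalid (lrel f g t) by apply/lvalid_rel.
have G tau (c : {ffun 'I_k -> V}) :
    [ffun i => g (permc tau c i)] = permc tau [ffun i => g (c i)].
  by apply/ffunP => i; rewrite !ffunE.
rewrite [LHS]surjective_pairing [RHS]surjective_pairing; congr pair.
apply/setP => -[b [p c]]; apply/idP/idP.
  case/lrelP => b0 [p0 [c0 [/lactP[c1 [tau [h ht ->]]] -> -> ->]]].
  by rewrite G; apply: lact_mem (lrel_mem f g h) _ => //; apply: ltwist_rel.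
case/lactP => c1 [tau [/lrelP[b0 [p0 [c0 [h eb -> ->]]]] ht ->]].
have [tau0 ht0] := ltwist_ex tv sigma h.
rewrite -G; apply/lrelP; exists b0, p0, (permc tau0 c0); split=> //; first exact: lact_mem.
by rewrite eb in ht; rewrite (ltwist_uniq tv' ht (ltwist_rel ht0)).
Qed.

Lemma lrel_surj (t' : ltree U' V') : lvalid t' ->
  lblacks t' \subset f @: setT -> lwhites t' \subset g @: setT ->
  exists2 t, lvalid t & lrel f g t = t'.
Proof.
move=> tv /subsetP bs /subsetP ws.
have gw v : v \in lwhites t' -> exists w, v = g w by move/ws/imsetP => [w _ ->]; exists w.
have [r0 er] : exists w, t'.1 = g w by apply: gw; apply/lwhitesP; left.
pose t : ltree U V := (r0, [set n : lnode U V |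
   (f n.1, (g n.2.1, [ffun i => g (n.2.2 i)])) \in t'.2]).
have e : lrel f g t = t'.
  rewrite [RHS]surjective_pairing /lrel /= -er; congr pair; apply/setP => -[b [p c]].
  apply/imsetP/idP => [[n]|h]; first by rewrite inE => h ->.
  have [b0 eb] : exists b0, b = f b0.
    have /bs/imsetP[b0 _ ->] : b \in lblacks t' by apply/lblacksP; exists (p, c).
    by exists b0.
  have [p0 ep] := gw _ (lparent tv h).
  have /choice[c0 ec] : forall i, exists w, c i = g w.
    by move=> i; apply: gw; apply/lwhitesP; right; exists b, p, c, i.
  have ec' : c = [ffun i => g ([ffun i => c0 i] i)] by apply/ffunP => i; rewrite !ffunE ec.
  exists (b0, (p0, [ffun i => c0 i])); rewrite ?inE /= -?ec' -?ep -?eb //.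
by exists t => //; apply/lvalid_rel; rewrite e.
Qed.

End Injective.

Definition LT : sspecies 'S_k := @SSpecies 'S_k ltree
  (fun U V t => `[< lvalid t >]) lblacks lwhites lrel lact
  (fun U U' V V' f g t fi gi tv => introT (asboolP _) ((lvalid_rel fi gi t).2 (elimT (asboolP _) tv)))
  (fun U U' V V' f g t => lblacks_rel f g t)
  (fun U U' V V' f g t => lwhites_rel f g t)
  (fun U V t => lrel_id t)
  (fun U U' U'' V V' V'' f g f' g' t => lrel_comp f g f' g' t)
  (fun U U' V V' f f' g g' t tv => lrel_congr (elimT (asboolP _) tv))
  (fun U U' V V' f g fi gi => lrel_inj fi gi)
  (fun U U' V V' f g t fi gi tv hb hw =>
     let: ex_intro2 t0 v e := lrel_surj fi gi (elimT (asboolP _) tv) hb hw in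
     ex_intro2 _ _ t0 (introT (asboolP _) v) e)
  (fun U V t c tv => introT (asboolP _) (lvalid_act (elimT (asboolP _) tv) c))
  (fun U V t c tv => lblacks_act (elimT (asboolP _) tv) c)
  (fun U V t c tv => lwhites_act (elimT (asboolP _) tv) c)
  (fun U V t tv => lact1 (elimT (asboolP _) tv))
  (fun U V t c d tv => lactM c d (elimT (asboolP _) tv))
  (fun U U' V V' f g t c fi gi tv => lrel_act fi gi c (elimT (asboolP _) tv)).

End LinearTrees.

(** * Singletons *)

Definition x_count : fix_count := fun U V A B mu nu =>
  [&& #|A| == 1, B == set0 & mu @: A == A]%N.
Definition y_count : fix_count := fun U V A B mu nu =>
  [&& A == set0, #|B| == 1 & nu @: B == B]%N.

Lemma natural_x : natural x_count.
Proof.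
move=> U U' V V' f g A B mu mu' nu nu' fi gi muA nuB hf hg.
by rewrite /x_count (imset_eqI fi hf) card_imset // imset_eq0.
Qed.

Lemma natural_y : natural y_count.
Proof.
move=> U U' V V' f g A B mu mu' nu nu' fi gi muA nuB hf hg.
by rewrite /y_count (imset_eqI gi hg) card_imset // imset_eq0.
Qed.

Lemma stable_x : stable x_count.
Proof.
move=> U V A B mu nu; rewrite /x_count eqb0 negbK => /and3P[_ /eqP -> /eqP ->].
by rewrite imset0.
Qed.

Lemma stable_y : stable y_count.
Proof.
move=> U V A B mu nu; rewrite /y_count eqb0 negbK => /and3P[/eqP -> _ /eqP ->].
by rewrite imset0.
Qed.

Lemma conv_x (Phi : fix_count) (U V : finType) (A : {set U}) (B : {set V}) mu nu :
  conv x_count Phi A B mu nu =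
  (\sum_(x : U) ((x \in A) && (mu x == x)) * Phi U V (A :\ x) B mu nu)%N.
Proof.
apply/esym; rewrite /conv.
transitivity (\sum_(A1 in [set [set x] | x in A]) x_count A1 (set0 : {set V}) mu nu *
    Phi U V (A :\: A1) B mu nu)%N.
  rewrite big_imset => [|x y _ _ /set1_inj //] /=.
  rewrite [RHS]big_mkcond /=; apply: eq_bigr => x _.
  rewrite /x_count cards1 !eqxx imset_set1 (inj_eq set1_inj) /=.
  by case: (x \in A) => //; rewrite mul0n.
rewrite [RHS](bigID (fun A1 : {set U} => #|A1| == 1%N)) /= [X in (_ + X)%N]big1 ?addn0 => [|A1].
  apply: eq_big => [A1|A1 _].
    apply/imsetP/andP => [[x xA ->]|[sA /cards1P[x ex]]].
      by rewrite sub1set cards1.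
    by exists x => //; rewrite -sub1set -ex.
  rewrite (bigD1 set0) ?sub0set //= big1 ?addn0 ?setD0 // => B1 /andP[_ /negPf nB].
  by rewrite /x_count nB andbF.
by case/andP => _ /negPf nA; rewrite big1 // => B1 _; rewrite /x_count nA.
Qed.

Lemma conv_y (Phi : fix_count) (U V : finType) (A : {set U}) (B : {set V}) mu nu :
  conv y_count Phi A B mu nu =
  (\sum_(y : V) ((y \in B) && (nu y == y)) * Phi U V A (B :\ y) mu nu)%N.
Proof.
apply/esym; rewrite /conv exchange_big /=.
transitivity (\sum_(B1 in [set [set y] | y in B]) y_count (set0 : {set U}) B1 mu nu *
    Phi U V A (B :\: B1) mu nu)%N.
  rewrite big_imset => [|x y _ _ /set1_inj //] /=.
  rewrite [RHS]big_mkcond /=; apply: eq_bigr => y _.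
  rewrite /y_count cards1 !eqxx imset_set1 (inj_eq set1_inj) /=.
  by case: (y \in B) => //; rewrite mul0n.
rewrite [RHS](bigID (fun B1 : {set V} => #|B1| == 1%N)) /= [X in (_ + X)%N]big1 ?addn0 => [|B1].
  apply: eq_big => [B1|B1 _].
    apply/imsetP/andP => [[x xB ->]|[sB /cards1P[x ex]]].
      by rewrite sub1set cards1.
    by exists x => //; rewrite -sub1set -ex.
  rewrite (bigD1 set0) ?sub0set //= big1 ?addn0 ?setD0 // => A1 /andP[_ /negPf nA].
  by rewrite /y_count nA.
by case/andP => _ /negPf nB; rewrite big1 // => A1 _; rewrite /y_count nB andbF.
Qed.

Section Singletons.
Local Open Scope ring_scope.

Lemma perm_card1 (T : finType) (mu : {perm T}) : (#|T| <= 1)%N -> mu = 1%g.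
Proof. by move=> /fintype_le1P h; apply/permP => x; apply: h. Qed.

Lemma big_perm_card1 (R : nmodType) (T : finType) (F : {perm T} -> R) : (#|T| <= 1)%N ->
  \sum_(mu : {perm T}) F mu = F 1%g.
Proof.
move=> T1; rewrite (bigD1 1%g) //= big1 ?addr0 // => mu.
by rewrite (perm_card1 mu T1) eqxx.
Qed.

Lemma wt_card1 (R : comNzRingType) (q : nat -> R) (T : finType) (mu : {perm T}) :
  #|T| = 1%N -> cycle_weight q mu = q 1%N.
Proof.
move=> T1; have /card_gt0P[x _] : (0 < #|T|)%N by rewrite T1.
have X y : y = x by apply: (fintype_le1P (eq_leq T1)).
have -> : cycle_weight q mu = \prod_(c in [set [set x]]) q #|c|.
  apply: eq_bigl => c; rewrite inE; apply/imsetP/eqP => [[y _ ->]|->].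
    by apply/setP => z; rewrite inE (X z) (X y) eqxx porbit_id.
  by exists x => //; apply/setP => z; rewrite inE (X z) eqxx porbit_id.
by rewrite big_set1 cards1.
Qed.

Lemma wtx_card1 (T : finType) (mu : {perm T}) : #|T| = 1%N -> wtx mu = px 1.
Proof. exact: wt_card1. Qed.

Lemma wty_card1 (T : finType) (mu : {perm T}) : #|T| = 1%N -> wty mu = py 1.
Proof. exact: wt_card1. Qed.

Lemma cycle_series_singleton (Phi : fix_count) (m n : nat) (q : series (nat + nat)%type) :
  (m + n = 1)%N -> homog (fun a b => q *+ ((a == m) && (b == n))) ->
  (forall U V, fix_sum Phi U V = q *+ ((#|U| == m) && (#|V| == n))) -> cycle_series Phi = q.
Proof.
move=> mn hq hE; apply: seriesP => M; rewrite [LHS]/= hE !card_ord scoefMn.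
have -> : coef q M = coef q M *+ ((wx M == m) && (wy M == n)).
  have := homogE m n M hq; rewrite !scoefMn !eqxx mulr1n => {1}->.
  by case: (_ && _); rewrite ?mulr1n ?mulr0n.
case: (boolP (_ && _)) => [/andP[/eqP -> /eqP ->]|_]; last by rewrite mulr0n mulr0.
suff -> : (m`! * n`! = 1)%N by rewrite invr1 mul1r.
by case: m n mn {hq hE} => [|[|m]] [|[|n]].
Qed.

Lemma cycle_series_x : cycle_series x_count = px 1.
Proof.
apply: (@cycle_series_singleton _ 1 0) => // [m n M|U V].
  case: andP => [[/eqP -> /eqP ->]|_]; last by rewrite mulr0n scoef0 eqxx.
  rewrite mulr1n /= pnatr_eq0 eqb0 negbK => /eqP ->.
  by rewrite /wx /wy !wdegU.
rewrite /fix_sum /x_count cardsT -[[set: V] == _]cards_eq0 cardsT.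
case: (boolP (_ && _)) => [/andP[/eqP U1 /eqP V0]|].
  rewrite big_perm_card1 ?U1 // big_perm_card1 ?V0 //.
  by rewrite stabT !eqxx wtx_card1 // wty_card0 // mulr1.
move=> h; rewrite big1 // => mu _; rewrite big1 // => nu _.
by rewrite andbA (negPf h).
Qed.

Lemma cycle_series_y : cycle_series y_count = py 1.
Proof.
apply: (@cycle_series_singleton _ 0 1) => // [m n M|U V].
  case: andP => [[/eqP -> /eqP ->]|_]; last by rewrite mulr0n scoef0 eqxx.
  rewrite mulr1n /= pnatr_eq0 eqb0 negbK => /eqP ->.
  by rewrite /wx /wy !wdegU.
rewrite /fix_sum /y_count cardsT -[[set: U] == _]cards_eq0 cardsT.
case: (boolP (_ && _)) => [/andP[/eqP U1 /eqP V0]|].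
  rewrite big_perm_card1 ?U1 // big_perm_card1 ?V0 //.
  by rewrite stabT !eqxx wtx_card0 // wty_card1 // mul1r.
move=> h; rewrite big1 // => mu _; rewrite big1 // => nu _.
by rewrite andbA (negPf h).
Qed.

End Singletons.

(** * A black vertex with a tuple of trees *)

Section PlantedSpecies.
Variables (k : nat) (K : sspecies 'S_k).

(** The structures of F_k built from K: a black label and k structures of K. The operations
on them carry the prefix pl. *)
Definition pl (U V : finType) : finType := (U * {ffun 'I_k -> K U V})%type.

Section Fixed.
Variables U V : finType.
Implicit Type z : pl U V.

Definition pl_bl z : {set U} := [set u | (u == z.1) || [exists i, u \in bl (z.2 i)]].
Definition pl_wh z : {set V} := [set v | [exists i, v \in wh (z.2 i)]].
Definition pl_ok z : bool :=
  [&& [forall i, ok (z.2 i)],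
      [forall u, (u == z.1) + \sum_i (u \in bl (z.2 i)) <= 1]
    & [forall v, \sum_i (v \in wh (z.2 i)) <= 1]]%N.
Definition pl_ac z (sigma : 'S_k) : pl U V :=
  (z.1, [ffun j => ac (z.2 ((sigma^-1)%g j)) (rho (lift ord0 ((sigma^-1)%g j)) sigma)]).

Lemma pl_okP z : reflect [/\ forall i, ok (z.2 i),
   forall u, ((u == z.1) + \sum_i (u \in bl (z.2 i)) <= 1)%N
   & forall v, (\sum_i (v \in wh (z.2 i)) <= 1)%N] (pl_ok z).
Proof. by apply: (iffP and3P) => -[/forallP h1 /forallP h2 /forallP h3]. Qed.

Lemma eq_pl_bl z z' : z.1 = z'.1 -> (exists s : 'S_k, forall i, bl (z.2 i) = bl (z'.2 (s i))) ->
  pl_bl z = pl_bl z'.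
Proof.
move=> e [s h]; apply/setP => u; rewrite !inE e; congr orb.
apply/existsP/existsP => -[i]; first by rewrite h; exists (s i).
by exists ((s^-1)%g i); rewrite h permKV.
Qed.

Lemma eq_pl_wh z z' : (exists s : 'S_k, forall i, wh (z.2 i) = wh (z'.2 (s i))) ->
  pl_wh z = pl_wh z'.
Proof.
move=> [s h]; apply/setP => u; rewrite !inE.
apply/existsP/existsP => -[i]; first by rewrite h; exists (s i).
by exists ((s^-1)%g i); rewrite h permKV.
Qed.

Lemma pl_ok_ac z s : pl_ok z -> pl_ok (pl_ac z s).
Proof.
move=> /pl_okP[h1 h2 h3]; apply/pl_okP; split=> [i|u|v] /=.
- by rewrite ffunE; apply: ok_ac.
- under eq_bigr => i _ do rewrite ffunE bl_ac //.
  rewrite (reindex_inj (@perm_inj _ s)) /=.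
  by under eq_bigr do rewrite permK; apply: h2.
under eq_bigr => i _ do rewrite ffunE wh_ac //.
rewrite (reindex_inj (@perm_inj _ s)) /=.
by under eq_bigr do rewrite permK; apply: h3.
Qed.

Lemma pl_bl_ac z s : pl_ok z -> pl_bl (pl_ac z s) = pl_bl z.
Proof.
move=> /pl_okP[h1 _ _]; apply: eq_pl_bl => //; exists (s^-1)%g => i.
by rewrite ffunE bl_ac.
Qed.

Lemma pl_wh_ac z s : pl_ok z -> pl_wh (pl_ac z s) = pl_wh z.
Proof.
move=> /pl_okP[h1 _ _]; apply: eq_pl_wh => //; exists (s^-1)%g => i.
by rewrite ffunE wh_ac.
Qed.

Lemma pl_ac1 z : pl_ok z -> pl_ac z 1%g = z.
Proof.
move=> /pl_okP[h1 _ _]; rewrite /pl_ac [RHS]surjective_pairing; congr pair.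
by apply/ffunP => j; rewrite ffunE invg1 perm1 rho1 ac1.
Qed.

Lemma pl_acM z s s' : pl_ok z -> pl_ac z (s * s')%g = pl_ac (pl_ac z s) s'.
Proof.
move=> /pl_okP[h1 _ _]; rewrite /pl_ac /=; congr pair.
apply/ffunP => j; rewrite !ffunE invMg permM rhoM emb_lift permKV acM //.
Qed.

End Fixed.

Section Relabel.
Variables (U U' V V' : finType) (f : U -> U') (g : V -> V').

Definition pl_rl (z : pl U V) : pl U' V' := (f z.1, [ffun i => rl f g (z.2 i)]).

Lemma pl_bl_rl (z : pl U V) : pl_bl (pl_rl z) = f @: pl_bl z.
Proof.
apply/setP => u; rewrite !inE; apply/orP/imsetP => [[/eqP ->|/existsP[i]]|[u0]].
- by exists z.1; rewrite // inE eqxx.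
- rewrite ffunE bl_rl => /imsetP[u0 h ->]; exists u0 => //; rewrite inE; apply/orP; right.
  by apply/existsP; exists i.
rewrite inE => /orP[/eqP -> ->|/existsP[i h] ->]; first by left.
by right; apply/existsP; exists i; rewrite ffunE bl_rl imset_f.
Qed.

Lemma pl_wh_rl (z : pl U V) : pl_wh (pl_rl z) = g @: pl_wh z.
Proof.
apply/setP => u; rewrite !inE; apply/existsP/imsetP => [[i]|[u0]].
  rewrite ffunE wh_rl => /imsetP[u0 h ->]; exists u0 => //; rewrite inE.
  by apply/existsP; exists i.
by rewrite inE => /existsP[i h] ->; exists i; rewrite ffunE wh_rl imset_f.
Qed.

Lemma pl_rl_ac (z : pl U V) s : injective f -> injective g -> pl_ok z ->
  pl_rl (pl_ac z s) = pl_ac (pl_rl z) s.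
Proof.
move=> fi gi /pl_okP[h1 _ _]; rewrite /pl_ac /pl_rl /=; congr pair.
by apply/ffunP => j; rewrite !ffunE rl_ac.
Qed.

Lemma pl_rl_inj : injective f -> injective g -> injective pl_rl.
Proof.
move=> fi gi [x W] [x' W'] [/fi -> e]; congr pair; apply/ffunP => i.
by apply: (rl_inj fi gi); have /ffunP/(_ i) := e; rewrite !ffunE.
Qed.

Lemma pl_ok_rlE (z : pl U V) : injective f -> injective g -> (forall i, ok (z.2 i)) ->
  pl_ok (pl_rl z) = pl_ok z.
Proof.
move=> fi gi okz; have okz' i : ok ((pl_rl z).2 i) by rewrite ffunE; apply: ok_rl.
have ez : [forall i, ok (z.2 i)] by apply/forallP.
have ez' : [forall i, ok ((pl_rl z).2 i)] by apply/forallP.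
have nr (T T' : finType) (h : T -> T') (u : T') (D : {set T}) : ~~ [exists x, u == h x] -> (u \in h @: D) = false.
  by move=> n; apply: contraNF n => /imsetP[x _ ->]; apply/existsP; exists x.
rewrite /pl_ok ez ez' /=; congr andb.
  apply/forallP/forallP => [h u|h u].
    have := h (f u); rewrite (inj_eq fi).
    by under eq_bigr do rewrite ffunE bl_rl (mem_imset _ _ fi).
  case: (boolP [exists x, u == f x]) => [/existsP[x /eqP ->]|nx].
    rewrite (inj_eq fi) (eq_bigr (fun i => nat_of_bool (x \in bl (z.2 i)))) => [|i _].
      exact: h.
    by rewrite ffunE bl_rl (mem_imset _ _ fi).
  rewrite big1 => [|i _]; last by rewrite ffunE bl_rl nr.
  by rewrite addn0; case: (_ == _).
apply/forallP/forallP => [h u|h u].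
  have := h (g u).
  by under eq_bigr do rewrite ffunE wh_rl (mem_imset _ _ gi).
case: (boolP [exists x, u == g x]) => [/existsP[x /eqP ->]|nx].
  rewrite (eq_bigr (fun i => nat_of_bool (x \in wh (z.2 i)))) => [|i _].
    exact: h.
  by rewrite ffunE wh_rl (mem_imset _ _ gi).
by rewrite big1 => [|i _]; last by rewrite ffunE wh_rl nr.
Qed.

Lemma pl_ok_rl (z : pl U V) : injective f -> injective g -> pl_ok z -> pl_ok (pl_rl z).
Proof. by move=> fi gi okz; rewrite pl_ok_rlE //; case/pl_okP: okz. Qed.

Lemma pl_rl_surj (z : pl U' V') : injective f -> injective g -> pl_ok z ->
  pl_bl z \subset f @: setT -> pl_wh z \subset g @: setT ->
  exists2 z0, pl_ok z0 & pl_rl z0 = z.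
Proof.
move=> fi gi okz /subsetP bs /subsetP ws; have /pl_okP[h1 _ _] := okz.
have /imsetP[x0 _ ex] : z.1 \in f @: setT by apply: bs; rewrite inE eqxx.
have /choice[W0 hW] : forall i, exists w, ok w /\ rl f g w = z.2 i.
  move=> i; have [||w okw e] := @rl_surj _ K _ _ _ _ f g (z.2 i) fi gi (h1 i).
  - by apply/subsetP => u h; apply: bs; rewrite inE; apply/orP; right; apply/existsP; exists i.
  - by apply/subsetP => u h; apply: ws; rewrite inE; apply/existsP; exists i.
  by exists w.
have e : pl_rl (x0, [ffun i => W0 i]) = z.
  rewrite [RHS]surjective_pairing ex /pl_rl /=; congr pair; apply/ffunP => i.
  by rewrite !ffunE; case: (hW i).
exists (x0, [ffun i => W0 i]) => //; rewrite -pl_ok_rlE ?e // => i.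
by rewrite ffunE; case: (hW i).
Qed.

End Relabel.

Lemma pl_rl_id (U V : finType) (z : pl U V) : pl_rl id id z = z.
Proof.
rewrite /pl_rl [RHS]surjective_pairing; congr pair; apply/ffunP => i.
by rewrite ffunE rl_id.
Qed.

Lemma pl_rl_comp (U U' U'' V V' V'' : finType) (f : U -> U') (g : V -> V')
    (f' : U' -> U'') (g' : V' -> V'') (z : pl U V) :
  pl_rl f' g' (pl_rl f g z) = pl_rl (f' \o f) (g' \o g) z.
Proof.
rewrite /pl_rl /=; congr pair; apply/ffunP => i.
by rewrite !ffunE rl_comp.
Qed.

Lemma pl_rl_congr (U U' V V' : finType) (f f' : U -> U') (g g' : V -> V') (z : pl U V) :
  pl_ok z -> {in pl_bl z, f =1 f'} -> {in pl_wh z, g =1 g'} -> pl_rl f g z = pl_rl f' g' z.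
Proof.
move=> /pl_okP[h1 _ _] hf hg; rewrite /pl_rl hf ?inE ?eqxx //; congr pair.
apply/ffunP => i; rewrite !ffunE; apply: rl_congr => // [u h|v h].
  by apply: hf; rewrite inE; apply/orP; right; apply/existsP; exists i.
by apply: hg; rewrite inE; apply/existsP; exists i.
Qed.

Definition planted : sspecies 'S_k := @SSpecies 'S_k pl
  (fun U V => @pl_ok U V) (fun U V => @pl_bl U V) (fun U V => @pl_wh U V)
  pl_rl (fun U V => @pl_ac U V)
  pl_ok_rl pl_bl_rl pl_wh_rl pl_rl_id pl_rl_comp pl_rl_congr pl_rl_inj pl_rl_surj
  pl_ok_ac pl_bl_ac pl_wh_ac pl_ac1 pl_acM pl_rl_ac.

Definition twist_of (sigma : 'S_k) (i : 'I_k) : 'S_k := rho (lift ord0 i) sigma.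

Lemma sum_bool_gt0 (I : finType) (P : pred I) : (0 < \sum_i P i)%N = [exists i, P i].
Proof.
apply/idP/existsP => [|[i Pi]]; last by rewrite (bigD1 i) //= Pi.
by rewrite lt0n => /sum_neq0[i _]; rewrite eqb0 negbK; exists i.
Qed.

(** The black label must be a fixed point of mu, and what remains is a family indexed by
'I_k that sigma permutes with the twists rho_i(sigma). *)
Lemma fix_count_planted sigma (U V : finType) (A : {set U}) (B : {set V}) mu nu :
  fixc planted sigma A B mu nu = conv x_count (tuple_count K sigma (twist_of sigma)) A B mu nu.
Proof.
transitivity (\sum_(x : U) ((x \in A) && (mu x == x)) *
   tuple_count K sigma (twist_of sigma) (A :\ x) B mu nu)%N.
  pose F x (W : {ffun 'I_k -> K U V}) : nat :=
    [&& pl_ok (x, W), pl_bl (x, W) == A, pl_wh (x, W) == B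
      & pl_ac (pl_rl mu nu (x, W)) sigma == (x, W)].
  transitivity (\sum_(p : pl U V) F p.1 p.2)%N; first by apply: eq_bigr => -[].
  rewrite -(pair_bigA _ F) /F.
  apply: eq_bigr => x _; rewrite /tuple_count big_distrr; apply: eq_bigr => W _ /=.
  rewrite mulnb; congr nat_of_bool; apply/idP/idP.
    case/and4P => /pl_okP /= [h1 h2 h3] /eqP bA /eqP wB /eqP[ex eW].
    have -> : x \in A by rewrite -bA inE eqxx.
    rewrite ex eqxx /=; apply/and4P; split; first exact/forallP.
    - apply/forallP => u; rewrite in_setD1 -bA inE /= -sum_bool_gt0.
      by have := h2 u; case: (u == x) => /=; case: (\sum_i _)%N => [|[|n]].
    - apply/forallP => v; rewrite -wB inE /= -sum_bool_gt0.
      by have := h3 v; case: (\sum_i _)%N => [|[|n]].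
    by apply/forallP => i; rewrite -{1}eW !ffunE permK.
  case/andP => /andP[xA /eqP ex] /and4P[/forallP h1 /forallP h2 /forallP h3 /forallP h4].
  have E2 u : ((u == x) + \sum_i (u \in bl (W i)) = (u \in A))%N.
    rewrite (eqP (h2 u)) in_setD1; case: eqP => [->|_]; by rewrite ?xA.
  apply/and4P; split.
  - apply/pl_okP; split=> //= u; first by rewrite E2; case: (_ \in _).
    by rewrite (eqP (h3 u)); case: (_ \in _).
  - apply/eqP/setP => u; rewrite inE /= -sum_bool_gt0.
    by have := E2 u; case: (u == x); case: (\sum_i _)%N => [|[|n]]; case: (_ \in _).
  - apply/eqP/setP => u; rewrite inE /= -sum_bool_gt0 (eqP (h3 u)).
    by case: (_ \in _).
  rewrite /pl_ac /pl_rl /= ex; apply/eqP; congr pair; apply/ffunP => j; rewrite !ffunE.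
  by have /eqP := h4 ((sigma^-1)%g j); rewrite permKV => ->.
by rewrite conv_x.
Qed.

End PlantedSpecies.

(** * Stable sets of structures *)

Lemma cycle_series_sum (I : finType) (Phi : I -> fix_count) :
  cycle_series (fun U V A B mu nu => \sum_i Phi i U V A B mu nu)%N = (\sum_i cycle_series (Phi i))%R.
Proof.
apply: seriesP => M; rewrite scoef_sum [LHS]/= -GRing.mulr_sumr; congr (_ * _)%R.
rewrite -scoef_sum; congr (coef _ M); rewrite /fix_sum [RHS]exchange_big; apply: eq_bigr => mu _.
rewrite [RHS]exchange_big; apply: eq_bigr => nu _.
by rewrite GRing.sumrMnr.
Qed.

Section Sets.
Variables (gT : finGroupType) (K : sspecies gT) (sigma : gT).
Hypothesis bl_neq0 : forall U V (z : K U V), ok z -> bl z != set0.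

Section Fixed.
Variables (U V : finType) (mu : {perm U}) (nu : {perm V}).

Definition step (z : K U V) : K U V := ac (rl mu nu z) sigma.

Lemma step_inj : {in @ok _ K U V &, injective step}.
Proof.
move=> z z' okz okz' e; apply: (rl_inj (@perm_inj _ mu) (@perm_inj _ nu)).
have ok1 : ok (rl mu nu z) by apply: ok_rl => //; apply: perm_inj.
have ok2 : ok (rl mu nu z') by apply: ok_rl => //; apply: perm_inj.
have := congr1 (fun z => ac z sigma^-1%g) e.
by rewrite -!acM // mulgV !ac1.
Qed.

Definition goodset (S : {set K U V}) (A : {set U}) (B : {set V}) : bool :=
  [&& [forall z in S, ok z], indicates (fun u => \sum_(z in S) (u \in bl z))%N A,
      indicates (fun v => \sum_(z in S) (v \in wh z))%N B & step @: S == S].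

End Fixed.

Definition set_count : fix_count := fun U V A B mu nu =>
  (\sum_(S : {set K U V}) goodset mu nu S A B)%N.

Definition set_count_n (n : nat) : fix_count := fun U V A B mu nu =>
  (\sum_(S : {set K U V}) ((#|S| == n) && goodset mu nu S A B))%N.

(** Nonempty supports make the members of a family pairwise distinct. A family with
disjoint supports is thus an enumeration of a set S of structures, and it is counted
for some tau if and only if S is stable, in which case tau is the permutation of the
indices induced on this enumeration. Each S has n! enumerations. *)
Lemma sum_tuple_count n U V (A : {set U}) (B : {set V}) mu nu :
  (\sum_(tau : 'S_n) tuple_count K tau (fun=> sigma) A B mu nu = set_count_n n A B mu nu * n`!)%N.
Proof.
pose P (W : {ffun 'I_n -> K U V}) := [&& [forall i, ok (W i)],
  indicates (fun u => \sum_i (u \in bl (W i))) A & indicates (fun v => \sum_i (v \in wh (W i))) B]%N.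
have Pinj W : P W -> injective W.
  case/and3P => /forallP okW /forallP cA _ i j e; apply/eqP; apply: contraT => ne.
  have /set0Pn[u ui] := bl_neq0 (okW i).
  have := cA u; rewrite (bigD1 i) //= (bigD1 j) 1?eq_sym //= -e ui.
  by case: (_ \in A); lia.
transitivity (\sum_(W | P W) (step mu nu @: (W @: setT) == W @: setT))%N.
  rewrite /tuple_count exchange_big [RHS]big_mkcond; apply: eq_bigr => W _ /=.
  case: (boolP (P W)) => [PW|nP]; last first.
    rewrite big1 // => tau _; apply/eqP; rewrite eqb0; apply: contra nP.
    by case/and4P => h1 h2 h3 _; apply/and3P.
  have /and3P[h1 h2 h3] := PW; rewrite h1 h2 h3 /=; have Wi := Pinj _ PW.
  case: eqP => [/= e|ne]; last first.
    rewrite big1 // => tau _; apply/eqP; rewrite eqb0; apply/negP => /forallP h; case: ne.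
    rewrite -imset_comp; apply/setP => z; apply/imsetP/imsetP => -[i _ ->].
      by exists (tau i); rewrite //= (eqP (h i)).
    exists ((tau^-1)%g i) => //=; have := h ((tau^-1)%g i).
    by rewrite permKV => /eqP.
  (* the permutation of the indices induced by a stable set *)
  have /choice[s hs] : forall i, exists j, step mu nu (W i) = W j.
    move=> i; have : step mu nu (W i) \in W @: setT.
      by rewrite -e; do 2!apply: imset_f.
    by case/imsetP => j _ ->; exists j.
  have si : injective s.
    move=> i j eij; apply: Wi; apply: (@step_inj _ _ mu nu); rewrite ?hs ?eij //;
    exact: (forallP h1).
  rewrite (bigD1 (perm si)) //= big1 => [|tau ne].
    by rewrite (_ : [forall i, _]) //; apply/forallP => i; rewrite permE -hs.
  apply/eqP; rewrite eqb0; apply: contra ne => /forallP h; apply/eqP/permP => i.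
  by apply: Wi; rewrite permE -hs (eqP (h i)).
rewrite (partition_big (fun W : {ffun 'I_n -> K U V} => W @: setT) xpredT) //=.
rewrite /set_count_n big_distrl /=; apply: eq_bigr => S _.
transitivity (\sum_(W : {ffun 'I_n -> K U V} | injectiveb W && (W @: setT == S))
   ((#|S| == n) && goodset mu nu S A B))%N.
  rewrite big_mkcond [RHS]big_mkcond; apply: eq_bigr => W _ /=.
  case: (W @: setT =P S) => [<-|]; rewrite ?andbF // !andbT.
  case: (boolP (injectiveb W)) => [/injectiveP Wi|nW]; last first.
    by case: (boolP (P W)) => // /Pinj/injectiveP; rewrite (negPf nW).
  rewrite card_imset // cardsT card_ord eqxx /goodset.
  have E (T : finType) (F : K U V -> {set T}) D :
      indicates (fun u => \sum_(z in W @: setT) (u \in F z))%N D =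
      indicates (fun u => \sum_i (u \in F (W i)))%N D.
    apply: eq_indicates => u; rewrite big_imset /=; last by move=> i j _ _; exact: Wi.
    by apply: eq_bigl => i; rewrite inE.
  rewrite !E; have -> : [forall z in W @: setT, ok z] = [forall i, ok (W i)].
    apply/forall_inP/forallP => [h i|h z /imsetP[i _ ->] //].
    by apply: h; apply: imset_f.
  by rewrite /P; case: (_ == _); case: [forall i, _]; case: indicates; case: indicates.
rewrite sum_nat_cond_const mulnC; case: (eqVneq #|S| n) => [cS|]; last by rewrite !mul0n.
congr (_ * _)%N; have := @card_inj_onto 'I_n _ S; rewrite card_ord => <- //.
Qed.

Lemma set_count_n0 U V (A : {set U}) (B : {set V}) mu nu :
  set_count_n 0 A B mu nu = unit_count A B mu nu.
Proof.
rewrite /set_count_n (bigD1 set0) //= big1 ?addn0 => [|S /negPf nS]; last by rewrite cards_eq0 nS.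
rewrite cards0 /= /goodset /unit_count imset0 eqxx andbT.
have -> : [forall z in set0, @ok _ K U V z] by apply/forall_inP => z; rewrite inE.
have E (T : finType) (F : K U V -> {set T}) (D : {set T}) :
    indicates (fun u => \sum_(z in set0) (u \in F z))%N D = (D == set0).
  apply/forallP/eqP => [h|-> u]; last by rewrite big_set0 inE.
  by apply/setP => u; rewrite inE; have := h u; rewrite big_set0; case: (u \in D).
by rewrite !E.
Qed.

Let st n (c : {set 'I_n.+1}) : 'I_n.+1 := odflt ord0 [pick i in c].

Let stP n (tau : 'S_n.+1) (c : {set 'I_n.+1}) : c \in porbits tau -> st c \in c.
Proof.
by rewrite /st => /imsetP[i _ ->]; case: pickP => [//|/(_ i)]; rewrite porbit_id.
Qed.

(** Naturality is inherited from the counts of families, through the division by n!. *)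
Lemma natural_set_count_n n : natural (set_count_n n).
Proof.
move=> U U' V V' f g A B mu mu' nu nu' fi gi muA nuB hf hg.
case: n => [|n]; first by rewrite !set_count_n0; apply: (natural_unit _ _ muA nuB).
apply/eqP; rewrite -(eqn_pmul2r (fact_gt0 n.+1)) -!sum_tuple_count; apply/eqP; apply: eq_bigr => tau _.
exact: (natural_tuple_count K (fun=> sigma) (@stP n tau)).
Qed.

Lemma stable_set_count_n n : stable (set_count_n n).
Proof.
move=> U V A B mu nu; case: n => [|n]; first by rewrite set_count_n0; apply: stable_unit.
move=> h; have : (set_count_n n.+1 A B mu nu * n.+1`! != 0)%N.
  by rewrite muln_eq0 negb_or h -lt0n fact_gt0.
rewrite -sum_tuple_count => /sum_neq0[tau _]; exact: (stable_tuple_count (@stP n tau)).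
Qed.

Lemma prod_const (I : Type) (r : seq I) (x : gT) : (\prod_(i <- r) x = x ^+ size r)%g.
Proof. by elim: r => [|i r IH]; rewrite ?big_nil ?expg0 // big_cons IH expgS. Qed.

(** The twists along a cycle c are all equal to sigma, hence their product is the power of
exponent #|c|. *)
Lemma cycle_series_set_count_n n : (cycle_series (set_count_n n) *+ n`! = \sum_(tau : 'S_n)
  \prod_(c in porbits tau) dilate #|c| (cycle_series (fixc K (sigma ^+ #|c|)%g)))%R.
Proof.
rewrite -cycle_series_muln; case: n => [|n].
  have c0 : (#|'I_0| <= 1)%N by rewrite card_ord.
  rewrite (big_perm_card1 _ c0) big1 => [|c /imsetP[[]] //].
  rewrite -cycle_series_unit; apply: cycle_series_ext => U V mu nu.
  by rewrite set_count_n0 muln1.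
transitivity (cycle_series (fun U V A B mu nu =>
    \sum_(tau : 'S_n.+1) tuple_count K tau (fun=> sigma) A B mu nu)%N).
  by apply: cycle_series_ext => U V mu nu; rewrite sum_tuple_count.
rewrite cycle_series_sum; apply: eq_bigr => tau _; rewrite (cycle_series_tuple_count K (fun=> sigma) (@stP n tau)).
by apply: eq_bigr => c _; rewrite /gprod prod_const size_traject.
Qed.

Lemma goodset_card U V (A : {set U}) (B : {set V}) mu nu (S : {set K U V}) :
  goodset mu nu S A B -> (#|S| <= #|A|)%N.
Proof.
case/and4P => /forall_inP okS /forallP cA _ _.
have -> : (#|A| = \sum_u \sum_(z in S) (u \in bl z))%N.
  rewrite -sum1_card big_mkcond; apply: eq_bigr => u _; rewrite (eqP (cA u)).
  by case: (u \in A).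
rewrite exchange_big -sum1_card; apply: leq_sum => z zS /=.
have /set0Pn[u uz] := bl_neq0 (okS z zS).
by rewrite (bigD1 u) //= uz.
Qed.

(** A set of structures with disjoint nonempty supports inside A has at most #|A| members. *)
Lemma set_countE N U V (A : {set U}) (B : {set V}) mu nu : (#|A| <= N)%N ->
  set_count A B mu nu = (\sum_(n < N.+1) set_count_n n A B mu nu)%N.
Proof.
move=> AN; rewrite /set_count_n exchange_big; apply: eq_bigr => S _ /=.
case: (boolP (goodset _ _ _ _ _)) => [gS|_]; last first.
  by rewrite big1 // => n _; rewrite andbF.
have lN : (#|S| < N.+1)%N by rewrite ltnS (leq_trans (goodset_card gS)).
rewrite (bigD1 (Ordinal lN)) //= eqxx big1 // => n /negPf ne.
by rewrite andbT; case: eqP => // e; rewrite -val_eqE /= e eqxx in ne.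
Qed.

Lemma natural_set_count : natural set_count.
Proof.
move=> U U' V V' f g A B mu mu' nu nu' fi gi muA nuB hf hg.
rewrite (@set_countE #|A|) ?(@set_countE #|A|) // ?card_imset //.
by apply: eq_bigr => n _; apply: natural_set_count_n.
Qed.

Lemma stable_set_count : stable set_count.
Proof.
move=> U V A B mu nu; rewrite (@set_countE #|A|) // => /sum_neq0[n _].
exact: stable_set_count_n.
Qed.

Lemma coef_set_count M N : (wx M <= N)%N ->
  coef (cycle_series set_count) M = (\sum_(n < N.+1) coef (cycle_series (set_count_n n)) M)%R.
Proof.
move=> MN; rewrite -scoef_sum -cycle_series_sum /= ; congr (_ * _)%R; congr (coef _ M).
apply: eq_bigr => mu _; apply: eq_bigr => nu _; congr (_ *+ _)%R.
by apply: set_countE; rewrite cardsT card_ord.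
Qed.

End Sets.

(** * A tree as a root with a set of planted trees *)

Lemma sum_eq_bool (I : finType) (P b : pred I) (c : bool) :
  (\sum_(i | P i) b i = c)%N <->
  (forall i j, P i -> P j -> b i -> b j -> i = j) /\ (c <-> exists2 i, P i & b i).
Proof.
split=> [e|[u ex]].
  split=> [i j Pi Pj bi bj|].
    apply/eqP/contraT => ne; move: e; rewrite (bigD1 i) // (bigD1 j) ?Pj 1?eq_sym //= bi bj.
    by case: c.
  split=> [ct|[i Pi bi]].
    have : (\sum_(i | P i) b i != 0)%N by rewrite e ct.
    by case/sum_neq0 => i Pi; rewrite eqb0 negbK; exists i.
  by move: e; rewrite (bigD1 i) //= bi; case: c.
case: c ex => [[/(_ isT)[i Pi bi] _]|[_ nex]].
  rewrite (bigD1 i) //= bi big1 // => j /andP[Pj ne]; apply/eqP; rewrite eqb0.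
  by apply: contra ne => bj; apply/eqP; apply: u.
by rewrite big1 // => i Pi; apply/eqP; rewrite eqb0; apply/negP => bi; have : false by apply: nex; exists i.
Qed.

Section Join.
Variable k : nat.
Let T := LT k.

Section Fixed.
Variables U V : finType.
Implicit Types (t : ltree k U V) (z : pl T U V) (S : {set pl T U V}) (y : V).

Definition proots z : {ffun 'I_k -> V} := [ffun i => (z.2 i : ltree k U V).1].

Definition graft y S : ltree k U V :=
  (y, [set n : lnode k U V | [exists z in S, (n == (z.1, (y, proots z)))
          || [exists i, n \in (z.2 i : ltree k U V).2]]]).

Lemma graftP y S b p c : (b, (p, c)) \in (graft y S).2 <->
  (exists2 z, z \in S & [/\ b = z.1, p = y & c = proots z]) \/
  (exists z i, z \in S /\ (b, (p, c)) \in (z.2 i : ltree k U V).2).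
Proof.
rewrite inE; split=> [/exists_inP[z zS /orP[/eqP[-> -> ->]|/existsP[i h]]]|].
- by left; exists z.
- by right; exists z, i.
case=> [[z zS [-> -> ->]]|[z [i [zS h]]]]; apply/exists_inP; exists z => //.
  by rewrite eqxx.
by apply/orP; right; apply/existsP; exists i.
Qed.

Definition graftable y S : Prop :=
  [/\ forall z, z \in S -> pl_ok z,
      forall z z' u, z \in S -> z' \in S -> u \in pl_bl z -> u \in pl_bl z' -> z = z',
      forall z z' v, z \in S -> z' \in S -> v \in pl_wh z -> v \in pl_wh z' -> z = z'
    & forall z v, z \in S -> v \in pl_wh z -> v <> y].

Lemma pl_ok_inner z : pl_ok z ->
  [/\ forall i, lvalid (z.2 i : ltree k U V),
      forall i, z.1 \notin lblacks (z.2 i : ltree k U V),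
      forall i j u, u \in lblacks (z.2 i : ltree k U V) ->
        u \in lblacks (z.2 j : ltree k U V) -> i = j
    & forall i j v, v \in lwhites (z.2 i : ltree k U V) ->
        v \in lwhites (z.2 j : ltree k U V) -> i = j].
Proof.
case/pl_okP => h1 h2 h3; split.
- by move=> i; apply/asboolP; exact: h1.
- move=> i; apply/negP => zi; have {}zi : z.1 \in bl (z.2 i) by [].
  by have := h2 z.1; rewrite eqxx (bigD1 i) // zi.
- move=> i j u ui uj; apply/eqP/contraT => ne; have := h2 u.
  have {}ui : u \in bl (z.2 i) by []. have {}uj : u \in bl (z.2 j) by [].
  by rewrite (bigD1 i) // (bigD1 j) 1?eq_sym // ui uj; case: (u == z.1) => /=; lia.
move=> i j v vi vj; apply/eqP/contraT => ne; have := h3 v.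
have {}vi : v \in wh (z.2 i) by []. have {}vj : v \in wh (z.2 j) by [].
by rewrite (bigD1 i) // (bigD1 j) 1?eq_sym // vi vj /=; lia.
Qed.

Lemma mem_pl_bl z u : u \in pl_bl z <->
  u = z.1 \/ exists i, u \in lblacks (z.2 i : ltree k U V).
Proof.
rewrite inE; split=> [/orP[/eqP|/existsP[i h]]|[->|[i h]]]; [by left | by right; exists i | by rewrite eqxx|].
by apply/orP; right; apply/existsP; exists i.
Qed.

Lemma mem_pl_wh z v : v \in pl_wh z <-> exists i, v \in lwhites (z.2 i : ltree k U V).
Proof. by rewrite inE; split=> [/existsP|/existsP]. Qed.

Section Good.
Variables (y : V) (S : {set pl T U V}).
Hypothesis g : graftable y S.

Lemma jok z : z \in S -> pl_ok z. Proof. by case: g => h _ _ _; apply: h. Qed.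

Lemma jvalid z i : z \in S -> lvalid (z.2 i : ltree k U V).
Proof. by move=> /jok/pl_ok_inner[]. Qed.

Lemma jdis_x z z' : z \in S -> z' \in S -> z.1 = z'.1 -> z = z'.
Proof.
move=> zS zS' e; case: g => _ h _ _; apply: (h _ _ z.1) => //; apply/mem_pl_bl; by left.
Qed.

Lemma jdis_xb z z' i : z \in S -> z' \in S -> z.1 \notin lblacks (z'.2 i : ltree k U V).
Proof.
move=> zS zS'; apply/negP => h; have e : z = z'.
  by case: g => _ d _ _; apply: (d _ _ z.1) => //; apply/mem_pl_bl; [left | right; exists i].
by have [_ /(_ i) + _ _] := pl_ok_inner (jok zS'); rewrite -{1}e h.
Qed.

Lemma jdis_b z z' i j u : z \in S -> z' \in S -> u \in lblacks (z.2 i : ltree k U V) ->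
  u \in lblacks (z'.2 j : ltree k U V) -> z = z' /\ i = j.
Proof.
move=> zS zS' h h'; have e : z = z'.
  by case: g => _ d _ _; apply: (d _ _ u) => //; apply/mem_pl_bl; right; [exists i | exists j].
split=> //; have [_ _ d _] := pl_ok_inner (jok zS); apply: d h _.
by rewrite e.
Qed.

Lemma jdis_w z z' i j v : z \in S -> z' \in S -> v \in lwhites (z.2 i : ltree k U V) ->
  v \in lwhites (z'.2 j : ltree k U V) -> z = z' /\ i = j.
Proof.
move=> zS zS' h h'; have e : z = z'.
  by case: g => _ _ d _; apply: (d _ _ v) => //; apply/mem_pl_wh; [exists i | exists j].
split=> //; have [_ _ _ d] := pl_ok_inner (jok zS); apply: d h _.
by rewrite e.
Qed.

Lemma jdis_y z i v : z \in S -> v \in lwhites (z.2 i : ltree k U V) -> v <> y.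
Proof. by move=> zS h; case: g => _ _ _ d; apply: (d z) => //; apply/mem_pl_wh; exists i. Qed.

Lemma root_wh t : t.1 \in lwhites t. Proof. by apply/lwhitesP; left. Qed.

Lemma child_wh t b p (c : {ffun 'I_k -> V}) i : (b, (p, c)) \in t.2 -> c i \in lwhites t.
Proof. by move=> h; apply/lwhitesP; right; exists b, p, c, i. Qed.

Lemma node_bl t b q : (b, q) \in t.2 -> b \in lblacks t.
Proof. by move=> h; apply/lblacksP; exists q. Qed.

Lemma graft_root z : z \in S -> (z.1, (y, proots z)) \in (graft y S).2.
Proof. by move=> zS; apply/graftP; left; exists z. Qed.

Lemma graft_inner z i n : z \in S -> n \in (z.2 i : ltree k U V).2 -> n \in (graft y S).2.
Proof. by case: n => b [p c] zS h; apply/graftP; right; exists z, i. Qed.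

Lemma under_mono (L L' : {set lnode k U V}) w b : L \subset L' -> under L w b -> under L' w b.
Proof.
move=> /subsetP s; elim=> {b} [b c h|b c b' p' c' i h h' _ IH]; first exact: under0 (s _ h).
exact: underS (s _ h) (s _ h') IH.
Qed.

Lemma inner_sub z i : z \in S -> (z.2 i : ltree k U V).2 \subset (graft y S).2.
Proof. by move=> zS; apply/subsetP => n; apply: graft_inner. Qed.

Lemma under_graft z i b : z \in S -> under (z.2 i : ltree k U V).2 (z.2 i : ltree k U V).1 b ->
  under (graft y S).2 y b.
Proof.
move=> zS; elim=> {b} [b c h|b c b' p' c' j h h' _ IH]; last first.
  exact: underS (graft_inner zS h) (graft_inner zS h') IH.
apply: (@underS _ _ _ _ _ _ c z.1 y (proots z) i).
- by rewrite ffunE; apply: graft_inner h.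
- exact: graft_root.
exact: under0 (graft_root zS).
Qed.

Lemma lvalid_graft : lvalid (graft y S).
Proof.
split.
- move=> b [p c] [p' c'] /graftP[[z zS [-> -> ->]]|[z [i [zS h]]]] /graftP[[z' zS' []]|[z' [i' [zS' h']]]].
  + by move=> /(jdis_x zS zS') -> -> ->.
  + by have := jdis_xb i' zS zS'; rewrite (node_bl h').
  + by move=> eb; have := jdis_xb i zS' zS; rewrite -eb (node_bl h).
  have [ez ei] := jdis_b zS zS' (node_bl h) (node_bl h').
  by move: h'; rewrite -ez -ei; apply: lfun h; apply: jvalid.
- move=> b p c i b' p' c' j /graftP[[z zS [-> _ ->]]|[z [l [zS h]]]]
    /graftP[[z' zS' [-> _ ->]]|[z' [l' [zS' h']]]].
  + rewrite !ffunE => e.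
    have hw : (z.2 i : ltree k U V).1 \in lwhites (z'.2 j : ltree k U V) by rewrite e root_wh.
    by have [-> ->] := jdis_w zS zS' (root_wh _) hw.
  + rewrite ffunE => e.
    have hw : (z.2 i : ltree k U V).1 \in lwhites (z'.2 l' : ltree k U V).
      by rewrite e; apply: child_wh h'.
    have [ez ei] := jdis_w zS zS' (root_wh _) hw.
    by case: (lroot (jvalid l' zS') h' (i := j)); rewrite -e -ez -ei.
  + rewrite ffunE => e.
    have hw : (z'.2 j : ltree k U V).1 \in lwhites (z.2 l : ltree k U V).
      by rewrite -e; apply: child_wh h.
    have [ez ei] := jdis_w zS' zS (root_wh _) hw.
    by case: (lroot (jvalid l zS) h (i := i)); rewrite e ez ei.
  move=> e; have hw : c i \in lwhites (z'.2 l' : ltree k U V).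
    by rewrite e; apply: child_wh h'.
  have [ez ei] := jdis_w zS zS' (child_wh i h) hw.
  by move: h'; rewrite -ez -ei => h'; apply: (lchild (jvalid l zS) h h' e).
- move=> b p c i /graftP[[z zS [_ _ ->]]|[z [l [zS h]]]].
    by rewrite ffunE; apply: jdis_y zS (root_wh _).
  exact: jdis_y zS (child_wh i h).
move=> b [p c] /graftP[[z zS [-> _ _]]|[z [i [zS h]]]]; first exact: under0 (graft_root zS).
exact: under_graft zS (lunder (jvalid i zS) h).
Qed.

Lemma mem_lblacks_graft u : u \in lblacks (graft y S) <-> exists2 z, z \in S & u \in pl_bl z.
Proof.
split=> [/lblacksP[[p c]] /graftP[[z zS [-> _ _]]|[z [i [zS h]]]]|[z zS /mem_pl_bl[->|[i /lblacksP[q h]]]]].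
- by exists z => //; apply/mem_pl_bl; left.
- by exists z => //; apply/mem_pl_bl; right; exists i; apply: node_bl h.
- exact: node_bl (graft_root zS).
exact: node_bl (graft_inner zS h).
Qed.

Lemma mem_lwhites_graft v : v \in lwhites (graft y S) <->
  v = y \/ exists2 z, z \in S & v \in pl_wh z.
Proof.
split=> [/lwhitesP[->|[b [p [c [i [/graftP[[z zS [_ _ ->]]|[z [j [zS h]]]] ->]]]]]]|].
- by left.
- by right; exists z => //; apply/mem_pl_wh; exists i; rewrite ffunE root_wh.
- by right; exists z => //; apply/mem_pl_wh; exists j; apply: child_wh h.
case=> [->|[z zS /mem_pl_wh[i /lwhitesP[->|[b [p [c [j [h ->]]]]]]]]]; first exact: root_wh.
  by have := child_wh i (graft_root zS); rewrite ffunE.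
exact: child_wh (graft_inner zS h).
Qed.

Definition subtree t w : ltree k U V := (w, [set n in t.2 | `[< under t.2 w n.1 >]]).

Lemma subtreeP t w n : n \in (subtree t w).2 <-> n \in t.2 /\ under t.2 w n.1.
Proof. by rewrite inE; split=> [/andP[h /asboolP]|[h h']] //; rewrite h; apply/asboolP. Qed.

Lemma graft_inner_bl z i b q : z \in S -> b \in lblacks (z.2 i : ltree k U V) ->
  (b, q) \in (graft y S).2 -> (b, q) \in (z.2 i : ltree k U V).2.
Proof.
case: q => p c zS hb /graftP[[z' zS' [eb _ _]]|[z' [j [zS' h]]]].
  by have := jdis_xb i zS' zS; rewrite -eb hb.
by have [-> ->] := jdis_b zS zS' hb (node_bl h).
Qed.

Lemma graft_inner_parent z i b p c : z \in S -> p \in lwhites (z.2 i : ltree k U V) ->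
  (b, (p, c)) \in (graft y S).2 -> b \in lblacks (z.2 i : ltree k U V).
Proof.
move=> zS hp /graftP[[z' zS' [_ ep _]]|[z' [j [zS' h]]]].
  by case: (jdis_y zS hp).
have [-> ->] := jdis_w zS zS' hp (lparent (jvalid j zS') h).
exact: node_bl h.
Qed.

(** Going down from the root of z.2 i one never leaves z.2 i: a node whose parent is a white
vertex of z.2 i belongs to z.2 i, as the supports of the grafted trees are disjoint and
avoid the root y. *)
Lemma subtree_graft z i : z \in S -> subtree (graft y S) (z.2 i : ltree k U V).1 = z.2 i.
Proof.
move=> zS; rewrite [RHS]surjective_pairing; congr pair; apply/setP => -[b q].
apply/idP/idP => [/subtreeP[h hu]|h]; last first.
  apply/subtreeP; split; first exact: graft_inner h.
  exact: under_mono (inner_sub i zS) (lunder (jvalid i zS) h).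
apply: graft_inner_bl => //; move: hu {h} => /= hu; elim: hu => {b} [b c h|b c b' p' c' j h h' _ IH].
  exact: graft_inner_parent (root_wh _) h.
have h2 := graft_inner_bl zS IH h'.
exact: graft_inner_parent (child_wh j h2) h.
Qed.

Lemma root_node b c : (b, (y, c)) \in (graft y S).2 ->
  exists2 z, z \in S & b = z.1 /\ c = proots z.
Proof.
move=> /graftP[[z zS [-> _ ->]]|[z [i [zS h]]]]; first by exists z.
by case: (jdis_y zS (lparent (jvalid i zS) h)).
Qed.

End Good.

(** The planted trees can be read off the graft: their black vertices are the children of
the root, and their trees are the subtrees below these. *)
Lemma graft_inj y y' S S' : graftable y S -> graftable y' S' -> graft y S = graft y' S' ->
  y = y' /\ S = S'.
Proof.
move=> gS gS' e; have ey : y = y' by have := congr1 fst e.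
split=> //; subst y'.
suff H S1 S2 : graftable y S1 -> graftable y S2 -> graft y S1 = graft y S2 -> S1 \subset S2.
  by apply/eqP; rewrite eqEsubset !H.
move=> {S S' gS gS' e} g1 g2 e; apply/subsetP => z zS.
have := graft_root y zS; rewrite e => /(root_node g2)[z' zS' [e1 e2]].
suff -> : z = z' by [].
rewrite [z]surjective_pairing [z']surjective_pairing e1; congr pair; apply/ffunP => i.
rewrite -(subtree_graft g1 i zS) -(subtree_graft g2 i zS') e; congr subtree.
by have /ffunP/(_ i) := e2; rewrite !ffunE.
Qed.

(** * Cutting a tree at its root *)

Section Split.
Variable t : ltree k U V.
Hypothesis tv : lvalid t.

Lemma not_under_top b c w b0 p0 (c0 : {ffun 'I_k -> V}) i : (b, (t.1, c)) \in t.2 ->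
  (b0, (p0, c0)) \in t.2 -> w = c0 i -> ~ under t.2 w b.
Proof.
move=> h h0 ew hu; case: hu h => [{}b c1 h1|{}b c1 b' p' c' j h1 h' _] h.
  by case: (lfun tv h h1) => e _; case: (lroot tv h0 (i := i)); rewrite -ew -e.
by case: (lfun tv h h1) => e _; case: (lroot tv h' (i := j)).
Qed.

Lemma under_trans w b c i b' p : (b, (p, c)) \in t.2 -> under t.2 w b -> under t.2 (c i) b' ->
  under t.2 w b'.
Proof.
move=> h hu; elim=> {b'} [b' c' h'|b' c1 b1 p1 c1' j h1 h1' _ IH].
  exact: underS h' h hu.
exact: underS h1 h1' IH.
Qed.

(** By induction along the path from the root to b: a cycle through b would pass through
the parent of b, hence through the previous black vertex on that path, and finally
through a black vertex whose parent is the root, which is nobody's child. *)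
Lemma no_cycle b p (c : {ffun 'I_k -> V}) i : (b, (p, c)) \in t.2 -> ~ under t.2 (c i) b.
Proof.
suff H : under t.2 t.1 b -> forall p (c : {ffun 'I_k -> V}) i,
    (b, (p, c)) \in t.2 -> ~ under t.2 (c i) b.
  by move=> h; apply: (H (lunder tv h) p c i h).
elim=> {b p c i} [b c0 h0|b c0 b1 p1 c1 j h0 h1 _ IH] p c i h.
  by case: (lfun tv h h0) => ep _; rewrite ep in h; apply: (not_under_top h h).
case: (lfun tv h h0) => ep _ hu; apply: (IH p1 c1 j h1).
have hu1 : under t.2 (c1 j) b by apply: (under0 (c := c)); rewrite -ep.
apply: (under_trans h hu1 (i := i)).
case: hu {IH hu1} h h0 => [{}b c2 h2|{}b c2 b2 p2 c2' l h2 h2' hu] h h0.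
  by case: (lfun tv h2 h0) => e _; have [eb _] := lchild tv h h1 e; rewrite -eb; apply: under0 h2.
by case: (lfun tv h2 h0) => e _; have [<- _] := lchild tv h2' h1 e.
Qed.

Lemma lvalid_subtree b p (c : {ffun 'I_k -> V}) i : (b, (p, c)) \in t.2 -> lvalid (subtree t (c i)).
Proof.
move=> h; split.
- by move=> b' q q' /subtreeP[h1 _] /subtreeP[h2 _]; apply: lfun h1 h2.
- by move=> b' p' c' j b1 p1 c1 j1 /subtreeP[h1 _] /subtreeP[h2 _]; apply: lchild h1 h2.
- move=> b' p' c' j /subtreeP[h1 hu] /= e; have [eb ej] := lchild tv h1 h e.
  by apply: (no_cycle h (i := i)); rewrite -eb.
move=> b' q /subtreeP[/= _ hu]; elim: hu => {b' q} [b' c' h'|b' c' b1 p1 c1 j h1 h2 hu IH].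
  by apply: (under0 (c := c')); apply/subtreeP; split=> //; apply: under0 h'.
apply: (@underS _ _ _ _ _ _ c' b1 p1 c1 j) IH; apply/subtreeP; split=> //=.
exact: underS h1 h2 hu.
Qed.

Lemma under_uniq b0 (c0 : {ffun 'I_k -> V}) i b1 (c1 : {ffun 'I_k -> V}) j b :
  (b0, (t.1, c0)) \in t.2 -> (b1, (t.1, c1)) \in t.2 ->
  under t.2 (c0 i) b -> under t.2 (c1 j) b -> c0 i = c1 j.
Proof.
move=> h0 h1; elim=> {b} [b c h|b c b' p' c' l h h' hu IH] hu1.
  case: hu1 h => [{}b c2 h2|{}b c2 b2 p2 c2' l h2 h2' hu] h.
    by case: (lfun tv h h2).
  case: (lfun tv h h2) => e _; have [eb _] := lchild tv h0 h2' e.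
  by case: (not_under_top h0 h1 (erefl (c1 j))); rewrite eb.
case: hu1 h => [{}b c2 h2|{}b c2 b2 p2 c2' l2 h2 h2' hu2] h.
  case: (lfun tv h h2) => e _; have [eb _] := lchild tv h' h1 e.
  by case: (not_under_top h1 h0 (erefl (c0 i))); rewrite -eb.
case: (lfun tv h h2) => e _; have [eb _] := lchild tv h' h2' e.
by apply: IH; rewrite eb.
Qed.

Definition pieces : {set pl T U V} :=
  [set (n.1, [ffun i => subtree t (n.2.2 i)] : {ffun 'I_k -> T U V}) | n : lnode k U V in
     [set n : lnode k U V in t.2 | n.2.1 == t.1]].

Lemma piecesP z : z \in pieces <->
  exists2 c : {ffun 'I_k -> V}, (z.1, (t.1, c)) \in t.2 & forall i, z.2 i = subtree t (c i).
Proof.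
split=> [/imsetP[[b [p c]]]|[c h e]].
  by rewrite inE /= => /andP[h /eqP ep] ->; exists c; rewrite -?ep //= => i; rewrite ffunE.
apply/imsetP; exists (z.1, (t.1, c)); first by rewrite inE h /= eqxx.
by rewrite [LHS]surjective_pairing; congr pair; apply/ffunP => i; rewrite ffunE e.
Qed.

Lemma pieces_x z z' : z \in pieces -> z' \in pieces -> z.1 = z'.1 -> z = z'.
Proof.
move=> /piecesP[c h e] /piecesP[c' h' e'] ez.
rewrite [z]surjective_pairing [z']surjective_pairing ez; congr pair.
apply/ffunP => l; rewrite e e'; rewrite ez in h.
by have := lfun tv h h' => -[->].
Qed.

Lemma pieces_b z z' i j u : z \in pieces -> z' \in pieces ->
  u \in lblacks (z.2 i : ltree k U V) -> u \in lblacks (z'.2 j : ltree k U V) ->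
  z = z' /\ i = j.
Proof.
move=> zP zP'; have /piecesP[c h e] := zP; have /piecesP[c' h' e'] := zP'.
rewrite e e' => /lblacksP[q /subtreeP[_ hu]] /lblacksP[q' /subtreeP[_ hu']].
have [ez ei] := lchild tv h h' (under_uniq h h' hu hu').
by split=> //; apply: pieces_x.
Qed.

Lemma pieces_w z z' i j v : z \in pieces -> z' \in pieces ->
  v \in lwhites (z.2 i : ltree k U V) -> v \in lwhites (z'.2 j : ltree k U V) ->
  z = z' /\ i = j.
Proof.
move=> zP zP'; have /piecesP[c h e] := zP; have /piecesP[c' h' e'] := zP'.
have eqz : c i = c' j -> z = z' /\ i = j.
  move=> ec; have [ez ei] := lchild tv h h' ec; split=> //; exact: pieces_x.
rewrite e e' => /lwhitesP /= [->|[b [p [c1 [l [/subtreeP[h1 hu] ->]]]]]] /lwhitesP /= [ev|[b' [p' [c1' [l' [/subtreeP[h1' hu'] ev]]]]]].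
- exact: eqz.
- have [eb _] := lchild tv h h1' ev.
  by case: (not_under_top h h' (erefl (c' j))); rewrite eb.
- have [eb _] := lchild tv h' h1 (esym ev).
  by case: (not_under_top h' h (erefl (c i))); rewrite eb.
have [eb _] := lchild tv h1 h1' ev.
by apply/eqz/(under_uniq h h' hu); rewrite eb.
Qed.

Lemma pieces_xb z z' i : z \in pieces -> z' \in pieces ->
  z.1 \notin lblacks (z'.2 i : ltree k U V).
Proof.
move=> /piecesP[c h e] /piecesP[c' h' e']; apply/negP; rewrite e' => /lblacksP[q /subtreeP[_ hu]].
exact: (not_under_top h h' (erefl (c' i))).
Qed.

Lemma sum_bool_le1 (I : finType) (b : pred I) :
  (forall i j, b i -> b j -> i = j) -> (\sum_i b i <= 1)%N.
Proof.
move=> ub; case: (pickP b) => [i bi|b0]; last by rewrite big1 // => i _; rewrite b0.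
rewrite (bigD1 i) //= bi big1 ?addn0 // => j ne; apply/eqP; rewrite eqb0.
by apply: contra ne => bj; apply/eqP/ub.
Qed.

Lemma graftable_pieces : graftable t.1 pieces.
Proof.
split.
- move=> z zP; apply/pl_okP; split.
  + move=> i; apply/asboolP; have /piecesP[c h e] := zP; rewrite e; exact: lvalid_subtree h.
  + move=> u; case: eqP => [->|_].
      rewrite big1 // => i _; apply/eqP; rewrite eqb0; exact: pieces_xb.
    by apply: sum_bool_le1 => i j hi hj; have [] := pieces_b zP zP hi hj.
  by move=> v; apply: sum_bool_le1 => i j hi hj; have [] := pieces_w zP zP hi hj.
- move=> z z' u zP zP' /mem_pl_bl[->|[i hi]] /mem_pl_bl[|[j hj]].
  + exact: pieces_x.
  + by have := pieces_xb j zP zP'; rewrite hj.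
  + by move=> eu; have := pieces_xb i zP' zP; rewrite -eu hi.
  by have [] := pieces_b zP zP' hi hj.
- by move=> z z' v zP zP' /mem_pl_wh[i hi] /mem_pl_wh[j hj]; have [] := pieces_w zP zP' hi hj.
move=> z v /piecesP[c h e] /mem_pl_wh[i]; rewrite e.
case/lwhitesP => /= [->|[b [p [c' [j [/subtreeP[h' _] ->]]]]]]; [exact: lroot h|exact: lroot h'].
Qed.

Lemma under_cases b : under t.2 t.1 b -> (exists c, (b, (t.1, c)) \in t.2) \/
  exists b0 (c0 : {ffun 'I_k -> V}) i, (b0, (t.1, c0)) \in t.2 /\ under t.2 (c0 i) b.
Proof.
elim=> {b} [b c h|b c b' p' c' i h h' _ [[c1 h1]|[b0 [c0 [j [h0 hu]]]]]].
- by left; exists c.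
- right; exists b', c1, i; split=> //; case: (lfun tv h' h1) => _ ec.
  by apply: (under0 (c := c)); rewrite -ec.
by right; exists b0, c0, j; split=> //; apply: underS h h' hu.
Qed.

Lemma graft_pieces : graft t.1 pieces = t.
Proof.
rewrite [RHS]surjective_pairing; congr pair; apply/setP => -[b [p c]].
apply/idP/idP => [/graftP[[z /piecesP[c' h e] [-> -> ->]]|[z [i [/piecesP[c' h e]]]]]|h].
- suff -> : proots z = c' by [].
  by apply/ffunP => i; rewrite ffunE e.
- by rewrite e => /subtreeP[].
apply/graftP; case: (under_cases (lunder tv h)) => [[c1 h1]|[b0 [c0 [i [h0 hu]]]]].
  case: (lfun tv h h1) => -> ->; left.
  exists (b, [ffun i => subtree t (c1 i)] : {ffun 'I_k -> T U V}).
    by apply/piecesP; exists c1 => // i; rewrite ffunE.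
  by split=> //; apply/ffunP => i; rewrite !ffunE.
right; exists (b0, [ffun i => subtree t (c0 i)] : {ffun 'I_k -> T U V}), i; split.
  by apply/piecesP; exists c0 => // j; rewrite ffunE.
by rewrite ffunE; apply/subtreeP.
Qed.

End Split.
End Fixed.
End Join.

(** * Equivariance of grafting *)

Section JoinEquivariance.
Variables (k : nat) (U V : finType).
Let T := LT k.
Let PL := planted T.
Implicit Types (z : pl T U V) (S : {set pl T U V}) (y : V).

Lemma graft_rel (f : U -> U) (g : V -> V) y S :
  lrel f g (graft y S) = graft (g y) (pl_rl f g @: S).
Proof.
have rootsE z : proots (pl_rl f g z) = [ffun i => g (proots z i)].
  by apply/ffunP => i; rewrite !ffunE.
rewrite [LHS]surjective_pairing; congr pair; apply/setP => -[b [p c]]; apply/idP/idP.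
  case/lrelP => b0 [p0 [c0 [/graftP[[z zS [-> -> ->]]|[z [i [zS h]]]] -> -> ->]]].
    by apply/graftP; left; exists (pl_rl f g z); rewrite ?imset_f ?rootsE.
  apply/graftP; right; exists (pl_rl f g z), i; rewrite imset_f // ffunE; split=> //.
  exact: lrel_mem.
case/graftP => [[_ /imsetP[z zS ->] [-> -> ->]]|[_ [i [/imsetP[z zS ->]]]]].
  by rewrite rootsE; apply: lrel_mem; apply: graft_root.
rewrite ffunE => /lrelP[b0 [p0 [c0 [h -> -> ->]]]]; apply: lrel_mem.
exact: graft_inner h.
Qed.

Section Act.
Variables (y : V) (S : {set pl T U V}) (sigma : 'S_k).
Hypothesis g : graftable y S.

Lemma ltwist_graft z i b tau : z \in S ->
  ltwist (z.2 i : ltree k U V) (rho (lift ord0 i) sigma) b tau -> ltwist (graft y S) sigma b tau.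
Proof.
move=> zS; elim=> {b tau} [b c h|b c b' p' c' j tau h h' _ IH]; last first.
  exact: ltwistS (graft_inner _ zS h) (graft_inner _ zS h') IH.
apply: (@ltwistS _ _ _ _ _ _ c z.1 y (proots z) i).
- by rewrite ffunE; apply: graft_inner h.
- exact: graft_root.
exact: ltwist0 (graft_root _ zS).
Qed.

(** Below the i-th child of a black vertex attached to the root, the twists that sigma
induces on the graft are those that rho_i(sigma) induces on the subtree; so sigma acts
on the planted trees as it does on F_k-structures. *)
Lemma graft_act : lact (graft y S) sigma = graft y ((fun z => pl_ac z sigma) @: S).
Proof.
have jv := lvalid_graft g.
have rootsE z : proots (pl_ac z sigma) = permc sigma (proots z).
  by apply/ffunP => i; rewrite !ffunE.
rewrite [LHS]surjective_pairing; congr pair; apply/setP => -[b [p c]]; apply/idP/idP.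
  case/lactP => c0 [tau [/graftP[[z zS [eb -> ->]]|[z [i [zS h]]]] ht ->]]; apply/graftP.
    left; exists (pl_ac z sigma); first exact: imset_f.
    have h0 := ltwist0 sigma (graft_root y zS).
    by rewrite eb in ht *; rewrite rootsE (ltwist_uniq jv ht h0).
  right; exists (pl_ac z sigma), (sigma i); split; first exact: imset_f.
  rewrite ffunE permK; apply/lactP; exists c0.
  have [tau0 ht0] := ltwist_ex (jvalid g i zS) (rho (lift ord0 i) sigma) h.
  exists tau0; split=> //; congr permc.
  by have -> := ltwist_uniq jv ht (ltwist_graft zS ht0).
case/graftP => [[_ /imsetP[z zS ->] [-> -> ->]]|[_ [i [/imsetP[z zS ->]]]]].
  rewrite rootsE; apply: lact_mem; first exact: (graft_root y zS).
  exact: (ltwist0 sigma (graft_root y zS)).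
rewrite ffunE => /lactP[c0 [tau [h ht ->]]]; apply: lact_mem; first exact: graft_inner h.
exact: ltwist_graft ht.
Qed.

End Act.

Variables (sigma : 'S_k) (mu : {perm U}) (nu : {perm V}).
Let stp := @step 'S_k PL sigma U V mu nu.

Lemma graft_step y S : graftable y S -> graftable (nu y) (pl_rl mu nu @: S) ->
  lact (lrel mu nu (graft y S)) sigma = graft (nu y) (stp @: S).
Proof.
move=> g g'; rewrite graft_rel graft_act //; congr graft; rewrite -imset_comp.
exact: eq_imset.
Qed.

Lemma graftable_image y S (h : pl T U V -> pl T U V) : graftable y S ->
  (forall z, z \in S -> pl_ok (h z)) ->
  (forall z, z \in S -> pl_bl (h z) = mu @: pl_bl z) ->
  (forall z, z \in S -> pl_wh (h z) = nu @: pl_wh z) -> graftable (nu y) (h @: S).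
Proof.
move=> [h1 h2 h3 h4] okh blh whh; split.
- by move=> _ /imsetP[z zS ->]; apply: okh.
- move=> _ _ u /imsetP[z zS ->] /imsetP[z' zS' ->]; rewrite !blh //.
  case/imsetP => x xz -> /imsetP[x' xz' /perm_inj e]; congr h; apply: h2 zS zS' xz _.
  by rewrite e.
- move=> _ _ u /imsetP[z zS ->] /imsetP[z' zS' ->]; rewrite !whh //.
  case/imsetP => x xz -> /imsetP[x' xz' /perm_inj e]; congr h; apply: h3 zS zS' xz _.
  by rewrite e.
move=> _ v /imsetP[z zS ->]; rewrite whh // => /imsetP[x xz ->] /perm_inj.
exact: h4 zS xz.
Qed.

Lemma graftable_rel y S : graftable y S -> graftable (nu y) (pl_rl mu nu @: S).
Proof.
move=> g; apply: graftable_image => // z zS; [|exact: pl_bl_rl|exact: pl_wh_rl].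
by apply: pl_ok_rl; [exact: perm_inj|exact: perm_inj|exact: jok g _ zS].
Qed.

Lemma graftable_step y S : graftable y S -> graftable (nu y) (stp @: S).
Proof.
move=> g; have okr z : z \in S -> pl_ok (pl_rl mu nu z).
  by move=> zS; apply: pl_ok_rl; [exact: perm_inj|exact: perm_inj|exact: jok g _ zS].
apply: graftable_image => // z zS.
- exact: pl_ok_ac (okr z zS).
- by rewrite /stp /step /= pl_bl_ac ?okr // pl_bl_rl.
by rewrite /stp /step /= pl_wh_ac ?okr // pl_wh_rl.
Qed.

Lemma graft_fixed y S : graftable y S ->
  (lact (lrel mu nu (graft y S)) sigma == graft y S) = (nu y == y) && (stp @: S == S).
Proof.
move=> g; rewrite graft_step //; last exact: graftable_rel.
apply/eqP/andP => [e|[/eqP -> /eqP ->] //].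
by have [-> ->] := graft_inj (graftable_step g) g e; rewrite !eqxx.
Qed.

Lemma goodsetP y S (A : {set U}) (B : {set V}) :
  (y \in B) && @goodset 'S_k PL sigma U V mu nu S A (B :\ y) <->
  [/\ graftable y S, lblacks (graft y S) = A, lwhites (graft y S) = B & stp @: S = S].
Proof.
split.
  case/andP => yB /and4P[/forall_inP okS /forallP bS /forallP wS /eqP sS].
  have b2 u := (sum_eq_bool (mem S) (fun z => u \in pl_bl z) (u \in A)).1 (eqP (bS u)).
  have w2 v := (sum_eq_bool (mem S) (fun z => v \in pl_wh z) (v \in B :\ y)).1 (eqP (wS v)).
  have g : graftable y S.
    split=> //.
    - by move=> z z' u zS zS' h h'; apply: (b2 u).1.
    - by move=> z z' u zS zS' h h'; apply: (w2 u).1.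
    move=> z v zS h e; have [_ e2] := w2 v.
    have vB : v \in B :\ y by apply/e2; exists z.
    by move: vB; rewrite in_setD1 e eqxx.
  split=> //.
    apply/setP => u; apply/idP/idP => [/mem_lblacks_graft|uA].
      by move/((b2 u).2.2).
    by apply/mem_lblacks_graft; apply/(b2 u).2.
  apply/setP => v; apply/idP/idP => [/mem_lwhites_graft[->//|/((w2 v).2.2)]|vB].
    by rewrite in_setD1 => /andP[].
  apply/mem_lwhites_graft; case: (eqVneq v y) => [->|ne]; [by left|right].
  by apply/(w2 v).2; rewrite in_setD1 ne.
case=> g bA wB sS; have yB : y \in B by rewrite -wB; apply/mem_lwhites_graft; left.
rewrite yB /=; have [h1 h2 h3 h4] := g; apply/and4P; split.
- exact/forall_inP.
- apply/forallP => u; apply/eqP.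
  apply: (sum_eq_bool (mem S) (fun z => u \in pl_bl z) (u \in A)).2; split.
    by move=> z z' zS zS' h h'; apply: h2 h h'.
  by rewrite -bA; exact: mem_lblacks_graft.
- apply/forallP => v; apply/eqP.
  apply: (sum_eq_bool (mem S) (fun z => v \in pl_wh z) (v \in B :\ y)).2; split.
    by move=> z z' zS zS' h h'; apply: h3 h h'.
  rewrite in_setD1 -wB; split=> [/andP[ne /mem_lwhites_graft[e|//]]|[z zS h]].
    by rewrite e eqxx in ne.
  apply/andP; split; first by apply/eqP; apply: h4 h.
  by apply/mem_lwhites_graft; right; exists z.
by apply/eqP.
Qed.

(** Grafting is a bijection from the pairs of a fixed root y and a stable set of planted
trees to the fixed trees: it is injective, equivariant and inverse to cutting at the
root. *)
Lemma fix_count_LT (A : {set U}) (B : {set V}) :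
  fixc T sigma A B mu nu = conv y_count (set_count PL sigma) A B mu nu.
Proof.
transitivity (\sum_(y : V) ((y \in B) && (nu y == y)) * set_count PL sigma A (B :\ y) mu nu)%N.
  rewrite /set_count; under [RHS]eq_bigr do rewrite big_distrr.
  pose D (p : V * {set pl T U V}) := ((p.1 \in B) && (nu p.1 == p.1)) &&
     @goodset 'S_k PL sigma U V mu nu p.2 A (B :\ p.1).
  have DP p : D p <-> [/\ graftable p.1 p.2, lblacks (graft p.1 p.2) = A,
      lwhites (graft p.1 p.2) = B & lact (lrel mu nu (graft p.1 p.2)) sigma = graft p.1 p.2].
    rewrite /D andbAC; split.
      case/andP => /goodsetP[g bA wB sS] nuy; split=> //.
      by apply/eqP; rewrite graft_fixed // nuy sS eqxx.
    case=> g bA wB /eqP; rewrite graft_fixed // => /andP[-> /eqP sS].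
    by rewrite andbT; apply/goodsetP.
  rewrite pair_bigA /=.
  transitivity #|[set p | D p]|; last first.
    rewrite -sum1dep_card big_mkcond; apply: eq_bigr => p _ /=.
    by rewrite /D; case: (_ && (nu _ == _)); case: (goodset _ _ _ _ _).
  rewrite -(card_in_imset (f := fun p => graft p.1 p.2)) => [|p q]; last first.
    rewrite !inE => /DP[g _ _ _] /DP[g' _ _ _] e.
    have [e1 e2] := graft_inj g g' e.
    by rewrite [p]surjective_pairing [q]surjective_pairing e1 e2.
  rewrite /fixc -big_mkcond /= sum1dep_card; apply: eq_card => t.
  rewrite inE; apply/and4P/imsetP => [[/asboolP tv /eqP tb /eqP tw /eqP tf]|[p]].
    exists (t.1, pieces t); last by rewrite /= graft_pieces.
    rewrite inE; apply/DP => /=; rewrite graft_pieces //; split=> //; exact: graftable_pieces.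
  rewrite inE => /DP[g bA wB sS] ->; split; [|exact/eqP..].
  by apply/asboolP; apply: lvalid_graft.
by rewrite conv_y.
Qed.

End JoinEquivariance.

Lemma pl_bl_neq0 k (U V : finType) (z : planted (LT k) U V) : ok z -> bl z != set0.
Proof. by move=> _; apply/set0Pn; exists z.1; rewrite inE eqxx. Qed.

Lemma cycle_series_LT k (sigma : 'S_k) :
  cycle_series (fixc (LT k) sigma) = (py 1 * cycle_series (set_count (planted (LT k)) sigma))%R.
Proof.
rewrite -cycle_series_y -cycle_series_conv; last exact: (stable_set_count (@pl_bl_neq0 k)).
- by apply: cycle_series_ext => U V mu nu; rewrite fix_count_LT.
- exact: natural_y.
- exact: (@natural_set_count _ (planted (LT k)) sigma (@pl_bl_neq0 k)).
exact: stable_y.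
Qed.

Lemma cycle_series_planted k (st : {set 'I_k} -> 'I_k) (sigma : 'S_k) (K : sspecies 'S_k) :
  (forall c, c \in porbits sigma -> st c \in c) ->
  cycle_series (fixc (planted K) sigma) = (px 1 *
    \prod_(c in porbits sigma) dilate #|c| (cycle_series (fixc K (ordered_rho sigma (st c)))))%R.
Proof.
move=> stP; rewrite -cycle_series_x.
have -> : (\prod_(c in porbits sigma) dilate #|c| (cycle_series (fixc K (ordered_rho sigma (st c)))) =
   cycle_series (tuple_count K sigma (twist_of sigma)))%R.
  rewrite (cycle_series_tuple_count K (twist_of sigma) stP); apply: eq_bigr => c cp.
  by rewrite /ordered_rho /gprod (porbit_st stP cp).
rewrite -cycle_series_conv; [|exact: natural_x|exact: (natural_tuple_count K _ stP)|exact: stable_x|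
  exact: (stable_tuple_count stP)].
by apply: cycle_series_ext => U V mu nu; rewrite fix_count_planted.
Qed.

(** * Coding trees as linear trees *)

(** On a cycle of length at least 3, a vertex of maximal rank would have two distinct
neighbors of smaller rank. *)
Lemma acyclic_rank (T : finType) (e : rel T) (rk : T -> nat) : symmetric e ->
  (forall x y, e x y -> rk x != rk y) ->
  (forall x y y', e x y -> e x y' -> rk y < rk x -> rk y' < rk x -> y = y')%N ->
  forall c, ucycle e c -> (size c <= 2)%N.
Proof.
move=> eC ne uq c; case: c => [//|x0 c0]; set c := x0 :: c0.
have xc : x0 \in c by rewrite inE eqxx.
(* turn the cycle so that it starts at a vertex of maximal rank *)
case: (arg_maxnP (P := mem c) rk xc) => x xin xmax /andP[cc uc].
have [i c' ec] := rot_to xin.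
have cc' : path.cycle e (x :: c') by rewrite -ec rot_cycle.
have uc' : uniq (x :: c') by rewrite -ec rot_uniq.
rewrite -(size_rot i c) ec.
have lt y : y \in x :: c' -> e x y -> (rk y < rk x)%N.
  move=> yin exy; rewrite ltn_neqAle eq_sym ne //=; apply: xmax.
  by move: yin; rewrite -ec mem_rot.
case/lastP: c' ec cc' uc' lt => [//|c' z] ec; case: c' ec => [//|y c'] ec.
rewrite /= rcons_path last_rcons => /and3P[exy _ ezx] /and3P[_ yN _] lt.
have ey : y = z.
  apply: (uq x) => //; first by rewrite eC.
    by apply: lt; rewrite ?inE ?eqxx ?orbT.
  by apply: lt; rewrite ?inE ?mem_rcons ?inE ?eqxx ?orbT // eC.
by rewrite ey mem_rcons inE eqxx in yN.
Qed.

Section Untie.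
Variable k : nat.

(** The parent comes in position k+1, which is the residue ord0. *)
Definition lcons (V : Type) (p : V) (c : {ffun 'I_k -> V}) : {ffun 'I_k.+1 -> V} :=
  [ffun a => if unlift ord0 a is Some i then c i else p].

Section Lcons.
Variable V : finType.
Implicit Types (p : V) (c : {ffun 'I_k -> V}) (s : {ffun 'I_k.+1 -> V}).

Lemma lcons0 p c : lcons p c ord0 = p.
Proof. by rewrite ffunE unlift_none. Qed.

Lemma lcons_lift p c i : lcons p c (lift ord0 i) = c i.
Proof. by rewrite ffunE liftK. Qed.

Lemma lcons_inj p c p' c' : lcons p c = lcons p' c' -> p = p' /\ c = c'.
Proof.
move=> e; split; first by rewrite -(lcons0 p c) e lcons0.
by apply/ffunP => i; rewrite -(lcons_lift p c) e lcons_lift.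
Qed.

Lemma lcons_ex s : exists p c, s = lcons p c.
Proof.
exists (s ord0), [ffun i => s (lift ord0 i)]; apply/ffunP => a; rewrite ffunE.
by case: unliftP => [i|] -> //; rewrite ffunE.
Qed.

Lemma permute_lcons tau p c : permute tau (lcons p c) = lcons p (permc tau c).
Proof.
apply/ffunP => a; rewrite ffunE; case: (unliftP ord0 a) => [i|] ->; last first.
  by rewrite lcons0 -{1}(emb0 tau) permK lcons0.
by rewrite lcons_lift -{1}(permKV tau i) -emb_lift permK lcons_lift ffunE.
Qed.

End Lcons.

Lemma map_lcons (V V' : finType) (g : V -> V') p (c : {ffun 'I_k -> V}) :
  [ffun a => g (lcons p c a)] = lcons (g p) [ffun i => g (c i)].
Proof.
apply/ffunP => a; rewrite ffunE; case: (unliftP ord0 a) => [i|] ->.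
  by rewrite !lcons_lift ffunE.
by rewrite !lcons0.
Qed.

Section Fixed.
Variables U V : finType.
Implicit Types (t : pretree k U V) (l : ltree k U V).

(** Of all the rotations of the neighbors of a black vertex, keep the one that starts with
the parent. *)
Definition untie t : ltree k U V :=
  (t.1, [set n : lnode k U V | `[< lin t n.1 (lcons n.2.1 n.2.2) >]]).

Definition tie l : pretree k U V :=
  (l.1, [set q | [exists n in l.2, [exists i, q == (n.1, rotate i (lcons n.2.1 n.2.2))]]]).

Lemma untieP t b p c : (b, (p, c)) \in (untie t).2 <-> lin t b (lcons p c).
Proof. by rewrite inE; split=> [/asboolP|h] //; apply/asboolP. Qed.

Lemma tieP l b s : (b, s) \in (tie l).2 <->
  exists p c i, (b, (p, c)) \in l.2 /\ s = rotate i (lcons p c).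
Proof.
rewrite inE; split=> [/exists_inP[[b' [p c]] h /existsP[i /eqP[-> ->]]]|[p [c [i [h ->]]]]].
  by exists p, c, i.
by apply/exists_inP; exists (b, (p, c)) => //; apply/existsP; exists i.
Qed.

Section FromCoding.
Variable t : pretree k U V.
Hypothesis tv : coding_tree t.

Lemma twist_untie sigma b tau : twist t sigma b tau -> ltwist (untie t) sigma b tau.
Proof.
elim=> {b tau} [b s ls s0|b s b' s' i tau ls ls' e _ IH].
  have [p [c es]] := lcons_ex s; rewrite es lcons0 in ls s0.
  by apply: (@ltwist0 _ _ _ _ _ _ c); apply/untieP; rewrite /= -s0.
have [p [c es]] := lcons_ex s; have [p' [c' es']] := lcons_ex s'.
rewrite es es' lcons0 lcons_lift in ls ls' e.
by apply: (@ltwistS _ _ _ _ _ _ c b' p' c' i) => //; apply/untieP; rewrite -?e.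
Qed.

Lemma under_untie b s : (b, s) \in t.2 -> under (untie t).2 (untie t).1 b.
Proof.
move=> bs; have [tau] := twist_ex tv 1%g bs; elim=> {b tau bs} [b s0 ls e|b s0 b' s' i tau ls ls' e _ IH].
  have [p [c es]] := lcons_ex s0; rewrite es lcons0 in ls e.
  by apply: (under0 (c := c)); apply/untieP; rewrite /= -e.
have [p [c es]] := lcons_ex s0; have [p' [c' es']] := lcons_ex s'.
rewrite es es' lcons0 lcons_lift in ls ls' e.
by apply: (@underS _ _ _ _ _ _ c b' p' c' i) => //; apply/untieP; rewrite -?e.
Qed.

(** In a tree every vertex has only one neighbor towards the root, and the children of b
are the neighbors of b for which this is b itself. *)
Lemma lvalid_untie : lvalid (untie t).
Proof.
have acyc := tv.1.2.
have tu := toward_uniq (@adjC _ _ _ t) (@adj_irr _ _ _ t) acyc.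
have wch b p (c : {ffun 'I_k -> V}) i : lin t b (lcons p c) ->
    c i <> t.1 /\ toward (adj t) (inr t.1) (inr (c i)) (inl b).
  move=> ls; have [bs ts] := ls; have [si _] := tv.2 _ _ bs.
  have ab : adj t (inr (c i)) (inl b).
    by rewrite adjC; apply/adjP; exists (lcons p c), (lift ord0 i); rewrite lcons_lift.
  have ne : p != c i.
    apply/eqP => e; have /eqP : ord0 = lift ord0 i by apply: si; rewrite lcons0 lcons_lift.
    by rewrite (negPf (neq_lift _ _)).
  rewrite lcons0 in ts.
  have nr : c i <> t.1.
    move=> er; have [eq0] : inr p = inr t.1 :> U + V.
      by apply: tu ts _; rewrite /toward connect0 andbT -er adjC.
    by rewrite eq0 er eqxx in ne.
  split=> //; apply: (toward_child (@adjC _ _ _ t) (@adj_irr _ _ _ t) acyc _ _ ab ts) => //.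
  by apply/eqP => -[].
split.
- move=> b [p c] [p' c'] /untieP h /untieP h'.
  by have [-> ->] := lcons_inj (lin_uniq tv h h').
- move=> b p c i b' p' c' j /untieP h /untieP h' e.
  have [_ t1] := wch _ _ _ i h; have [_ t2] := wch _ _ _ j h'.
  rewrite e in t1; have [eb] := tu _ _ _ _ t1 t2; split=> //.
  rewrite -eb in h'; have [_ ec] := lcons_inj (lin_uniq tv h h').
  have [si _] := tv.2 _ _ h.1; apply: (@lift_inj _ ord0); apply: si.
  by rewrite !lcons_lift e ec.
- by move=> b p c i /untieP /wch - /(_ i)[].
by move=> b [p c] /untieP[bs _]; apply: under_untie bs.
Qed.

Lemma untieK : tie (untie t) = t.
Proof.
rewrite [RHS]surjective_pairing; congr pair; apply/setP => -[b s]; apply/idP/idP.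
  case/tieP => p [c [i [/untieP[bs _] ->]]].
  by have [_ ->] := tv.2 _ _ bs; exists i.
move=> bs; have [s0 ls] := lin_ex tv bs; apply/tieP; have [p [c es]] := lcons_ex s0.
have [_ /(_ s)[/(_ bs)[i ->] _]] := tv.2 _ _ ls.1.
by exists p, c, i; rewrite -es; split=> //; apply/untieP; rewrite -es.
Qed.

Lemma lblacks_untie : lblacks (untie t) = blacks t.
Proof.
apply/setP => b; apply/lblacksP/imsetP => [[[p c] /untieP[bs _]]|[[b' s] bs ->]].
  by exists (b, lcons p c).
have [s0 ls] := lin_ex tv bs; have [p [c es]] := lcons_ex s0.
by exists (p, c); apply/untieP; rewrite -es.
Qed.

Lemma lwhites_untie : lwhites (untie t) = whites t.
Proof.
apply/setP => w; rewrite !inE; apply/idP/idP.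
  case/orP => [->//|/existsP[[b [p c]] /andP[/untieP[bs _] /codomP[i ->]]]].
  apply/orP; right; apply/existsP; exists b; apply/adjP; exists (lcons p c), (lift ord0 i).
  by rewrite lcons_lift.
case/orP => [->//|/existsP[b /adjP[s [i [bs <-]]]]].
have [s0 ls] := lin_ex tv bs; have [p [c es]] := lcons_ex s0.
have [_ /(_ s)[/(_ bs)[j ->] _]] := tv.2 _ _ ls.1.
have h : (b, (p, c)) \in (untie t).2 by apply/untieP; rewrite -es.
suff : s0 (i + j)%R \in lwhites (untie t) by rewrite inE ffunE.
rewrite es; case: (unliftP ord0 (i + j)%R) => [l|] ->.
  rewrite lcons_lift; exact: child_wh h.
by rewrite lcons0; exact: (lparent lvalid_untie h).
Qed.

Lemma untie_act sigma : untie (tree_act t sigma) = lact (untie t) sigma.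
Proof.
rewrite [RHS]surjective_pairing; congr pair; apply/setP => -[b [p c]].
apply/idP/idP => [/untieP ls'|/lactP[c0 [tau [/untieP ls ht ->]]]].
  have [s [tau [i [ls h _]]]] := act_mem ls'.1.
  have e := lin_uniq (coding_tree_act tv sigma) ls' (lin_act tv ls h).
  have [p0 [c0 es]] := lcons_ex s; rewrite es permute_lcons in e.
  have [ep ->] := lcons_inj e; apply/lactP; exists c0, tau; split=> //.
    by apply/untieP; rewrite ep -es.
  exact: twist_untie.
have [tau0 h0] := twist_ex tv sigma ls.1.
rewrite (ltwist_uniq lvalid_untie ht (twist_untie h0)); apply/untieP => /=.
by rewrite -permute_lcons; apply: lin_act.
Qed.

End FromCoding.

Section ToCoding.
Variable l : ltree k U V.
Hypothesis lv : lvalid l.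
Let t := tie l.

Lemma parent_neq_child b p (c : {ffun 'I_k -> V}) i : (b, (p, c)) \in l.2 -> p <> c i.
Proof.
by move=> h e; apply: (no_cycle lv h (i := i)); apply: (under0 (c := c)); rewrite -e.
Qed.

Lemma lcons_injective b p c : (b, (p, c)) \in l.2 -> injective (lcons p c).
Proof.
move=> h x y; case: (unliftP ord0 x) => [i|] ->; case: (unliftP ord0 y) => [j|] -> //;
rewrite ?lcons_lift ?lcons0.
- by move=> e; have [_ ->] := lchild lv h h e.
- by move/esym => /(parent_neq_child h).
by move=> /(parent_neq_child h).
Qed.

Lemma adj_tie b w : adj t (inl b) (inr w) <->
  exists p c, (b, (p, c)) \in l.2 /\ (w = p \/ exists i, w = c i).
Proof.
split=> [/adjP[s [i [/tieP[p [c [j [h ->]]]] <-]]]|[p [c [h hw]]]].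
  exists p, c; split=> //; rewrite ffunE.
  case: (unliftP ord0 (i + j)%R) => [a|] ->; first by right; exists a; rewrite lcons_lift.
  by left; rewrite lcons0.
have hs : (b, lcons p c) \in t.2 by apply/tieP; exists p, c, 0%R; rewrite rotate0.
apply/adjP; exists (lcons p c); case: hw => [->|[i ->]].
  by exists ord0; rewrite lcons0.
by exists (lift ord0 i); rewrite lcons_lift.
Qed.

Definition ancestors b : {set U} :=
  [set a | `[< exists p (c : {ffun 'I_k -> V}) i, (a, (p, c)) \in l.2 /\ under l.2 (c i) b >]].

Lemma ancestors_lt b p c b' p' (c' : {ffun 'I_k -> V}) i : (b, (p, c)) \in l.2 ->
  (b', (p', c')) \in l.2 -> p = c' i -> (#|ancestors b'| < #|ancestors b|)%N.
Proof.
move=> h h' e; rewrite e in h; apply: proper_card; apply/properP; split.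
  apply/subsetP => a; rewrite !inE => /asboolP[q [d [j [ha hu]]]]; apply/asboolP.
  by exists q, d, j; split=> //; apply: underS h h' hu.
exists b'; rewrite inE; first by apply/asboolP; exists p', c', i; split=> //; apply: under0 h.
apply/asboolP => -[q [d [j [ha hu]]]]; exact: (no_cycle lv ha hu).
Qed.

(** The distance to the root. It is read off the number of strict ancestors among the
black vertices; a white vertex other than the root lies one step below the black vertex
of which it is a child. *)
Definition tie_rank (x : U + V) : nat :=
  match x with
  | inl b => (#|ancestors b| * 2).+1
  | inr w => if [pick n in l.2 | w \in codom n.2.2] is Some n
             then (#|ancestors n.1| * 2).+2 else 0%N
  end.

Lemma rank_child b p (c : {ffun 'I_k -> V}) i : (b, (p, c)) \in l.2 ->
  tie_rank (inr (c i)) = (#|ancestors b| * 2).+2.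
Proof.
move=> h; rewrite /tie_rank; case: pickP => [[b' [p' c']]|/(_ (b, (p, c)))].
  by case/andP => h' /codomP[j e]; have [-> _] := lchild lv h h' e.
by rewrite h codom_f.
Qed.

Lemma rank_parent b p c : (b, (p, c)) \in l.2 -> (tie_rank (inr p) < tie_rank (inl b))%N.
Proof.
move=> h; rewrite /tie_rank; case: pickP => [[b' [p' c']] /andP[h' /codomP[j e]]|] //=.
have := ancestors_lt h h' e; lia.
Qed.

Lemma acyclic_tie : forall c, ucycle (adj t) c -> (size c <= 2)%N.
Proof.
have H b w : adj t (inl b) (inr w) ->
    (exists c, (b, (w, c)) \in l.2 /\ (tie_rank (inr w) < tie_rank (inl b))%N) \/
    (exists p (c : {ffun 'I_k -> V}) i, [/\ (b, (p, c)) \in l.2, w = c i &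
       (tie_rank (inl b) < tie_rank (inr w))%N]).
  move/adj_tie => [p [c [h [->|[i ->]]]]]; first by left; exists c; split=> //; apply: rank_parent h.
  by right; exists p, c, i; split=> //; rewrite (rank_child i h) /=.
apply: (acyclic_rank (rk := tie_rank)); first exact: adjC.
  case=> [b|w] [b'|w'] //.
    by case/H => [[c [_ lt]]|[p [c [i [_ _ lt]]]]]; [rewrite gtn_eqF | rewrite ltn_eqF].
  rewrite adjC => /H.
  by case=> [[c [_ lt]]|[p [c [i [_ _ lt]]]]]; [rewrite ltn_eqF | rewrite gtn_eqF].
case=> [b|w] [b1|w1] [b2|w2] //.
  move=> /H[[c [h _]]|[p [c [i [_ _ lt]]]]]; last by move=> _ lt'; move: lt lt'; lia.
  move=> /H[[c' [h' _]]|[p [c' [i [_ _ lt]]]]]; last by move=> _ lt'; move: lt lt'; lia.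
  by case: (lfun lv h h') => -> _.
rewrite ![adj t (inr w) _]adjC => /H[[c [h lt]]|[p [c [i [h e _]]]]].
  by move=> _ lt'; move: lt lt'; lia.
move=> /H[[c' [h' lt]]|[p' [c' [i' [h' e' _]]]]].
  by move=> _ lt'; move: lt lt'; lia.
by rewrite e in e'; have [-> _] := lchild lv h h' e'.
Qed.

Lemma tie_connect x : x \in vertices t -> connect (adj t) x (inr t.1).
Proof.
have bl b q : (b, q) \in l.2 -> connect (adj t) (inl b) (inr t.1).
  move=> h; elim: (lunder lv h) => {b q h} [b c h|b c b' p' c' i h h' _ IH].
    by apply: connect1; apply/adj_tie; exists l.1, c; split=> //; left.
  apply: (connect_trans (y := inr (c' i))).
    by apply: connect1; apply/adj_tie; exists (c' i), c; split=> //; left.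
  apply: (connect_trans (y := inl b')) IH; apply: connect1; rewrite adjC; apply/adj_tie.
  by exists p', c'; split=> //; right; exists i.
rewrite inE; case: x => [b|w].
  by case/imsetP => -[b' s] /tieP[p [c [i [h _]]]] ->; apply: bl h.
rewrite !inE => /orP[/eqP ->|/existsP[b ab]]; first exact: connect0.
apply: (connect_trans (y := inl b)); first by apply: connect1; rewrite adjC.
by have /adj_tie[p [c [h _]]] := ab; apply: bl h.
Qed.

Lemma coding_tie : coding_tree t.
Proof.
split; first split.
- move=> x y /tie_connect hx /tie_connect hy; apply: connect_trans hx _.
  by rewrite (sym_connect_sym (@adjC _ _ _ t)).
- exact: acyclic_tie.
move=> b s /tieP[p [c [i [h ->]]]]; split; first exact: rotate_inj (lcons_injective h).
move=> s'; split=> [/tieP[p' [c' [j [h' ->]]]]|[j ->]].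
  have [ep ec] := lfun lv h h'; exists (j - i)%R.
  by rewrite rotateD GRing.subrK ep ec.
by rewrite rotateD; apply/tieP; exists p, c, (j + i)%R.
Qed.

(** By induction from the root: if the parent of b is a child of b', then the neighbor of
this white vertex on the way to the root is b', and so that of b is this white vertex. *)
Lemma lin_tie b p c : (b, (p, c)) \in l.2 -> lin t b (lcons p c).
Proof.
have mem b0 p0 c0 : (b0, (p0, c0)) \in l.2 -> (b0, lcons p0 c0) \in t.2.
  by move=> h0; apply/tieP; exists p0, c0, 0%R; rewrite rotate0.
have aC := @adjC _ _ _ t; have aI := @adj_irr _ _ _ t.
move=> h; split; first exact: mem.
rewrite lcons0; have hu := lunder lv h; elim: hu p c h => {b} [b c0 h0|b c0 b' p' c' i h0 h' _ IH] p c h.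
  have [-> _] := lfun lv h h0; rewrite /toward connect0 andbT; apply/adj_tie.
  by exists l.1, c0; split=> //; left.
have [-> _] := lfun lv h h0.
have tw : toward (adj t) (inr t.1) (inr (c' i)) (inl b').
  apply: (toward_child aC aI acyclic_tie _ _ _ (IH _ _ h')) => //.
  - by apply/eqP => -[]; apply: (lroot lv h').
  - by rewrite aC; apply/adj_tie; exists p', c'; split=> //; right; exists i.
  by apply/eqP => -[]; apply: parent_neq_child h'.
apply: (toward_child aC aI acyclic_tie _ _ _ tw) => //.
- by apply/eqP => -[]; apply: (lroot lv h').
- by apply/adj_tie; exists (c' i), c0; split=> //; left.
apply/eqP => -[eb]; rewrite eb in h'; have [_ ec] := lfun lv h0 h'.
by apply: (parent_neq_child h0 (i := i)); rewrite ec.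
Qed.

Lemma tieK : untie t = l.
Proof.
rewrite [RHS]surjective_pairing; congr pair; apply/setP => -[b [p c]]; apply/idP/idP.
  move=> /untieP ls; have /tieP[p0 [c0 [i [h _]]]] := ls.1.
  by have [-> ->] := lcons_inj (lin_uniq coding_tie ls (lin_tie h)).
by move=> h; apply/untieP; apply: lin_tie.
Qed.

End ToCoding.
End Fixed.

Lemma untie_relabel (U U' V V' : finType) (f : U -> U') (g : V -> V') (t : pretree k U V) :
  bijective f -> bijective g -> coding_tree t ->
  untie (relabel f g t) = lrel f g (untie t).
Proof.
move=> bf bg tv; have tv' := coding_tree_relabel bf bg tv.
rewrite [RHS]surjective_pairing; congr pair; apply/setP => -[b [p c]]; apply/idP/idP.
  move=> /untieP ls; have /imsetP[[b0 s0] bs0 [eb _]] := ls.1.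
  have [s1 ls1] := lin_ex tv bs0; have [p1 [c1 es]] := lcons_ex s1.
  rewrite eb in ls *; have := lin_uniq tv' ls (lin_relabel bf bg ls1).
  rewrite es map_lcons => /lcons_inj[-> ->]; apply: lrel_mem; apply/untieP.
  by rewrite -es.
case/lrelP => b0 [p0 [c0 [/untieP ls -> -> ->]]]; apply/untieP.
by rewrite -map_lcons; apply: lin_relabel.
Qed.

End Untie.

Local Open Scope ring_scope.

(** * Cycle indices as series of counts *)

Lemma cycle_index2_series (gT : finGroupType) (F : species2 gT) (c : gT) (Phi : fix_count) :
  (forall m n (mu : 'S_m) (nu : 'S_n), #|fix2 F c mu nu| = Phi 'I_m 'I_n setT setT mu nu) ->
  cycle_index2 F c = cycle_series Phi.
Proof.
move=> h; apply: seriesP => M; rewrite (egf_coef _ (@homog_fix_sum Phi)).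
apply: eq_fsbigr => -[m n] _ /=; congr (_ * coef _ M).
by apply: eq_bigr => mu _; apply: eq_bigr => nu _; rewrite h.
Qed.

Lemma cycle_index2_Y (gT : finGroupType) (c : gT) : cycle_index2 (Y_species gT) c = py 1.
Proof.
rewrite -cycle_series_y; apply: cycle_index2_series => m n mu nu; rewrite /y_count stabT eqxx andbT.
rewrite -cards_eq0 !cardsT !card_ord.
case: (boolP (_ && _)) => h; last first.
  apply/eqP; rewrite cards_eq0; apply/eqP/setP => -[w hw]; exfalso.
  by move: h; rewrite !card_ord in hw; rewrite hw.
have hw : (#|'I_m| == 0%N) && (#|'I_n| == 1%N) by rewrite !card_ord.
have n1 : (#|'I_n| <= 1)%N by case/andP: hw => _ /eqP ->.
have /card_gt0P[w _] : (0 < #|'I_n|)%N by case/andP: hw => _ /eqP ->.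
have eqw x y : x = y :> 'I_n by apply: (fintype_le1P n1).
pose z0 : Y_species gT 'I_m 'I_n := exist _ w hw.
have eqz (x y : Y_species gT 'I_m 'I_n) : x = y by apply: val_inj; apply: eqw.
suff -> : fix2 (Y_species gT) c mu nu = [set z0]%SET by rewrite cards1.
by apply/setP => x; rewrite !inE (eqz x z0) eqxx; apply/eqP; apply: eqz.
Qed.

(** Untying is a bijection from the coding trees on all the labels to the linear trees
with full support, and it is equivariant. *)
Lemma cycle_index2_CT k (sigma : 'S_k) :
  cycle_index2 (CT_species k) sigma = cycle_series (fixc (LT k) sigma).
Proof.
apply: cycle_index2_series => m n mu nu.
have ct (z : CT_str k 'I_m 'I_n) : ctY (val z) by exact/asboolP/(valP z).
have ui : injective (fun z : CT_str k 'I_m 'I_n => untie (val z)).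
  move=> z z' e; apply: val_inj; have [v _ _] := ct z; have [v' _ _] := ct z'.
  by rewrite -(untieK v) e untieK.
rewrite /fixc -big_mkcond /= sum1dep_card -(card_imset _ ui).
have E (z : CT_str k 'I_m 'I_n) : (z \in fix2 (CT_species k) sigma mu nu) =
    (lact (lrel mu nu (untie (val z))) sigma == untie (val z)).
  rewrite inE -val_eqE /=; have [v _ _] := ct z.
  have bm := perm_bij mu; have bn := perm_bij nu.
  have v' := coding_tree_relabel bm bn v.
  rewrite -untie_relabel // -untie_act //.
  apply/eqP/eqP => [->//|e].
  by rewrite -[RHS](untieK v) -e untieK //; apply: coding_tree_act.
apply: eq_card => t; rewrite inE; apply/imsetP/and4P => [[z + ->]|[/asboolP tv /eqP tb /eqP tw tf]].
  rewrite E => f; have [v vb vw] := ct z; split=> //.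
  - exact/asboolP/lvalid_untie.
  - by rewrite lblacks_untie // vb.
  by rewrite lwhites_untie // vw.
have tc : `[< ctY (tie t) >].
  apply/asboolP; have v := coding_tie tv; split=> //.
    by rewrite -lblacks_untie // tieK.
  by rewrite -lwhites_untie // tieK.
by exists (exist _ (tie t) tc : CT_str k 'I_m 'I_n); rewrite ?E /= tieK.
Qed.

(** The same bijection applied to each of the k trees. *)
Lemma cycle_index2_F k (sigma : 'S_k) :
  cycle_index2 (F_species k) sigma = cycle_series (fixc (planted (LT k)) sigma).
Proof.
apply: cycle_index2_series => m n mu nu.
pose u (z : preF k 'I_m 'I_n) : pl (LT k) 'I_m 'I_n :=
  (z.1, [ffun i => untie (z.2 i)] : {ffun 'I_k -> LT k 'I_m 'I_n}).
have fa (z : F_str k 'I_m 'I_n) : F_axiom (val z) by exact/asboolP/(valP z).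
have ui (z z' : preF k 'I_m 'I_n) : (forall i, coding_tree (z.2 i)) -> (forall i, coding_tree (z'.2 i)) ->
    u z = u z' -> z = z'.
  move=> v v' [ex eW]; rewrite [z]surjective_pairing [z']surjective_pairing ex; congr pair.
  apply/ffunP => i; have /ffunP/(_ i) := eW; rewrite !ffunE => e.
  by rewrite -(untieK (v i)) e untieK.
have uvi : injective (fun z : F_str k 'I_m 'I_n => u (val z)).
  by move=> z z' e; apply: val_inj; have [v _ _ _ _] := fa z; have [v' _ _ _ _] := fa z'; apply: ui.
rewrite /fixc -big_mkcond /= sum1dep_card -(card_imset _ uvi).
have E (z : F_str k 'I_m 'I_n) : (z \in fix2 (F_species k) sigma mu nu) =
    (pl_ac (pl_rl mu nu (u (val z))) sigma == u (val z)).
  rewrite inE -val_eqE /=; have [v _ _ _ _] := fa z.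
  have bm := perm_bij mu; have bn := perm_bij nu.
  have v' i : coding_tree (relabel mu nu ((val z).2 i)) by apply: coding_tree_relabel.
  have <- : u (F_act_fun (F_map_fun mu nu (val z)) sigma) = pl_ac (pl_rl mu nu (u (val z))) sigma.
    rewrite /u /pl_ac /pl_rl /=; congr pair; apply/ffunP => i.
    by rewrite !ffunE untie_act // untie_relabel.
  apply/eqP/eqP => [->//|e]; apply: ui => // i; rewrite ffunE; apply: coding_tree_act; rewrite ffunE; exact: v'.
apply: eq_card => t; rewrite inE; apply/imsetP/and4P => [[z + ->]|[/pl_okP[tv t2 t3] /eqP tb /eqP tw tf]].
  rewrite E => f; have [v vd vx vb vw] := fa z; split=> //.
  - apply/pl_okP; split=> [i|x|y].
    + by rewrite ffunE; apply/asboolP/lvalid_untie.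
    + case: eqP => [->|_] /=.
        rewrite big1 // => i _; rewrite ffunE /= lblacks_untie //.
        by rewrite (negPf (vx i)).
      apply: sum_bool_le1 => i j; rewrite !ffunE /= !lblacks_untie // => hi hj.
      apply/eqP/contraT => ne; have [d _] := vd _ _ ne.
      by rewrite (disjointFr d hi) in hj.
    apply: sum_bool_le1 => i j; rewrite !ffunE /= !lwhites_untie // => hi hj.
    apply/eqP/contraT => ne; have [_ d] := vd _ _ ne.
    by rewrite (disjointFr d hi) in hj.
  - apply/eqP/setP => x; rewrite inE in_setT.
    have : x \in (val z).1 |: \bigcup_i blacks ((val z).2 i) by rewrite vb.
    rewrite in_setU1 => /orP[->//|/bigcupP[i _ h]]; apply/orP; right.
    by apply/existsP; exists i; rewrite ffunE /= lblacks_untie.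
  apply/eqP/setP => x; rewrite inE in_setT.
  have : x \in \bigcup_i whites ((val z).2 i) by rewrite vw.
  move=> /bigcupP[i _ h]; apply/existsP; exists i.
  by rewrite ffunE /= lwhites_untie.
have lv i : lvalid (t.2 i : ltree k 'I_m 'I_n) by apply/asboolP; exact: tv.
pose z0 : preF k 'I_m 'I_n := (t.1, [ffun i => tie (t.2 i : ltree k 'I_m 'I_n)]).
have uz : u z0 = t.
  rewrite [RHS]surjective_pairing; congr pair; apply/ffunP => i.
  by rewrite !ffunE /= tieK.
have zc i : coding_tree (z0.2 i) by rewrite ffunE; apply: coding_tie.
have zb i : blacks (z0.2 i) = bl (t.2 i).
  by rewrite -lblacks_untie //= !ffunE tieK.
have zw i : whites (z0.2 i) = wh (t.2 i).
  by rewrite -lwhites_untie //= !ffunE tieK.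
have tc : `[< F_axiom z0 >].
  apply/asboolP; split=> //.
  - move=> i j ne; rewrite !zb !zw; split.
      apply/pred0P => x /=; apply/negP => /andP[hi hj].
      have := t2 x; rewrite (bigD1 i) // (bigD1 j) 1?eq_sym // hi hj.
      by case: (x == t.1) => /=; lia.
    apply/pred0P => x /=; apply/negP => /andP[hi hj].
    by have := t3 x; rewrite (bigD1 i) // (bigD1 j) 1?eq_sym // hi hj /=; lia.
  - move=> i; rewrite zb; apply/negP => hi; have := t2 t.1.
    by rewrite eqxx (bigD1 i) // hi.
  - apply/setP => x; rewrite in_setT; have : x \in pl_bl t by rewrite tb.
    rewrite inE in_setU1 => /orP[->//|/existsP[i h]]; apply/orP; right.
    by apply/bigcupP; exists i => //; rewrite zb.
  apply/setP => x; rewrite in_setT; have : x \in pl_wh t by rewrite tw.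
  rewrite inE => /existsP[i h].
  by apply/bigcupP; exists i => //; rewrite zw.
by exists (exist _ z0 tc : F_str k 'I_m 'I_n); rewrite ?E /= uz.
Qed.

(** * Plethysm with the species of sets *)

(** The order of vanishing in the x-weight. Substituting for the variables p_n series of
order n makes each coefficient of the result a finite sum. *)
Definition xord (N : nat) (f : series (nat + nat)%type) : Prop :=
  forall M, (wx M < N)%N -> coef f M = 0.

Lemma xordM a b f g : xord a f -> xord b g -> xord (a + b) (f * g).
Proof.
move=> hf hg M lt; have [D uD hD] := ex_mdivs M.
rewrite (scoefM _ _ uD hD) big1 // => p _; rewrite big1 // => q _.
case: eqP => [e|]; last by rewrite mulr0n.
have eM : (wx p + wx q = wx M)%N by rewrite -e /wx wdegM.
have [pa|pa] := ltnP (wx p) a; first by rewrite hf // mul0r mul0rn.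
by rewrite (hg q) ?mulr0 ?mul0rn //; move: eM pa lt; lia.
Qed.

Lemma xord0 f : xord 0 f. Proof. by []. Qed.

Lemma xord_px : xord 1 (px 1).
Proof.
by move=> M /=; case: eqP => [->|//]; rewrite /wx wdegU.
Qed.

Lemma xord_dilate l N f : (0 < l)%N -> xord N f -> xord (l * N) (dilate l f).
Proof.
move=> l0 hf M lt; rewrite dilateE.
have [[d e]|nM] := pselect (exists d, M = ren (dilx l) d); last first.
  by rewrite coef_rename0 // => d e; apply: nM; exists d.
rewrite e (coef_rename (dilx_inj l0)) hf // -(ltn_pmul2l l0) mulnC.
by rewrite -(wx_dil l0) -e.
Qed.

Definition wz : {cmonom nat} -> nat := wdeg S.

Lemma xord_mono_eval (g : nat -> series (nat + nat)%type) d :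
  (forall i, xord i.+1 (g i)) -> xord (wz d) (mono_eval g d).
Proof.
move=> hg; rewrite /wz /wdeg /mono_eval; elim/big_rec2: _ => [|i f n _ IH]; first exact: xord0.
apply: xordM IH; elim: (d i) => [|j IH]; first by rewrite muln0; exact: xord0.
by rewrite exprS mulnS; apply: xordM.
Qed.

Definition cyctype (n : nat) (mu : 'S_n) : {cmonom nat} :=
  \big[mmul/mone]_(c in porbits mu) ucm #|c|.-1.

Lemma wz_cyctype n (mu : 'S_n) : wz (cyctype mu) = n.
Proof.
rewrite /wz wdeg_prod -[RHS]card_ord -(card_porbits_sum mu); apply: eq_bigr => c /porbits_gt0 c0.
by rewrite wdegU prednK.
Qed.

Lemma coef_cycle_index_sets (gT : finGroupType) (c : gT) d :
  coef (cycle_index1 (set_species gT) c) d =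
  (\sum_(n \in [set: nat]%classic) (n`!%:R^-1 : rat) * \sum_(mu : 'S_n) (d == cyctype mu)%:R)%R.
Proof.
apply: eq_fsbigr => n _; congr (_ * _); rewrite scoef_sum; apply: eq_bigr => mu _.
have -> : fix1 (set_species gT) c mu = [set: unit] by apply/setP => z; rewrite !inE.
by rewrite cardsT card_unit mulr1n /p_perm -mono_prod.
Qed.

Section Plethysm.
Variables (gT : finGroupType) (ZF : gT -> series (nat + nat)%type) (sigma : gT).
Hypothesis ZF1 : forall c, xord 1 (ZF c).

Definition cycle_products (n : nat) : series (nat + nat)%type :=
  \sum_(tau : 'S_n) \prod_(c in porbits tau) dilate #|c| (ZF (sigma ^+ #|c|)%g).

(** A monomial d of weight n contributes to the coefficient at M only if n <= wx M, since
its value has order n. The monomials that remain are cycle types of permutations of n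
points, and summing over permutations accounts for their coefficients. *)
Lemma coef_plethysm_sets M N : (wx M <= N)%N ->
  coef (plethysm (cycle_index1 (set_species gT)) ZF sigma) M =
  \sum_(n < N.+1) (n`!%:R^-1 : rat) * coef (cycle_products n) M.
Proof.
move=> MN; pose g i := dilate i.+1 (ZF (sigma ^+ i.+1)%g).
have g1 i : xord i.+1 (g i) by rewrite -[i.+1]muln1; apply: xord_dilate.
(* all the monomials that can contribute *)
pose r := undup (flatten [seq [seq cyctype mu | mu : 'S_n] | n <- iota 0 N.+1]).
have ct_r n (mu : 'S_n) : (n < N.+1)%N -> cyctype mu \in r.
  move=> nN; rewrite mem_undup; apply/flattenP; exists [seq cyctype mu | mu : 'S_n].
    by apply: (map_f (fun n => [seq cyctype mu | mu : 'S_n])); rewrite mem_iota.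
  exact: image_f.
have E d : coef (cycle_index1 (set_species gT) sigma) d =
    ((wz d)`!%:R^-1 : rat) * \sum_(mu : 'S_(wz d)) (d == cyctype mu)%:R.
  rewrite coef_cycle_index_sets (@fsum_seq _ [:: wz d]) ?big_seq1 // => n.
  rewrite mem_seq1 => ne; rewrite big1 ?mulr0 // => mu _.
  by case: eqP => // e; rewrite e wz_cyctype eqxx in ne.
transitivity (\sum_(d <- r) coef (cycle_index1 (set_species gT) sigma) d * coef (mono_eval g d) M).
  apply: fsum_seq => [|d dr]; first exact: undup_uniq.
  have [lt|ge] := ltnP (wx M) (wz d); first by rewrite [X in _ * X](xord_mono_eval g1) ?mulr0.
  rewrite E big1 ?mulr0 ?mul0r // => mu _; case: eqP => // e.
  by case/negP: dr; rewrite e; apply: ct_r; rewrite ltnS (leq_trans ge).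
transitivity (\sum_(n < N.+1) (n`!%:R^-1 : rat) * \sum_(mu : 'S_n) coef (mono_eval g (cyctype mu)) M).
  transitivity (\sum_(n < N.+1) (n`!%:R^-1 : rat) * \sum_(mu : 'S_n) \sum_(d <- r)
     (d == cyctype mu)%:R * coef (mono_eval g d) M); last first.
    apply: eq_bigr => n _; congr (_ * _); apply: eq_bigr => mu _.
    rewrite (bigD1_seq (cyctype mu)) ?undup_uniq ?ct_r //= eqxx mul1r big1 ?addr0 // => d /negPf ->.
    by rewrite mul0r.
  under [RHS]eq_bigr do rewrite exchange_big mulr_sumr.
  rewrite [RHS]exchange_big; apply: eq_big_seq => d dr /=.
  under [RHS]eq_bigr do rewrite -mulr_suml mulrA.
  rewrite -mulr_suml; congr (_ * _).
  rewrite -[LHS]/(coef (cycle_index1 (set_species gT) sigma) d) E.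
  have dN : (wz d < N.+1)%N.
    move: dr; rewrite mem_undup => /flattenP[_ /mapP[n nN ->] /imageP[mu _ ->]].
    by rewrite wz_cyctype; move: nN; rewrite mem_iota.
  rewrite (bigD1 (Ordinal dN)) //= [X in _ + X]big1 ?addr0 // => n ne.
  rewrite big1 ?mulr0 // => mu _; case: eqP => // e; case/eqP: ne; apply: val_inj => /=.
  by rewrite e wz_cyctype.
apply: eq_bigr => n _; congr (_ * _); rewrite /cycle_products scoef_sum.
apply: eq_bigr => mu _; congr (coef _ M); rewrite mono_eval_prod; apply: eq_bigr => c /porbits_gt0 c0.
by rewrite mono_evalU /g prednK.
Qed.

End Plethysm.

Lemma cycle_series_sets_plethysm (gT : finGroupType) (K : sspecies gT) (sigma : gT) :
  (forall U V (z : K U V), ok z -> bl z != finset.set0) ->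
  (forall c, xord 1 (cycle_series (fixc K c))) ->
  cycle_series (set_count K sigma) =
  plethysm (cycle_index1 (set_species gT)) (fun c => cycle_series (fixc K c)) sigma.
Proof.
move=> bl0 K1; apply: seriesP => M.
rewrite (coef_set_count _ bl0 (leqnn (wx M))) (coef_plethysm_sets _ K1 (leqnn _)).
apply: eq_bigr => n _; rewrite /cycle_products -(cycle_series_set_count_n _ bl0) scoefMn -[coef _ _ *+ _]mulr_natl mulKf //.
by rewrite pnatr_eq0 -lt0n fact_gt0.
Qed.

(** * Uniqueness of the solution *)

Definition agree (N : nat) (f g : series (nat + nat)%type) : Prop :=
  forall M, (wx M + wy M < N)%N -> coef f M = coef g M.

Lemma agreeM N f f' g g' : agree N f g -> agree N f' g' -> agree N (f * f') (g * g').
Proof.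
move=> h h' M lt; have [D uD hD] := ex_mdivs M.
rewrite !(scoefM _ _ uD hD); apply: eq_bigr => p _; apply: eq_bigr => q _.
case: eqP => [e|]; last by rewrite !mulr0n.
have ex : (wx p + wx q = wx M)%N by rewrite -e /wx wdegM.
have ey : (wy p + wy q = wy M)%N by rewrite -e /wy wdegM.
by rewrite h ?h' //; move: ex ey lt; lia.
Qed.

Lemma agree_refl N f : agree N f f. Proof. by []. Qed.

Lemma agree_prod N (I : Type) (r : seq I) (P : pred I) (F G : I -> series (nat + nat)%type) :
  (forall i, P i -> agree N (F i) (G i)) ->
  agree N (\prod_(i <- r | P i) F i) (\prod_(i <- r | P i) G i).
Proof.
move=> h; elim/big_rec2: _ => [|i f g Pi IH]; first exact: agree_refl.
by apply: agreeM => //; apply: h.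
Qed.

(** Dilation does not decrease weights. *)
Lemma agree_dilate N l f g : (0 < l)%N -> agree N f g -> agree N (dilate l f) (dilate l g).
Proof.
move=> l0 h M lt; rewrite !dilateE.
have [[d e]|nM] := pselect (exists d, M = ren (dilx l) d); last first.
  by rewrite !coef_rename0 // => d e; apply: nM; exists d.
rewrite e !(coef_rename (dilx_inj l0)) h //; move: lt; rewrite e wx_dil // wy_dil //.
by apply: leq_ltn_trans; rewrite leq_add // leq_pmulr.
Qed.

(** Every variable has positive weight. *)
Lemma agree_var N (i : nat + nat) f g : agree N f g -> agree N.+1 (var i * f) (var i * g).
Proof.
move=> h M lt; have [D uD hD] := ex_mdivs M.
rewrite !(scoefM _ _ uD hD); apply: eq_bigr => p _; apply: eq_bigr => q _.
case: eqP => [e|]; last by rewrite !mulr0n.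
have ex : (wx p + wx q = wx M)%N by rewrite -e /wx wdegM.
have ey : (wy p + wy q = wy M)%N by rewrite -e /wy wdegM.
rewrite /=; case: eqP => [ep|]; last by rewrite !mul0r.
have p0 : (0 < wx p + wy p)%N by rewrite ep /wx /wy !wdegU; case: (i).
by rewrite h //; move: ex ey lt p0; lia.
Qed.

Theorem theorem5p5 (k : nat) (k_gt0 : (0 < k)%N)
    (start : 'S_k -> {set 'I_k} -> 'I_k)
    (startP : forall (sigma : 'S_k) (c : {set 'I_k}),
       c \in porbits sigma -> start sigma c \in c) :
  let equations (ZCT ZF : 'S_k -> series (nat + nat)%type) : Prop :=
    (forall sigma : 'S_k,
       ZCT sigma = cycle_index2 (Y_species 'S_k) sigma *
                   plethysm (cycle_index1 (set_species 'S_k)) ZF sigma) /\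
    (forall sigma : 'S_k,
       ZF sigma = px 1 *
         \prod_(c in porbits sigma)
            dilate #|c| (ZCT (ordered_rho sigma (start sigma c)))) in
  equations (cycle_index2 (CT_species k)) (cycle_index2 (F_species k)) /\
  forall ZCT ZF : 'S_k -> series (nat + nat)%type,
    equations ZCT ZF ->
    ZCT = cycle_index2 (CT_species k) /\ ZF = cycle_index2 (F_species k).
Proof.
move=> equations.
have F1 ZCT ZF : equations ZCT ZF -> forall c, xord 1 (ZF c).
  by move=> [_ eF] c; rewrite eF -[1%N]addn0; apply: xordM; [exact: xord_px | exact: xord0].
have eqs : equations (cycle_index2 (CT_species k)) (cycle_index2 (F_species k)).
  have -> : cycle_index2 (CT_species k) = fun c => cycle_series (fixc (LT k) c).
    by apply/funext => c; apply: cycle_index2_CT.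
  have -> : cycle_index2 (F_species k) = fun c => cycle_series (fixc (planted (LT k)) c).
    by apply/funext => c; apply: cycle_index2_F.
  have eF sigma : cycle_series (fixc (planted (LT k)) sigma) = px 1 *
      \prod_(c in porbits sigma) dilate #|c| (cycle_series (fixc (LT k) (ordered_rho sigma (start sigma c)))).
    exact: (cycle_series_planted (LT k) (startP sigma)).
  split=> [sigma|//]; rewrite cycle_index2_Y cycle_series_LT; congr (_ * _).
  apply: cycle_series_sets_plethysm => [U V z|c]; first exact: pl_bl_neq0.
  by rewrite eF -[1%N]addn0; apply: xordM; [exact: xord_px | exact: xord0].
split=> // ZCT ZF eqs'.
have ag N : forall sigma, agree N (ZCT sigma) (cycle_index2 (CT_species k) sigma) /\
    agree N.+1 (ZF sigma) (cycle_index2 (F_species k) sigma).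
  have [eC eF] := eqs; have [eC' eF'] := eqs'.
  have CF n : (forall sigma, agree n (ZCT sigma) (cycle_index2 (CT_species k) sigma)) ->
      forall sigma, agree n.+1 (ZF sigma) (cycle_index2 (F_species k) sigma).
    move=> h sigma; rewrite eF eF'; apply: agree_var; apply: agree_prod => c /porbits_gt0 c0.
    exact: agree_dilate.
  (* by CF the series of F_k agree one weight further than those of the trees, and the
     first equation passes this on to the trees *)
  elim: N => [|N IH]; first by move=> sigma; split; [|apply: CF].
  suff h sigma : agree N.+1 (ZCT sigma) (cycle_index2 (CT_species k) sigma).
    by move=> sigma; split; [|apply: CF].
  rewrite eC eC'; apply: agreeM; first exact: agree_refl.
  move=> M lt; rewrite (coef_plethysm_sets _ (F1 _ _ eqs') (leqnn (wx M))).
  rewrite (coef_plethysm_sets _ (F1 _ _ eqs) (leqnn (wx M))).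
  apply: eq_bigr => n _; congr (_ * _); rewrite !scoef_sum; apply: eq_bigr => tau _.
  apply: (agree_prod (N := N.+1)) => // c /porbits_gt0 c0; apply: agree_dilate => //.
  by have [_] := IH (sigma ^+ #|c|)%g.
split; apply/funext => sigma; apply: seriesP => M.
  by have [h _] := ag (wx M + wy M).+1 sigma; apply: h.
by have [_ h] := ag (wx M + wy M)%N sigma; apply: h.
Qed.
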